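(* Let $f(\nu),g(\nu)$, $\nu\in\mathcal I$, be two differentiable functions on an interval $\mathcal I\subseteq\mathbb R$ with $f(\nu)-g(\nu)\neq0$ and $f'(\nu)g'(\nu)\neq0$, and let $\nu(u,v)$, $(u,v)\in\mathcal D$, be a differentiable function satisfying $\nu_u\nu_v\neq0$ and $\nu(u,v)\in\mathcal I$. Let $(u_0,v_0)\in\mathcal D$, $\nu_0=\nu(u_0,v_0)$, and let $\mathfrak a>0$, $\mathfrak b>0$ be two constants. Put $$I=\int_{\nu_0}^{\nu}\frac{f'(\nu)\,d\nu}{f(\nu)-g(\nu)},\qquad J=\int_{\nu_0}^{\nu}\frac{g'(\nu)\,d\nu}{g(\nu)-f(\nu)},$$ regarded as functions of $(u,v)$ through $\nu=\nu(u,v)$. If $$\mathfrak a^2e^{2I}\,(J_{uu}+I_uJ_u-J_u^2)+\mathfrak b^2e^{2J}\,(I_{vv}+I_vJ_v-I_v^2)=-f(\nu)\,g(\nu),$$ then there exists a unique (up to a motion) strongly regular space-like W-surface $S: z=z(u,v)$, $(u,v)\in\mathcal D_0\subset\mathcal D$, with invariants $$\nu_1=f(\nu),\quad \nu_2=g(\nu),\quad \gamma_1=\mathfrak b\,e^{J}\,I_v,\quad \gamma_2=-\mathfrak a\,e^{I}\,J_u.$$ Furthermore, $(u,v)$ are natural principal parameters on $S$.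
   Context: $\mathbb R^3_1$ is three-dimensional Minkowski space with flat metric of signature $(2,1)$. All functions are assumed smooth; $\mathcal D\subset\mathbb R^2$ is a domain and $\mathcal D_0$ is a neighborhood of $(u_0,v_0)$. A surface $z=z(u,v)$ in $\mathbb R^3_1$ is space-like if its induced metric is positive definite; its unit normal $l$ satisfies $l^2=-1$. Put $E=z_u^2$, $F=z_uz_v$, $G=z_v^2$, $L=lz_{uu}$, $M=lz_{uv}$, $N=lz_{vv}$. Surfaces are free of umbilical points and parameterized by principal parameters, i.e. $F=M=0$; the frame $z_u/\sqrt E,\ z_v/\sqrt G,\ l$ is positively oriented. The invariants of the surface are the principal curvatures and principal geodesic curvatures $$\nu_1=\frac LE,\quad\nu_2=\frac NG,\quad\gamma_1=-\frac{E_v}{2E\sqrt G},\quad\gamma_2=\frac{G_u}{2G\sqrt E}.$$ The surface is strongly regular if $(\nu_1-\nu_2)\gamma_1\gamma_2\neq0$ everywhere. It is a W-surface (Weingarten surface) with Weingarten functions $f,g$ if $\nu_1=f(\nu)$, $\nu_2=g(\nu)$ for some differentiable function $\nu(u,v)$, where $f'g'\neq0$, $f-g\neq0$. Principal parameters $(u,v)$ on a W-surface are called natural principal if the functions $\sqrt E\,e^{I}$ and $\sqrt G\,e^{J}$ are both constant. *)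

(* Defs.v *)
From Stdlib Require Import Reals.
From Coquelicot Require Import Coquelicot.
Open Scope R_scope.

Definition connected (D : R * R -> Prop) : Prop :=
  forall U V : R * R -> Prop,
    open U -> open V ->
    (forall p, D p -> U p \/ V p) ->
    (forall p, D p -> U p -> V p -> False) ->
    (forall p, D p -> U p) \/ (forall p, D p -> V p).

Definition planar_domain (D : R * R -> Prop) : Prop :=
  (exists p, D p) /\ open D /\ connected D.

Definition interval (Int : R -> Prop) : Prop :=
  forall x y t : R, Int x -> Int y -> x <= t <= y -> Int t.

(* An interval need not be open: at an endpoint belonging to it, [f] stands for
   a smooth extension of the function across that endpoint. *)
Definition smooth1 (Int : R -> Prop) (f : R -> R) : Prop :=
  forall (n : nat) (t : R), Int t -> ex_derive_n f n t.

Definition smooth2 (D : R * R -> Prop) (h : R -> R -> R) : Prop :=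
  forall (n : nat) (u v : R), D (u, v) -> ex_diff_n h n u v.

Definition du (h : R -> R -> R) (u v : R) : R := Derive (fun s => h s v) u.
Definition dv (h : R -> R -> R) (u v : R) : R := Derive (fun s => h u s) v.

Definition vec : Type := (R * R * R)%type.

Definition x1 (a : vec) : R := fst (fst a).
Definition x2 (a : vec) : R := snd (fst a).
Definition x3 (a : vec) : R := snd a.

Definition mink (a b : vec) : R := x1 a * x1 b + x2 a * x2 b - x3 a * x3 b.

Definition det3 (a b c : vec) : R :=
  x1 a * (x2 b * x3 c - x3 b * x2 c)
  - x2 a * (x1 b * x3 c - x3 b * x1 c)
  + x3 a * (x1 b * x2 c - x2 b * x1 c).

(* Motions are proper (determinant 1), since the frame of a surface is required
   to be positively oriented.  They may reverse the time orientation. *)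
Definition motion (T : R * R * R -> R * R * R) : Prop :=
  exists (A : R * R * R -> R * R * R) (b : R * R * R),
    is_linear A /\
    (forall x y, mink (A x) (A y) = mink x y) /\
    det3 (A (1, 0, 0)) (A (0, 1, 0)) (A (0, 0, 1)) = 1 /\
    (forall x, T x = plus (A x) b).

Definition surface : Type := R -> R -> R * R * R.

Definition zu (z : surface) : surface := fun u v =>
  (du (fun s t => x1 (z s t)) u v,
   du (fun s t => x2 (z s t)) u v,
   du (fun s t => x3 (z s t)) u v).

Definition zv (z : surface) : surface := fun u v =>
  (dv (fun s t => x1 (z s t)) u v,
   dv (fun s t => x2 (z s t)) u v,
   dv (fun s t => x3 (z s t)) u v).

Definition smooth_surface (D : R * R -> Prop) (z : surface) : Prop :=
  smooth2 D (fun u v => x1 (z u v)) /\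
  smooth2 D (fun u v => x2 (z u v)) /\
  smooth2 D (fun u v => x3 (z u v)).

Definition fE (z : surface) (u v : R) : R := mink (zu z u v) (zu z u v).
Definition fF (z : surface) (u v : R) : R := mink (zu z u v) (zv z u v).
Definition fG (z : surface) (u v : R) : R := mink (zv z u v) (zv z u v).

Definition fL (z l : surface) (u v : R) : R := mink (l u v) (zu (zu z) u v).
Definition fM (z l : surface) (u v : R) : R := mink (l u v) (zv (zu z) u v).
Definition fN (z l : surface) (u v : R) : R := mink (l u v) (zv (zv z) u v).

Definition space_like (D : R * R -> Prop) (z : surface) : Prop :=
  forall u v, D (u, v) ->
    forall a b : R, (a, b) <> (0, 0) ->
      0 < fE z u v * a ^ 2 + 2 * fF z u v * a * b + fG z u v * b ^ 2.

(* On a space-like surface this determines [l] at every point of [D]. *)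
Definition unit_normal (D : R * R -> Prop) (z l : surface) : Prop :=
  forall u v, D (u, v) ->
    mink (l u v) (l u v) = -1 /\
    mink (l u v) (zu z u v) = 0 /\
    mink (l u v) (zv z u v) = 0 /\
    0 < det3 (scal (/ sqrt (fE z u v)) (zu z u v))
             (scal (/ sqrt (fG z u v)) (zv z u v))
             (l u v).

Definition principal_parameters (D : R * R -> Prop) (z l : surface) : Prop :=
  forall u v, D (u, v) -> fF z u v = 0 /\ fM z l u v = 0.

Definition nu1 (z l : surface) (u v : R) : R := fL z l u v / fE z u v.
Definition nu2 (z l : surface) (u v : R) : R := fN z l u v / fG z u v.
Definition gamma1 (z : surface) (u v : R) : R :=
  - (dv (fE z) u v / (2 * fE z u v * sqrt (fG z u v))).
Definition gamma2 (z : surface) (u v : R) : R :=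
  du (fG z) u v / (2 * fG z u v * sqrt (fE z u v)).

Definition strongly_regular (D : R * R -> Prop) (z l : surface) : Prop :=
  forall u v, D (u, v) ->
    (nu1 z l u v - nu2 z l u v) * gamma1 z u v * gamma2 z u v <> 0.

Definition W_functions (Int : R -> Prop) (f g : R -> R) : Prop :=
  smooth1 Int f /\ smooth1 Int g /\
  (forall t, Int t -> f t - g t <> 0) /\
  (forall t, Int t -> Derive f t * Derive g t <> 0).

Definition W_surface_via (Int : R -> Prop) (f g : R -> R) (nu : R -> R -> R)
    (D : R * R -> Prop) (z l : surface) : Prop :=
  W_functions Int f g /\
  smooth2 D nu /\
  (forall u v, D (u, v) ->
     Int (nu u v) /\ nu1 z l u v = f (nu u v) /\ nu2 z l u v = g (nu u v)).

Definition W_surface (Int : R -> Prop) (f g : R -> R)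
    (D : R * R -> Prop) (z l : surface) : Prop :=
  exists nu : R -> R -> R, W_surface_via Int f g nu D z l.

(* The function I of the pair (f, g); the function J is the one of (g, f). *)
Definition Wint (f g : R -> R) (t0 : R) (nu : R -> R -> R) (u v : R) : R :=
  RInt (fun t => Derive f t / (f t - g t)) t0 (nu u v).

Definition natural_principal (Int : R -> Prop) (f g : R -> R) (t0 : R)
    (nu : R -> R -> R) (D : R * R -> Prop) (z l : surface) : Prop :=
  W_surface_via Int f g nu D z l /\
  principal_parameters D z l /\
  (exists c : R, forall u v, D (u, v) ->
     sqrt (fE z u v) * exp (Wint f g t0 nu u v) = c) /\
  (exists c : R, forall u v, D (u, v) ->
     sqrt (fG z u v) * exp (Wint g f t0 nu u v) = c).

Definition regular_principal_surface (D : R * R -> Prop) (z l : surface)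
    : Prop :=
  smooth_surface D z /\
  space_like D z /\
  unit_normal D z l /\
  principal_parameters D z l /\
  strongly_regular D z l.

Definition has_invariants (D : R * R -> Prop) (z l : surface)
    (n1 n2 g1 g2 : R -> R -> R) : Prop :=
  forall u v, D (u, v) ->
    nu1 z l u v = n1 u v /\ nu2 z l u v = n2 u v /\
    gamma1 z u v = g1 u v /\ gamma2 z u v = g2 u v.

(* Main.v *)
Require Import Defs.
From Stdlib Require Import Reals Lra Lia List IndefiniteDescription.
From Coquelicot Require Import Coquelicot.
Open Scope R_scope.

(** The statement is the fundamental theorem of surface theory, in a form where the two
    metric coefficients are eliminated.  Along a surface in principal parameters put
    [p = sqrt E] and [q = sqrt G].  The frame [X = z_u / p], [Y = z_v / q], [l] satisfies the
    linear system

      [X_u = al Y - be l],  [Y_u = - al X],           [l_u = - be X],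
      [X_v = ga Y],         [Y_v = - ga X - de l],    [l_v = - de Y],

    with [al = gamma1 p], [be = nu1 p], [ga = gamma2 q], [de = nu2 q].  Its compatibility
    conditions are the Codazzi equations
    [nu1_v = gamma1 q (nu1 - nu2)], [nu2_u = gamma2 p (nu1 - nu2)] and the Gauss equation
    [(gamma1 p)_v + nu1 nu2 p q = (gamma2 q)_u], whose sign reflects [l^2 = -1].  When
    [nu1 = f(nu)] and [nu2 = g(nu)], the definition of [I] and [J] says
    [nu1_v = I_v (nu1 - nu2)] and [nu2_u = - J_u (nu1 - nu2)]; with the prescribed
    [gamma1 = b e^J I_v] and [gamma2 = - a e^I J_u] the Codazzi equations are therefore
    equivalent to [p = e^(-I) / a], [q = e^(-J) / b], and the Gauss equation becomes the
    equation assumed for [nu].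

    Existence ([surface_of_invariants]).  The frame system is solved on a small square by an
    ordinary differential equation along one horizontal line, and then along every vertical
    line ([picard_lindelof]).  That the result also solves the horizontal equations is
    [parameter_derivative]: the first-order remainder of a horizontal increment [h] solves
    the vertical system up to a source of size [h^2], so Gronwall's inequality propagates its
    smallness from the initial line.  Since the coefficient matrices are infinitesimally
    Lorentzian, products of solutions ([frame_system_pairing]) are constant, which keeps the
    frame orthonormal; the surface is then a potential of the closed form [p X du + q Y dv]
    ([square_potential]).

    Uniqueness ([congruence_of_invariants]).  For strongly regular surfaces the Codazzi
    equations determine [p] and [q] from the invariants, so both frames solve the same system.
    The linear map carrying the first frame to the second is then independent of the point
    ([frame_map_constant]), and it is the linear part of the required motion. *)

(** * Functions of two variables *)

(** On [D], the functions [hu] and [hv] are the partial derivatives of [h]. *)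
Definition has_partials (D : R * R -> Prop) (h hu hv : R -> R -> R) : Prop :=
  forall u v, D (u, v) ->
    is_derive (fun s => h s v) u (hu u v) /\ is_derive (fun s => h u s) v (hv u v).

(** [h] has continuous partial derivatives up to order [n] at the points of [D]. *)
Definition class_C (D : R * R -> Prop) (n : nat) (h : R -> R -> R) : Prop :=
  forall u v, D (u, v) -> ex_diff_n h n u v.

Lemma open_locally_2d (D : R * R -> Prop) (u v : R) :
  open D -> D (u, v) -> locally_2d (fun s t => D (s, t)) u v.
Proof.
  intros HD Huv. apply locally_2d_locally.
  generalize (HD _ Huv). apply filter_imp. intros [s t]; exact (fun H => H).
Qed.

Lemma open_box (D : R * R -> Prop) (u v : R) :
  open D -> D (u, v) ->
  exists r : posreal, forall s t, Rabs (s - u) < r -> Rabs (t - v) < r -> D (s, t).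
Proof.
  intros HD Huv. destruct (open_locally_2d D u v HD Huv) as [r Hr].
  exists r. intros s t Hs Ht. now apply Hr.
Qed.

Lemma locally_Rabs (P : R -> Prop) (x r : R) :
  0 < r -> (forall y, Rabs (y - x) < r -> P y) -> locally x P.
Proof. intros Hr H. exists (mkposreal r Hr). intros y Hy. apply H. exact Hy. Qed.

Lemma open_slice_u (D : R * R -> Prop) (u v : R) :
  open D -> D (u, v) -> locally u (fun s => D (s, v)).
Proof.
  intros HD Huv. destruct (open_box D u v HD Huv) as [r Hr].
  apply (locally_Rabs _ u r (cond_pos r)). intros s Hs. apply Hr; trivial.
  rewrite Rminus_diag, Rabs_R0. apply cond_pos.
Qed.

Lemma open_slice_v (D : R * R -> Prop) (u v : R) :
  open D -> D (u, v) -> locally v (fun s => D (u, s)).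
Proof.
  intros HD Huv. destruct (open_box D u v HD Huv) as [r Hr].
  apply (locally_Rabs _ v r (cond_pos r)). intros s Hs. apply Hr; trivial.
  rewrite Rminus_diag, Rabs_R0. apply cond_pos.
Qed.

Lemma ex_derive_continuity_pt (f : R -> R) (x : R) : ex_derive f x -> continuity_pt f x.
Proof.
  intros H. apply continuity_pt_filterlim.
  exact (@ex_derive_continuous R_AbsRing R_NormedModule f x H).
Qed.

Lemma has_partials_subset (D D' : R * R -> Prop) h hu hv :
  (forall p, D' p -> D p) -> has_partials D h hu hv -> has_partials D' h hu hv.
Proof. intros Hs H u v Huv. apply H, Hs, Huv. Qed.

Lemma has_partials_du D h hu hv u v :
  has_partials D h hu hv -> D (u, v) -> du h u v = hu u v.
Proof. intros H Huv. apply is_derive_unique, (H u v Huv). Qed.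

Lemma has_partials_dv D h hu hv u v :
  has_partials D h hu hv -> D (u, v) -> dv h u v = hv u v.
Proof. intros H Huv. apply is_derive_unique, (H u v Huv). Qed.

Lemma has_partials_unique D h hu hv hu' hv' u v :
  has_partials D h hu hv -> has_partials D h hu' hv' -> D (u, v) ->
  hu u v = hu' u v /\ hv u v = hv' u v.
Proof.
  intros H H' Huv.
  rewrite <- (has_partials_du _ _ _ _ _ _ H Huv), <- (has_partials_dv _ _ _ _ _ _ H Huv).
  now rewrite <- (has_partials_du _ _ _ _ _ _ H' Huv), <- (has_partials_dv _ _ _ _ _ _ H' Huv).
Qed.

Lemma has_partials_ext D h k hu hv ku kv :
  open D ->
  (forall u v, D (u, v) -> h u v = k u v) ->
  (forall u v, D (u, v) -> hu u v = ku u v) ->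
  (forall u v, D (u, v) -> hv u v = kv u v) ->
  has_partials D h hu hv -> has_partials D k ku kv.
Proof.
  intros HD Hh Hu Hv H u v Huv. destruct (H u v Huv) as [H1 H2].
  rewrite <- (Hu _ _ Huv), <- (Hv _ _ Huv). split.
  - apply is_derive_ext_loc with (fun s => h s v); trivial.
    generalize (open_slice_u D u v HD Huv). apply filter_imp. intros s Hs. now apply Hh.
  - apply is_derive_ext_loc with (fun s => h u s); trivial.
    generalize (open_slice_v D u v HD Huv). apply filter_imp. intros s Hs. now apply Hh.
Qed.

Lemma has_partials_const D c : has_partials D (fun _ _ => c) (fun _ _ => 0) (fun _ _ => 0).
Proof. intros u v _. split; apply (@is_derive_const R_AbsRing R_NormedModule). Qed.

Lemma has_partials_plus D h hu hv k ku kv :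
  has_partials D h hu hv -> has_partials D k ku kv ->
  has_partials D (fun u v => h u v + k u v)
    (fun u v => hu u v + ku u v) (fun u v => hv u v + kv u v).
Proof.
  intros H K u v Huv. destruct (H u v Huv), (K u v Huv).
  split.
  - apply (@is_derive_plus R_AbsRing R_NormedModule (fun s => h s v) (fun s => k s v)); trivial.
  - apply (@is_derive_plus R_AbsRing R_NormedModule (fun s => h u s) (fun s => k u s)); trivial.
Qed.

Lemma has_partials_mult D h hu hv k ku kv :
  has_partials D h hu hv -> has_partials D k ku kv ->
  has_partials D (fun u v => h u v * k u v)
    (fun u v => hu u v * k u v + h u v * ku u v)
    (fun u v => hv u v * k u v + h u v * kv u v).
Proof.
  intros H K u v Huv. destruct (H u v Huv), (K u v Huv).
  split.
  - apply (@is_derive_mult R_AbsRing (fun s => h s v) (fun s => k s v)); trivial.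
    intros; apply Rmult_comm.
  - apply (@is_derive_mult R_AbsRing (fun s => h u s) (fun s => k u s)); trivial.
    intros; apply Rmult_comm.
Qed.

Lemma has_partials_opp D h hu hv :
  has_partials D h hu hv ->
  has_partials D (fun u v => - h u v) (fun u v => - hu u v) (fun u v => - hv u v).
Proof.
  intros H u v Huv. destruct (H u v Huv).
  split.
  - apply (@is_derive_opp R_AbsRing R_NormedModule (fun s => h s v)); trivial.
  - apply (@is_derive_opp R_AbsRing R_NormedModule (fun s => h u s)); trivial.
Qed.

Lemma has_partials_minus D h hu hv k ku kv :
  has_partials D h hu hv -> has_partials D k ku kv ->
  has_partials D (fun u v => h u v - k u v)
    (fun u v => hu u v - ku u v) (fun u v => hv u v - kv u v).
Proof. intros H K. apply has_partials_plus; trivial. now apply has_partials_opp. Qed.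

Lemma has_partials_comp D phi dphi h hu hv :
  (forall u v, D (u, v) -> is_derive phi (h u v) (dphi (h u v))) ->
  has_partials D h hu hv ->
  has_partials D (fun u v => phi (h u v))
    (fun u v => dphi (h u v) * hu u v) (fun u v => dphi (h u v) * hv u v).
Proof.
  intros Hphi H u v Huv. destruct (H u v Huv). specialize (Hphi u v Huv).
  rewrite 2 (Rmult_comm (dphi _)).
  split.
  - apply (is_derive_comp phi (fun s => h s v)); trivial.
  - apply (is_derive_comp phi (fun s => h u s)); trivial.
Qed.

Lemma has_partials_inv D h hu hv :
  (forall u v, D (u, v) -> h u v <> 0) ->
  has_partials D h hu hv ->
  has_partials D (fun u v => / h u v)
    (fun u v => - hu u v * (/ h u v * / h u v)) (fun u v => - hv u v * (/ h u v * / h u v)).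
Proof.
  intros Hnz H u v Huv. destruct (H u v Huv). specialize (Hnz u v Huv).
  split.
  - replace (- hu u v * (/ h u v * / h u v)) with (- hu u v / h u v ^ 2) by (field; trivial).
    apply is_derive_inv with (f := fun s => h s v); trivial.
  - replace (- hv u v * (/ h u v * / h u v)) with (- hv u v / h u v ^ 2) by (field; trivial).
    apply is_derive_inv with (f := fun s => h u s); trivial.
Qed.

Lemma has_partials_exp D h hu hv :
  has_partials D h hu hv ->
  has_partials D (fun u v => exp (h u v))
    (fun u v => exp (h u v) * hu u v) (fun u v => exp (h u v) * hv u v).
Proof.
  apply has_partials_comp. intros u v _. apply is_derive_Reals, derivable_pt_lim_exp.
Qed.

Lemma has_partials_sqrt D h hu hv :
  (forall u v, D (u, v) -> 0 < h u v) ->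
  has_partials D h hu hv ->
  has_partials D (fun u v => sqrt (h u v))
    (fun u v => / (2 * sqrt (h u v)) * hu u v) (fun u v => / (2 * sqrt (h u v)) * hv u v).
Proof.
  intros Hp H.
  apply (has_partials_comp D sqrt (fun t => / (2 * sqrt t))); trivial.
  intros u v Huv. apply is_derive_Reals, derivable_pt_lim_sqrt, Hp, Huv.
Qed.

(** * Differentiability classes *)

Lemma class_C_continuity D n h u v : class_C D n h -> D (u, v) -> continuity_2d_pt h u v.
Proof. intros H Huv. specialize (H u v Huv). now destruct n; destruct H. Qed.

Lemma class_C_le D m n h : (m <= n)%nat -> class_C D n h -> class_C D m h.
Proof. intros Hmn H u v Huv. apply ex_diff_n_m with n; auto. Qed.

Lemma class_C_ext D n h k :
  open D -> (forall u v, D (u, v) -> h u v = k u v) -> class_C D n h -> class_C D n k.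
Proof.
  intros HD E H u v Huv. apply ex_diff_n_ext_loc with h; auto.
  generalize (open_locally_2d D u v HD Huv). apply locally_2d_impl.
  apply locally_2d_forall. auto.
Qed.

Lemma class_C_S_intro D n h hu hv :
  open D -> (forall u v, D (u, v) -> continuity_2d_pt h u v) ->
  has_partials D h hu hv -> class_C D n hu -> class_C D n hv -> class_C D (S n) h.
Proof.
  intros HD Hc H Hu Hv u v Huv. destruct (H u v Huv) as [H1 H2].
  simpl. repeat split.
  - auto.
  - now exists (hu u v).
  - now exists (hv u v).
  - apply (class_C_ext D n hu); trivial.
    intros s t Hst. symmetry. apply (has_partials_du _ _ _ _ _ _ H Hst).
  - apply (class_C_ext D n hv); trivial.
    intros s t Hst. symmetry. apply (has_partials_dv _ _ _ _ _ _ H Hst).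
Qed.

Lemma class_C_S_elim D n h :
  class_C D (S n) h ->
  has_partials D h (du h) (dv h) /\ class_C D n (du h) /\ class_C D n (dv h).
Proof.
  intros H. split; [|split]; intros u v Huv;
    destruct (H u v Huv) as (_ & Hu & Hv & Hu' & Hv'); trivial.
  split; now apply Derive_correct.
Qed.

Lemma class_C_const D n c : open D -> class_C D n (fun _ _ => c).
Proof.
  intros HD. revert c. induction n as [|n IH]; intros c.
  - intros u v Huv. split; trivial. apply continuity_2d_pt_const.
  - apply class_C_S_intro with (fun _ _ => 0) (fun _ _ => 0); trivial.
    + intros. apply continuity_2d_pt_const.
    + apply has_partials_const.
Qed.

Lemma class_C_plus D n h k :
  open D -> class_C D n h -> class_C D n k -> class_C D n (fun u v => h u v + k u v).
Proof.
  intros HD. revert h k. induction n as [|n IH]; intros h k Hh Hk.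
  - intros u v Huv. split; trivial.
    apply continuity_2d_pt_plus; eapply class_C_continuity; eauto.
  - destruct (class_C_S_elim _ _ _ Hh) as (Ph & Uh & Vh).
    destruct (class_C_S_elim _ _ _ Hk) as (Pk & Uk & Vk).
    eapply class_C_S_intro; trivial.
    + intros; apply continuity_2d_pt_plus; eapply class_C_continuity; eauto.
    + apply has_partials_plus; eassumption.
    + auto.
    + auto.
Qed.

Lemma class_C_mult D n h k :
  open D -> class_C D n h -> class_C D n k -> class_C D n (fun u v => h u v * k u v).
Proof.
  intros HD. revert h k. induction n as [|n IH]; intros h k Hh Hk.
  - intros u v Huv. split; trivial.
    apply continuity_2d_pt_mult; eapply class_C_continuity; eauto.
  - destruct (class_C_S_elim _ _ _ Hh) as (Ph & Uh & Vh).
    destruct (class_C_S_elim _ _ _ Hk) as (Pk & Uk & Vk).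
    assert (Ch : class_C D n h) by (apply class_C_le with (S n); auto).
    assert (Ck : class_C D n k) by (apply class_C_le with (S n); auto).
    eapply class_C_S_intro; trivial.
    + intros; apply continuity_2d_pt_mult; eapply class_C_continuity; eauto.
    + apply has_partials_mult; eassumption.
    + apply class_C_plus; auto.
    + apply class_C_plus; auto.
Qed.

Lemma class_C_opp D n h : open D -> class_C D n h -> class_C D n (fun u v => - h u v).
Proof.
  intros HD H. apply class_C_ext with (fun u v => (-1) * h u v); trivial.
  - intros; ring.
  - apply class_C_mult; trivial. now apply class_C_const.
Qed.

Lemma class_C_minus D n h k :
  open D -> class_C D n h -> class_C D n k -> class_C D n (fun u v => h u v - k u v).
Proof. intros HD Hh Hk. apply class_C_plus; trivial. now apply class_C_opp. Qed.

Lemma ex_derive_n_Derive phi m t : ex_derive_n phi (S m) t -> ex_derive_n (Derive phi) m t.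
Proof.
  intros H. destruct m as [|m]; [exact I|]. simpl in H |- *.
  apply ex_derive_ext with (2 := H). intros s.
  change (Derive phi) with (Derive_n phi 1). now rewrite Derive_n_comp, Nat.add_1_r.
Qed.

(** Only the derivatives of [phi] at values of [h] enter, so [phi] may be smooth on an
    arbitrary set containing them. *)
Lemma class_C_comp D n phi h :
  open D -> (forall m u v, D (u, v) -> ex_derive_n phi m (h u v)) ->
  class_C D n h -> class_C D n (fun u v => phi (h u v)).
Proof.
  intros HD. revert phi h. induction n as [|n IH]; intros phi h Hphi Hh.
  - intros u v Huv. split; trivial. apply continuity_1d_2d_pt_comp.
    + apply ex_derive_continuity_pt, (Hphi 1%nat u v Huv).
    + eapply class_C_continuity; eauto.
  - destruct (class_C_S_elim _ _ _ Hh) as (Ph & Uh & Vh).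
    assert (Ch : class_C D n h) by (apply class_C_le with (S n); auto).
    assert (Cp : class_C D n (fun u v => Derive phi (h u v))).
    { apply IH; trivial. intros m u v Huv. now apply ex_derive_n_Derive, Hphi. }
    eapply class_C_S_intro; trivial.
    + intros u v Huv; apply continuity_1d_2d_pt_comp.
      * apply ex_derive_continuity_pt, (Hphi 1%nat u v Huv).
      * eapply class_C_continuity; eauto.
    + apply has_partials_comp with (dphi := Derive phi); [|eassumption].
      intros u v Huv. apply Derive_correct, (Hphi 1%nat u v Huv).
    + apply class_C_mult; auto.
    + apply class_C_mult; auto.
Qed.

Lemma class_C_inv D n h :
  open D -> (forall u v, D (u, v) -> h u v <> 0) ->
  class_C D n h -> class_C D n (fun u v => / h u v).
Proof.
  intros HD Hnz. induction n as [|n IH]; intros Hh.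
  - intros u v Huv. split; trivial. apply continuity_2d_pt_inv; auto.
    eapply class_C_continuity; eauto.
  - destruct (class_C_S_elim _ _ _ Hh) as (Ph & Uh & Vh).
    assert (Ch : class_C D n h) by (apply class_C_le with (S n); auto).
    eapply class_C_S_intro; trivial.
    + intros; apply continuity_2d_pt_inv; auto. eapply class_C_continuity; eauto.
    + apply has_partials_inv; eassumption.
    + apply class_C_mult; [trivial | now apply class_C_opp | apply class_C_mult; auto].
    + apply class_C_mult; [trivial | now apply class_C_opp | apply class_C_mult; auto].
Qed.

Lemma class_C_exp D n h : open D -> class_C D n h -> class_C D n (fun u v => exp (h u v)).
Proof.
  intros HD. induction n as [|n IH]; intros Hh.
  - intros u v Huv. split; trivial. apply continuity_1d_2d_pt_comp.
    + apply derivable_continuous_pt, derivable_pt_exp.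
    + eapply class_C_continuity; eauto.
  - destruct (class_C_S_elim _ _ _ Hh) as (Ph & Uh & Vh).
    assert (Ch : class_C D n h) by (apply class_C_le with (S n); auto).
    eapply class_C_S_intro; trivial.
    + intros; apply continuity_1d_2d_pt_comp.
      * apply derivable_continuous_pt, derivable_pt_exp.
      * eapply class_C_continuity; eauto.
    + apply has_partials_exp; eassumption.
    + apply class_C_mult; auto.
    + apply class_C_mult; auto.
Qed.

Lemma class_C_sqrt D n h :
  open D -> (forall u v, D (u, v) -> 0 < h u v) ->
  class_C D n h -> class_C D n (fun u v => sqrt (h u v)).
Proof.
  intros HD Hp.
  assert (Hc : forall u v, D (u, v) -> continuity_2d_pt h u v ->
               continuity_2d_pt (fun u v => sqrt (h u v)) u v).
  { intros u v Huv Hc. apply continuity_1d_2d_pt_comp; trivial.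
    apply continuity_pt_sqrt. apply Rlt_le, Hp, Huv. }
  induction n as [|n IH]; intros Hh.
  - intros u v Huv. split; trivial. apply Hc; trivial. eapply class_C_continuity; eauto.
  - destruct (class_C_S_elim _ _ _ Hh) as (Ph & Uh & Vh).
    assert (Ch : class_C D n h) by (apply class_C_le with (S n); auto).
    assert (Ci : class_C D n (fun u v => / (2 * sqrt (h u v)))).
    { apply class_C_inv; trivial.
      - intros u v Huv. specialize (sqrt_lt_R0 _ (Hp u v Huv)). lra.
      - apply class_C_mult; auto using class_C_const. }
    eapply class_C_S_intro; trivial.
    + intros u v Huv. apply Hc; trivial. eapply class_C_continuity; eauto.
    + apply has_partials_sqrt; eassumption.
    + apply class_C_mult; auto.
    + apply class_C_mult; auto.
Qed.

(** The closure properties of [class_C], at all orders at once, are those of [smooth2]. *)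
Lemma smooth2_intro D h hu hv :
  open D -> (forall u v, D (u, v) -> continuity_2d_pt h u v) ->
  has_partials D h hu hv -> smooth2 D hu -> smooth2 D hv -> smooth2 D h.
Proof.
  intros HD Hc H Hu Hv [|n].
  - intros u v Huv. split; auto.
  - apply (class_C_S_intro D n h hu hv); trivial; [exact (Hu n) | exact (Hv n)].
Qed.

Lemma smooth2_elim D h :
  smooth2 D h -> has_partials D h (du h) (dv h) /\ smooth2 D (du h) /\ smooth2 D (dv h).
Proof.
  intros H. split; [|split].
  - now apply (class_C_S_elim D 0 h (H 1%nat)).
  - intros n. apply (class_C_S_elim D n h (H (S n))).
  - intros n. apply (class_C_S_elim D n h (H (S n))).
Qed.

Lemma smooth2_partials D h : smooth2 D h -> has_partials D h (du h) (dv h).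
Proof. intros H. apply smooth2_elim, H. Qed.

Lemma smooth2_du D h : smooth2 D h -> smooth2 D (du h).
Proof. intros H. apply smooth2_elim, H. Qed.

Lemma smooth2_dv D h : smooth2 D h -> smooth2 D (dv h).
Proof. intros H. apply smooth2_elim, H. Qed.

Lemma smooth2_continuity D h u v : smooth2 D h -> D (u, v) -> continuity_2d_pt h u v.
Proof. intros H. apply (class_C_continuity D 0 h u v (H 0%nat)). Qed.

Lemma smooth2_subset (D D' : R * R -> Prop) h :
  (forall p, D' p -> D p) -> smooth2 D h -> smooth2 D' h.
Proof. intros Hs H n u v Huv. apply H, Hs, Huv. Qed.

Lemma smooth2_ext D h k :
  open D -> (forall u v, D (u, v) -> h u v = k u v) -> smooth2 D h -> smooth2 D k.
Proof. intros HD E H n. apply (class_C_ext D n h k HD E (H n)). Qed.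

Lemma smooth2_const D c : open D -> smooth2 D (fun _ _ => c).
Proof. intros HD n. apply (class_C_const D n c HD). Qed.

Lemma smooth2_plus D h k :
  open D -> smooth2 D h -> smooth2 D k -> smooth2 D (fun u v => h u v + k u v).
Proof. intros HD Hh Hk n. apply (class_C_plus D n h k HD (Hh n) (Hk n)). Qed.

Lemma smooth2_minus D h k :
  open D -> smooth2 D h -> smooth2 D k -> smooth2 D (fun u v => h u v - k u v).
Proof. intros HD Hh Hk n. apply (class_C_minus D n h k HD (Hh n) (Hk n)). Qed.

Lemma smooth2_opp D h : open D -> smooth2 D h -> smooth2 D (fun u v => - h u v).
Proof. intros HD Hh n. apply (class_C_opp D n h HD (Hh n)). Qed.

Lemma smooth2_mult D h k :
  open D -> smooth2 D h -> smooth2 D k -> smooth2 D (fun u v => h u v * k u v).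
Proof. intros HD Hh Hk n. apply (class_C_mult D n h k HD (Hh n) (Hk n)). Qed.

Lemma smooth2_inv D h :
  open D -> (forall u v, D (u, v) -> h u v <> 0) -> smooth2 D h ->
  smooth2 D (fun u v => / h u v).
Proof. intros HD Hnz Hh n. apply (class_C_inv D n h HD Hnz (Hh n)). Qed.

Lemma smooth2_exp D h : open D -> smooth2 D h -> smooth2 D (fun u v => exp (h u v)).
Proof. intros HD Hh n. apply (class_C_exp D n h HD (Hh n)). Qed.

Lemma smooth2_sqrt D h :
  open D -> (forall u v, D (u, v) -> 0 < h u v) -> smooth2 D h ->
  smooth2 D (fun u v => sqrt (h u v)).
Proof. intros HD Hp Hh n. apply (class_C_sqrt D n h HD Hp (Hh n)). Qed.

Lemma smooth2_comp D phi h :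
  open D -> (forall m u v, D (u, v) -> ex_derive_n phi m (h u v)) ->
  smooth2 D h -> smooth2 D (fun u v => phi (h u v)).
Proof. intros HD Hphi Hh n. apply (class_C_comp D n phi h HD Hphi (Hh n)). Qed.

Lemma smooth2_schwarz D h u v :
  open D -> smooth2 D h -> D (u, v) -> dv (du h) u v = du (dv h) u v.
Proof.
  intros HD H Huv. unfold du at 2, dv at 2. unfold du, dv. symmetry. apply Schwarz.
  - generalize (open_locally_2d D u v HD Huv). apply locally_2d_impl, locally_2d_forall.
    intros s t Hst.
    destruct (smooth2_partials D h H s t Hst) as [A1 A2].
    destruct (smooth2_partials D _ (smooth2_dv D h H) s t Hst) as [A3 _].
    destruct (smooth2_partials D _ (smooth2_du D h H) s t Hst) as [_ A4].
    repeat split; eexists; eassumption.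
  - apply (smooth2_continuity D (du (dv h))); trivial. now apply smooth2_du, smooth2_dv.
  - apply (smooth2_continuity D (dv (du h))); trivial. now apply smooth2_dv, smooth2_du.
Qed.

(** * Mean value estimates and constancy *)

Lemma segment_lipschitz (h h' : R -> R) (M x y r c : R) :
  Rabs (x - c) < r -> Rabs (y - c) < r ->
  (forall t, Rabs (t - c) < r -> is_derive h t (h' t)) ->
  (forall t, Rabs (t - c) < r -> Rabs (h' t) <= M) ->
  Rabs (h y - h x) <= M * Rabs (y - x).
Proof.
  intros Hx Hy Hd HM.
  destruct (MVT_gen h x y h') as (t & Ht & E).
  - intros t Ht. apply Hd.
    apply Rabs_lt_between in Hx, Hy. apply Rabs_lt_between.
    unfold Rmin, Rmax in Ht. destruct (Rle_dec x y); lra.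
  - intros t Ht. apply ex_derive_continuity_pt.
    exists (h' t). apply Hd.
    apply Rabs_lt_between in Hx, Hy. apply Rabs_lt_between.
    unfold Rmin, Rmax in Ht. destruct (Rle_dec x y); lra.
  - rewrite E, Rabs_mult. apply Rmult_le_compat_r; [apply Rabs_pos|]. apply HM.
    apply Rabs_lt_between in Hx, Hy. apply Rabs_lt_between.
    unfold Rmin, Rmax in Ht. destruct (Rle_dec x y); lra.
Qed.

(** The open square of half-side [r] about [(u0, v0)]. *)
Definition square (u0 v0 r : R) (p : R * R) : Prop :=
  Rabs (fst p - u0) < r /\ Rabs (snd p - v0) < r.

Lemma square_center u0 v0 r : 0 < r -> square u0 v0 r (u0, v0).
Proof. intros Hr. split; simpl; rewrite Rminus_diag, Rabs_R0; trivial. Qed.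

Lemma square_open u0 v0 r : open (square u0 v0 r).
Proof.
  intros [u v] [Hu Hv]; simpl in *.
  set (e := Rmin (r - Rabs (u - u0)) (r - Rabs (v - v0))).
  assert (He : 0 < e) by (apply Rmin_case; lra).
  exists (mkposreal e He). intros [s t] [Hs Ht]. simpl in Hs, Ht.
  change (Rabs (s - u) < e) in Hs. change (Rabs (t - v) < e) in Ht.
  assert (e <= r - Rabs (u - u0)) by apply Rmin_l.
  assert (e <= r - Rabs (v - v0)) by apply Rmin_r.
  split; simpl.
  - replace (s - u0) with ((s - u) + (u - u0)) by ring.
    apply Rle_lt_trans with (1 := Rabs_triang _ _). lra.
  - replace (t - v0) with ((t - v) + (v - v0)) by ring.
    apply Rle_lt_trans with (1 := Rabs_triang _ _). lra.
Qed.

Lemma square_lipschitz u0 v0 r h hu hv M u v s t :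
  has_partials (square u0 v0 r) h hu hv ->
  (forall u v, square u0 v0 r (u, v) -> Rabs (hu u v) <= M /\ Rabs (hv u v) <= M) ->
  square u0 v0 r (u, v) -> square u0 v0 r (s, t) ->
  Rabs (h s t - h u v) <= M * Rabs (s - u) + M * Rabs (t - v).
Proof.
  intros H HM [Hu Hv] [Hs Ht]; simpl in *.
  replace (h s t - h u v) with ((h s t - h u t) + (h u t - h u v)) by ring.
  apply Rle_trans with (1 := Rabs_triang _ _). apply Rplus_le_compat.
  - apply (segment_lipschitz (fun z => h z t) (fun z => hu z t) M u s r u0); trivial.
    + intros z Hz. apply (H z t). now split.
    + intros z Hz. apply (HM z t). now split.
  - apply (segment_lipschitz (fun z => h u z) (fun z => hv u z) M v t r v0); trivial.
    + intros z Hz. apply (H u z). now split.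
    + intros z Hz. apply (HM u z). now split.
Qed.

Lemma square_in_open (D : R * R -> Prop) u v :
  open D -> D (u, v) -> exists r, 0 < r /\ forall p, square u v r p -> D p.
Proof.
  intros HD Huv. destruct (open_box D u v HD Huv) as [r Hr].
  exists r. split; [apply cond_pos|]. intros [s t] [Hs Ht]. now apply Hr.
Qed.

Lemma square_le u0 v0 r r' p : r <= r' -> square u0 v0 r p -> square u0 v0 r' p.
Proof. intros Hr [H1 H2]. split; lra. Qed.

Lemma continuity_2d_bounded h u v :
  continuity_2d_pt h u v ->
  exists r, 0 < r /\ forall s t, square u v r (s, t) -> Rabs (h s t) <= Rabs (h u v) + 1.
Proof.
  intros H. destruct (H (mkposreal 1 Rlt_0_1)) as [r Hr]. exists r.
  split; [apply cond_pos|]. intros s t [Hs Ht]. specialize (Hr s t Hs Ht). simpl in Hr.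
  replace (h s t) with ((h s t - h u v) + h u v) by ring.
  apply Rle_trans with (1 := Rabs_triang _ _). lra.
Qed.

Lemma bounded_partials_continuity D h hu hv M u v :
  open D -> has_partials D h hu hv -> D (u, v) ->
  (forall s t, D (s, t) -> Rabs (hu s t) <= M /\ Rabs (hv s t) <= M) ->
  continuity_2d_pt h u v.
Proof.
  intros HD H Huv HM.
  destruct (square_in_open D u v HD Huv) as (r & Hr & Hs).
  assert (M0 : 0 <= M) by (apply Rle_trans with (2 := proj1 (HM u v Huv)), Rabs_pos).
  intros eps.
  set (d := Rmin r (eps / (2 * (M + 1)))).
  assert (Hd : 0 < d).
  { apply Rmin_case; trivial. apply Rdiv_lt_0_compat; [apply cond_pos|lra]. }
  exists (mkposreal d Hd). simpl. intros s t Hsu Htv.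
  assert (d <= r) by apply Rmin_l.
  assert (Hd2 : d <= eps / (2 * (M + 1))) by apply Rmin_r.
  apply Rle_lt_trans with (M * Rabs (s - u) + M * Rabs (t - v)).
  - apply (square_lipschitz u v r h hu hv M).
    + now apply has_partials_subset with D.
    + intros s' t' Hst. apply HM, Hs, Hst.
    + now apply square_center.
    + split; simpl; lra.
  - apply Rlt_le_trans with (2 * (M + 1) * d).
    + assert (M * Rabs (s - u) <= M * d) by (apply Rmult_le_compat_l; lra).
      assert (M * Rabs (t - v) <= M * d) by (apply Rmult_le_compat_l; lra). lra.
    + apply Rle_trans with (2 * (M + 1) * (eps / (2 * (M + 1)))).
      * apply Rmult_le_compat_l; lra.
      * right. field. lra.
Qed.

(** Continuous partial derivatives force joint continuity. *)
Lemma has_partials_continuity D h hu hv u v :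
  open D -> has_partials D h hu hv -> D (u, v) ->
  continuity_2d_pt hu u v -> continuity_2d_pt hv u v -> continuity_2d_pt h u v.
Proof.
  intros HD H Huv Cu Cv.
  destruct (square_in_open D u v HD Huv) as (r0 & Hr0 & Hs0).
  destruct (continuity_2d_bounded _ _ _ Cu) as (r1 & Hr1 & Hs1).
  destruct (continuity_2d_bounded _ _ _ Cv) as (r2 & Hr2 & Hs2).
  set (r := Rmin r0 (Rmin r1 r2)).
  assert (Hr : 0 < r) by (repeat apply Rmin_case; trivial).
  assert (r <= r0) by apply Rmin_l.
  assert (r <= r1) by (eapply Rle_trans; [apply Rmin_r|apply Rmin_l]).
  assert (r <= r2) by (eapply Rle_trans; [apply Rmin_r|apply Rmin_r]).
  apply (bounded_partials_continuity (square u v r) h hu hv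
           (Rabs (hu u v) + 1 + (Rabs (hv u v) + 1))).
  - apply square_open.
  - apply has_partials_subset with D; trivial. intros p Hp. apply Hs0.
    now apply square_le with r.
  - now apply square_center.
  - intros s t Hst.
    specialize (Hs1 s t (square_le _ _ _ _ _ H1 Hst)).
    specialize (Hs2 s t (square_le _ _ _ _ _ H2 Hst)).
    generalize (Rabs_pos (hu u v)) (Rabs_pos (hv u v)); lra.
Qed.

(** The level set of a value and its complement are both open. *)
Lemma connected_constant D h p q :
  open D -> connected D -> has_partials D h (fun _ _ => 0) (fun _ _ => 0) ->
  D p -> D q -> h (fst p) (snd p) = h (fst q) (snd q).
Proof.
  intros HD HC H Hp Hq.
  set (c := h (fst p) (snd p)).
  assert (Hloc : forall u v, D (u, v) -> locally (u, v) (fun z => D z /\ h (fst z) (snd z) = h u v)).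
  { intros u v Huv. destruct (square_in_open D u v HD Huv) as (r & Hr & Hs).
    generalize (square_open u v r (u, v) (square_center u v r Hr)).
    apply filter_imp. intros [s t] Hst. split; [now apply Hs|]. simpl.
    assert (E : Rabs (h s t - h u v) <= 0 * Rabs (s - u) + 0 * Rabs (t - v)).
    { apply (square_lipschitz u v r h (fun _ _ => 0) (fun _ _ => 0)); trivial.
      - now apply has_partials_subset with D.
      - intros. rewrite Rabs_R0. lra.
      - now apply square_center. }
    rewrite 2 Rmult_0_l, Rplus_0_r in E.
    assert (E' := Rabs_pos (h s t - h u v)).
    assert (E0 : Rabs (h s t - h u v) = 0) by lra.
    apply Rminus_diag_uniq. destruct (Req_dec (h s t - h u v) 0) as [|N]; trivial.
    apply Rabs_no_R0 in N. contradiction. }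
  destruct (HC (fun z => D z /\ h (fst z) (snd z) = c) (fun z => D z /\ h (fst z) (snd z) <> c))
    as [A | A].
  - intros [u v] [Huv E]. generalize (Hloc u v Huv). apply filter_imp.
    intros z [Hz Ez]. split; trivial. exact (eq_trans Ez E).
  - intros [u v] [Huv E]. generalize (Hloc u v Huv). apply filter_imp.
    intros z [Hz Ez]. split; trivial. intros E'. apply E. exact (eq_trans (eq_sym Ez) E').
  - intros z Hz. destruct (Req_dec (h (fst z) (snd z)) c); auto.
  - intros z _ [_ E] [_ N]. contradiction.
  - symmetry. now apply A.
  - now destruct (A p Hp) as [_ N].
Qed.

(** Connectedness is proved along the segment joining two points of the square. *)
Lemma square_connected u0 v0 r : connected (square u0 v0 r).
Proof.
  intros U V HU HV Hcov Hdis.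
  destruct (Classical_Prop.classic (forall p, square u0 v0 r p -> U p)) as [|NU]; [now left|].
  right. intros q Hq. destruct (Hcov q Hq) as [Uq|]; trivial. exfalso.
  apply Classical_Pred_Type.not_all_ex_not in NU. destruct NU as [p NU].
  assert (Hp : square u0 v0 r p /\ ~ U p) by tauto. clear NU. destruct Hp as [Hp NUp].
  assert (Vp : V p) by (destruct (Hcov p Hp); tauto).
  set (seg := fun t : R => (fst p + t * (fst q - fst p), snd p + t * (snd q - snd p))).
  assert (Hconv : forall a b c t, Rabs (a - c) < r -> Rabs (b - c) < r -> 0 <= t <= 1 ->
                  Rabs (a + t * (b - a) - c) < r).
  { intros a b c t Ha Hb Ht. apply Rabs_lt_between in Ha, Hb. apply Rabs_lt_between.
    destruct (Rle_lt_dec a b).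
    - assert (0 <= t * (b - a) <= b - a) by nra. lra.
    - assert (b - a <= t * (b - a) <= 0) by nra. lra. }
  assert (Hseg : forall t, 0 <= t <= 1 -> square u0 v0 r (seg t)).
  { intros t Ht. destruct Hp, Hq. split; apply Hconv; trivial. }
  assert (Cseg : forall t, continuous seg t).
  { intros t. unfold seg.
    apply (continuous_comp_2 (fun t => fst p + t * (fst q - fst p))
             (fun t => snd p + t * (snd q - snd p)) (fun a b => (a, b))).
    - apply @ex_derive_continuous. auto_derive; trivial.
    - apply @ex_derive_continuous. auto_derive; trivial.
    - apply continuous_ext with (fun z => z); [now intros []|apply filterlim_id]. }
  assert (Hloc : forall (W : R * R -> Prop) t, open W -> W (seg t) ->
                 exists d : posreal, forall s, Rabs (s - t) < d -> W (seg s)).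
  { intros W t HW Wt. destruct (Cseg t W (HW _ Wt)) as [d Hd]. exists d. exact Hd. }
  assert (S0 : seg 0 = p) by (unfold seg; rewrite 2 Rmult_0_l, 2 Rplus_0_r; now destruct p).
  assert (S1 : seg 1 = q) by (unfold seg; destruct q; simpl; f_equal; ring).
  (* the supremum [tau] of the initial part of the segment lying in [V] is contradictory,
     whichever of the two open sets contains its endpoint *)
  set (E := fun t => 0 <= t <= 1 /\ forall s, 0 <= s <= t -> V (seg s)).
  assert (E0 : E 0).
  { split; [lra|]. intros s Hs. replace s with 0 by lra. now rewrite S0. }
  destruct (completeness E) as [tau [Hub Hlub]].
  { exists 1. intros t [Ht _]. apply Ht. }
  { now exists 0. }
  assert (Htau : 0 <= tau <= 1).
  { split; [now apply Hub|]. apply Hlub. intros t [Ht _]. apply Ht. }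
  assert (Hclose : forall d, 0 < d -> exists t, E t /\ tau - d < t).
  { intros d Hd. apply Classical_Prop.NNPP. intros N.
    assert (tau <= tau - d); [|lra]. apply Hlub. intros t Et.
    destruct (Rle_lt_dec t (tau - d)); trivial. exfalso; eauto. }
  destruct (Hcov (seg tau) (Hseg tau Htau)) as [Ut | Vt].
  - destruct (Hloc U tau HU Ut) as [d Hd].
    destruct (Hclose d (cond_pos d)) as (t & Et & Ht).
    assert (t <= tau) by now apply Hub.
    destruct Et as [Ht1 Vs]. apply (Hdis (seg t)); [now apply Hseg| |].
    + apply Hd. apply Rabs_lt_between. lra.
    + apply Vs. lra.
  - destruct (Hloc V tau HV Vt) as [d Hd].
    destruct (Hclose d (cond_pos d)) as (t & Et & Ht).
    assert (Hdp := cond_pos d).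
    assert (Ex : forall t', tau <= t' <= 1 -> t' < tau + d -> E t').
    { intros t' Ht' Ht''. split; [lra|]. intros s Hs.
      destruct (Rle_lt_dec s t) as [Hst|Hst].
      - apply Et. lra.
      - apply Hd. apply Rabs_lt_between. lra. }
    destruct (Req_dec tau 1) as [E1|N1].
    + apply (Hdis q); trivial. rewrite <- S1, <- E1. exact Vt.
    + assert (Hm : tau < Rmin 1 (tau + d / 2)) by (apply Rmin_case; lra).
      assert (Rmin 1 (tau + d / 2) <= 1) by apply Rmin_l.
      assert (Rmin 1 (tau + d / 2) <= tau + d / 2) by apply Rmin_r.
      assert (Rmin 1 (tau + d / 2) <= tau); [|lra].
      apply Hub, Ex; lra.
Qed.

Lemma square_domain u0 v0 r : 0 < r -> planar_domain (square u0 v0 r).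
Proof.
  intros Hr. repeat split.
  - exists (u0, v0). now apply square_center.
  - apply square_open.
  - apply square_connected.
Qed.

(** * Ordinary differential equations *)

Lemma abs_RInt_le (f : R -> R) (a b M : R) :
  ex_RInt f a b -> (forall t, Rmin a b <= t <= Rmax a b -> Rabs (f t) <= M) ->
  Rabs (RInt f a b) <= M * Rabs (b - a).
Proof.
  intros Hf HM. rewrite Rmult_comm. destruct (Rle_dec a b) as [Hab|Hab].
  - rewrite (Rabs_pos_eq (b - a)) by lra. apply abs_RInt_le_const; trivial.
    intros t Ht. apply HM. now rewrite Rmin_left, Rmax_right.
  - rewrite (Rabs_left1 (b - a)) by lra.
    rewrite <- (opp_RInt_swap f); [|now apply ex_RInt_swap].
    change (Rabs (- RInt f b a) <= - (b - a) * M). rewrite Rabs_Ropp.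
    replace (- (b - a)) with (a - b) by ring.
    apply abs_RInt_le_const; [lra|now apply ex_RInt_swap|].
    intros t Ht. apply HM. rewrite Rmin_right, Rmax_left; lra.
Qed.

(** The nearest point to [t] of the interval of radius [r] about [t0]. *)
Definition clamp (t0 r t : R) : R := Rmax (t0 - r) (Rmin (t0 + r) t).

Lemma clamp_bounds t0 r t : 0 <= r -> Rabs (clamp t0 r t - t0) <= r.
Proof.
  intros Hr. unfold clamp. apply Rabs_le_between.
  unfold Rmax, Rmin. repeat destruct Rle_dec; lra.
Qed.

Lemma clamp_id t0 r t : Rabs (t - t0) <= r -> clamp t0 r t = t.
Proof.
  intros Hr. apply Rabs_le_between in Hr. unfold clamp.
  rewrite Rmin_right, Rmax_right; lra.
Qed.

Lemma clamp_continuous t0 r t : continuous (clamp t0 r) t.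
Proof.
  unfold clamp.
  apply continuous_ext with
    (fun t => ((t0 - r) + Rmin (t0 + r) t + Rabs ((t0 - r) - Rmin (t0 + r) t)) / 2).
  { intros s. unfold Rmax, Rabs. destruct Rle_dec, Rcase_abs; lra. }
  assert (H : continuous (Rmin (t0 + r)) t).
  { apply continuous_ext with (fun t => ((t0 + r) + t - Rabs ((t0 + r) - t)) / 2).
    { intros s. unfold Rmin, Rabs. destruct Rle_dec, Rcase_abs; lra. }
    unfold Rdiv. apply @continuous_mult; [|apply continuous_const].
    apply @continuous_minus.
    - apply @continuous_plus; [apply continuous_const|apply continuous_id].
    - apply (continuous_comp (fun s => t0 + r - s) Rabs).
      + apply @continuous_minus; [apply continuous_const|apply continuous_id].
      + apply continuous_Rabs. }
  unfold Rdiv. apply @continuous_mult; [|apply continuous_const].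
  apply @continuous_plus.
  - apply @continuous_plus; [apply continuous_const|trivial].
  - apply (continuous_comp (fun s => t0 - r - Rmin (t0 + r) s) Rabs).
    + apply @continuous_minus; [apply continuous_const|trivial].
    + apply continuous_Rabs.
Qed.

(** The equation [y' = F(t, y)], [y(t0) = c] for families [y] indexed by an arbitrary type,
    with [F] Lipschitz for the sup distance, on an interval of radius [r] with [K r < 1].
    All integrands are precomposed with [clamp], which makes the iterates globally defined. *)
Section Picard.
Variables (Idx : Type) (F : R -> (Idx -> R) -> Idx -> R) (c : Idx -> R).
Variables (t0 r K B : R).
Hypothesis r_pos : 0 < r.
Hypothesis K_pos : 0 <= K.
Hypothesis Kr : K * r < 1.
Hypothesis F_cont : forall (y : R -> Idx -> R) t i, Rabs (t - t0) <= r ->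
  (forall j, continuous (fun s => y s j) t) -> continuous (fun s => F s (y s) i) t.
Hypothesis F_lip : forall t x y d, Rabs (t - t0) <= r ->
  (forall j, Rabs (x j - y j) <= d) -> forall i, Rabs (F t x i - F t y i) <= K * d.
Hypothesis F_bound : forall t i, Rabs (t - t0) <= r -> Rabs (F t c i) <= B.

(** The right-hand side along [y], frozen outside the interval. *)
Let rhs (y : R -> Idx -> R) (i : Idx) (s : R) : R :=
  F (clamp t0 r s) (y (clamp t0 r s)) i.

(** One step of the Picard iteration. *)
Let step (y : R -> Idx -> R) (t : R) (i : Idx) : R :=
  c i + RInt (rhs y i) t0 (clamp t0 r t).

Let iterate (n : nat) : R -> Idx -> R := Nat.iter n step (fun _ => c).

Let continuous_family (y : R -> Idx -> R) := forall i t, continuous (fun s => y s i) t.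

Lemma rhs_continuous y i t : continuous_family y -> continuous (rhs y i) t.
Proof.
  intros Hy. unfold rhs.
  apply (continuous_comp (clamp t0 r) (fun s => F s (y s) i)).
  - apply clamp_continuous.
  - apply F_cont; [apply clamp_bounds; lra|]. intros j. apply Hy.
Qed.

Lemma rhs_ex_RInt y i a b : continuous_family y -> ex_RInt (rhs y i) a b.
Proof.
  intros Hy. apply @ex_RInt_continuous. intros t _. now apply rhs_continuous.
Qed.

Lemma step_continuous y : continuous_family y -> continuous_family (step y).
Proof.
  intros Hy i t. unfold step.
  apply @continuous_plus; [apply continuous_const|].
  apply (continuous_comp (clamp t0 r) (RInt (rhs y i) t0)).
  - apply clamp_continuous.
  - apply (continuous_RInt_1 (rhs y i) t0 _ (RInt (rhs y i) t0)).
    apply filter_forall. intros z. apply @RInt_correct. now apply rhs_ex_RInt.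
Qed.

Lemma iterate_continuous n : continuous_family (iterate n).
Proof.
  induction n as [|n IH].
  - intros i t. apply continuous_const.
  - now apply step_continuous.
Qed.

Lemma step_contracts y z d :
  continuous_family y -> continuous_family z ->
  (forall t i, Rabs (y t i - z t i) <= d) ->
  forall t i, Rabs (step y t i - step z t i) <= K * r * d.
Proof.
  intros Hy Hz Hd t i. unfold step.
  assert (R0 : forall p q s : R, s + p - (s + q) = p - q) by (intros; ring).
  rewrite R0.
  assert (E := RInt_minus (V := R_CompleteNormedModule) (rhs y i) (rhs z i) t0 (clamp t0 r t)
                 (rhs_ex_RInt y i _ _ Hy) (rhs_ex_RInt z i _ _ Hz)).
  change (RInt (rhs y i) t0 (clamp t0 r t) - RInt (rhs z i) t0 (clamp t0 r t))
    with (minus (RInt (rhs y i) t0 (clamp t0 r t)) (RInt (rhs z i) t0 (clamp t0 r t))).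
  rewrite <- E.
  assert (H0 : 0 <= d) by (apply Rle_trans with (2 := Hd t i), Rabs_pos).
  apply Rle_trans with (K * d * Rabs (clamp t0 r t - t0)).
  - apply abs_RInt_le.
    + apply @ex_RInt_minus; now apply rhs_ex_RInt.
    + intros s _. apply F_lip; [apply clamp_bounds; lra|]. intros j. apply Hd.
  - replace (K * r * d) with (K * d * r) by ring.
    apply Rmult_le_compat_l; [now apply Rmult_le_pos|]. apply clamp_bounds; lra.
Qed.

(** The geometric bound for the distance of every iterate to the initial constant. *)
Let size := r * B / (1 - K * r).

Lemma size_pos (i : Idx) : 0 <= size.
Proof.
  assert (HB : 0 <= B).
  { apply Rle_trans with (2 := F_bound t0 i ltac:(rewrite Rminus_diag, Rabs_R0; lra)).
    apply Rabs_pos. }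
  unfold size. apply Rdiv_le_0_compat; [|lra]. apply Rmult_le_pos; lra.
Qed.

Lemma iterate_near_start n t i : Rabs (iterate n t i - c i) <= size.
Proof.
  revert t i. induction n as [|n IH]; intros t i.
  - simpl. rewrite Rminus_diag, Rabs_R0. now apply size_pos.
  - change (iterate (S n)) with (step (iterate n)). unfold step.
    assert (R0 : forall p q : R, p + q - p = q) by (intros; ring).
    rewrite R0.
    apply Rle_trans with ((B + K * size) * Rabs (clamp t0 r t - t0)).
    + apply abs_RInt_le; [apply rhs_ex_RInt, iterate_continuous|].
      intros s _. unfold rhs.
      assert (Hs := clamp_bounds t0 r s ltac:(lra)).
      assert (H1 := F_lip _ _ c size Hs (fun j => IH (clamp t0 r s) j) i).
      assert (H2 := F_bound _ i Hs).
      replace (F _ (iterate n _) i) with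
        (F (clamp t0 r s) (iterate n (clamp t0 r s)) i - F (clamp t0 r s) c i
         + F (clamp t0 r s) c i) by ring.
      apply Rle_trans with (1 := Rabs_triang _ _). lra.
    + apply Rle_trans with ((B + K * size) * r).
      * apply Rmult_le_compat_l; [|apply clamp_bounds; lra].
        assert (HS := size_pos i).
        assert (HB : 0 <= B).
        { apply Rle_trans with (2 := F_bound t0 i ltac:(rewrite Rminus_diag, Rabs_R0; lra)).
          apply Rabs_pos. }
        assert (0 <= K * size) by now apply Rmult_le_pos. lra.
      * right. unfold size. field. lra.
Qed.

Lemma iterate_cauchy n k t i :
  Rabs (iterate (n + k) t i - iterate n t i) <= (K * r) ^ n * size.
Proof.
  revert t i. induction n as [|n IH]; intros t i.
  - simpl. rewrite Rmult_1_l. apply iterate_near_start.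
  - change (iterate (S n + k)) with (step (iterate (n + k))).
    change (iterate (S n)) with (step (iterate n)).
    rewrite <- tech_pow_Rmult, Rmult_assoc.
    apply step_contracts; trivial; apply iterate_continuous.
Qed.

Lemma iterate_converges :
  exists y : R * Idx -> R,
    filterlim (fun n => (fun p => iterate n (fst p) (snd p)) : R * Idx -> R)
      eventually (@locally (fct_UniformSpace (R * Idx) R_UniformSpace) y).
Proof.
  apply (proj1 (@filterlim_locally_cauchy nat
    (fct_CompleteSpace (T := R * Idx) (U := R_CompleteSpace)) eventually _ _)).
  intros eps.
  destruct (Classical_Prop.classic (inhabited Idx)) as [[i0]|Hempty].
  (* for an empty index type there is no bound [size], and nothing to prove *)
  2:{ exists (fun _ => True). split; [now exists 0%nat|].
      intros m n _ _ [t i]. destruct Hempty. now constructor. }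
  assert (HS := size_pos i0).
  destruct (pow_lt_1_zero (K * r) ltac:(rewrite Rabs_pos_eq; [lra|apply Rmult_le_pos; lra])
              (eps / (2 * (size + 1)))) as [N HN].
  { apply Rdiv_lt_0_compat; [apply cond_pos|lra]. }
  exists (fun n => (N <= n)%nat). split; [now exists N|].
  assert (H : forall n, (N <= n)%nat -> forall t i,
            Rabs (iterate n t i - iterate N t i) < eps / 2).
  { intros n Hn t i. replace n with (N + (n - N))%nat by lia.
    apply Rle_lt_trans with (1 := iterate_cauchy N (n - N) t i).
    specialize (HN N (Nat.le_refl N)). apply Rabs_lt_between in HN.
    assert (Hq : 0 <= (K * r) ^ N) by (apply pow_le, Rmult_le_pos; lra).
    apply Rle_lt_trans with ((K * r) ^ N * (size + 1)); [apply Rmult_le_compat_l; lra|].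
    apply Rlt_le_trans with (eps / (2 * (size + 1)) * (size + 1)).
    - apply Rmult_lt_compat_r; lra.
    - right. field. lra. }
  intros m n Hm Hn [t i]. simpl.
  change (Rabs (iterate n t i - iterate m t i) < eps).
  assert (H1 := H m Hm t i). assert (H2 := H n Hn t i).
  replace (iterate n t i - iterate m t i) with
    ((iterate n t i - iterate N t i) + - (iterate m t i - iterate N t i)) by ring.
  apply Rle_lt_trans with (1 := Rabs_triang _ _). rewrite Rabs_Ropp. lra.
Qed.

(** The iterates converge uniformly, hence so do their integrands, and the limit satisfies
    the integral equation. *)
Lemma picard_lindelof :
  exists y : R -> Idx -> R,
    (forall i, y t0 i = c i) /\
    (forall t i, Rabs (t - t0) < r -> is_derive (fun s => y s i) t (F t (y t) i)).
Proof.
  destruct iterate_converges as [Y HY].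
  set (y := fun t i => Y (t, i)).
  assert (Hunif : forall eps : posreal,
            eventually (fun n => forall t i, Rabs (iterate n t i - y t i) < eps)).
  { intros eps. destruct (proj1 (filterlim_locally _ _) HY eps) as [N HN].
    exists N. intros n Hn t i. exact (HN n Hn (t, i)). }
  assert (Hlim : forall t i, filterlim (fun n => iterate n t i) eventually (locally (y t i))).
  { intros t i. apply filterlim_locally. intros eps.
    generalize (Hunif eps). apply filter_imp. intros n Hn. apply Hn. }
  assert (Hrhs : forall i, filterlim (fun n => rhs (iterate n) i) eventually
                   (@locally (fct_UniformSpace R R_UniformSpace) (rhs y i))).
  { intros i. apply filterlim_locally. intros eps.
    assert (He : 0 < eps / (K + 1)) by (apply Rdiv_lt_0_compat; [apply cond_pos|lra]).
    generalize (Hunif (mkposreal _ He)). apply filter_imp. intros n Hn s.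
    change (Rabs (rhs (iterate n) i s - rhs y i s) < eps). unfold rhs.
    apply Rle_lt_trans with (K * (eps / (K + 1))).
    - apply F_lip; [apply clamp_bounds; lra|]. intros j. apply Rlt_le, Hn.
    - apply Rlt_le_trans with ((K + 1) * (eps / (K + 1))); [|right; field; lra].
      apply Rmult_lt_compat_r; trivial. lra. }
  assert (Hint : forall t i, is_RInt (rhs y i) t0 (clamp t0 r t) (y t i - c i)).
  { intros t i.
    destruct (filterlim_RInt (fun n => rhs (iterate n) i) t0 (clamp t0 r t) eventually _
                (rhs y i) (fun n => RInt (rhs (iterate n) i) t0 (clamp t0 r t)))
      as (L & HL & HI).
    - intros n. apply @RInt_correct, rhs_ex_RInt, iterate_continuous.
    - apply Hrhs.
    - replace (y t i - c i) with L; trivial.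
      assert (E : c i + L = y t i); [|lra].
      apply (filterlim_locally_unique (V := R_NormedModule)
               (F := eventually) (fun n => iterate (S n) t i)).
      + unfold iterate, step; simpl.
        apply (filterlim_comp_2 (G := locally (c i)) (H := locally L)
                 (fun _ => c i) (fun n => RInt (rhs (iterate n) i) t0 (clamp t0 r t)) Rplus).
        * apply filterlim_const.
        * exact HL.
        * apply (filterlim_plus (V := R_NormedModule)).
      + apply (filterlim_comp nat nat R S (fun n => iterate n t i) eventually eventually); trivial.
        intros P [N HN]. exists N. intros n Hn. apply HN. lia. }
  assert (Hloc : forall t, Rabs (t - t0) < r ->
                 locally t (fun s => Rabs (s - t0) < r)).
  { intros t Ht. apply (locally_Rabs _ t (r - Rabs (t - t0))); [lra|].
    intros s Hs. replace (s - t0) with ((s - t) + (t - t0)) by ring.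
    apply Rle_lt_trans with (1 := Rabs_triang _ _). lra. }
  assert (HintI : forall t i, Rabs (t - t0) < r ->
            locally t (fun s => is_RInt (rhs y i) t0 s (y s i - c i))).
  { intros t i Ht. generalize (Hloc t Ht). apply filter_imp. intros s Hs.
    rewrite <- (clamp_id t0 r s) at 1; [|lra]. apply Hint. }
  assert (Hcont : forall t i, Rabs (t - t0) < r -> continuous (fun s => y s i) t).
  { intros t i Ht.
    apply continuous_ext with (fun s => (y s i - c i) + c i); [intros; simpl; ring|].
    apply @continuous_plus; [|apply continuous_const].
    apply (continuous_RInt_1 (rhs y i) t0 t). now apply HintI. }
  exists y. split.
  - intros i. assert (H := Hint t0 i).
    rewrite clamp_id in H by (rewrite Rminus_diag, Rabs_R0; lra).
    assert (E := is_RInt_unique _ _ _ _ H).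
    assert (E' := RInt_point (V := R_CompleteNormedModule) t0 (rhs y i)).
    rewrite E in E'. change zero with 0 in E'. lra.
  - intros t i Ht.
    replace (F t (y t) i) with (rhs y i t + 0)
      by (unfold rhs; rewrite clamp_id by lra; ring).
    apply is_derive_ext with (fun s => (y s i - c i) + c i); [intros; simpl; ring|].
    apply (@is_derive_plus R_AbsRing R_NormedModule (fun s => y s i - c i) (fun _ => c i)).
    + apply (is_derive_RInt (rhs y i) (fun s => y s i - c i) t0 t).
      * now apply HintI.
      * apply continuous_ext_loc with (fun s => F s (y s) i).
        -- generalize (Hloc t Ht). apply filter_imp. intros s Hs.
           unfold rhs. now rewrite clamp_id by lra.
        -- apply F_cont; [lra|]. intros j. now apply Hcont.
    + apply (@is_derive_const R_AbsRing R_NormedModule).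
Qed.

End Picard.

(** Gronwall's inequality on both sides of [t0], in differential form. *)
Lemma gronwall (phi dphi : R -> R) (t0 r C e t : R) :
  (forall s, Rabs (s - t0) < r -> is_derive phi s (dphi s)) ->
  (forall s, Rabs (s - t0) < r -> Rabs (dphi s) <= C * (phi s + e)) ->
  Rabs (t - t0) < r ->
  phi t + e <= (phi t0 + e) * exp (C * Rabs (t - t0)).
Proof.
  intros Hd Hb Ht.
  assert (H : forall k, (k = C /\ t <= t0 \/ k = - C /\ t0 <= t) ->
              (phi t + e) * exp (k * (t - t0)) <= phi t0 + e).
  { intros k Hk.
    set (psi := fun s => (phi s + e) * exp (k * (s - t0))).
    set (dpsi := fun s => (dphi s + k * (phi s + e)) * exp (k * (s - t0))).
    assert (Hpsi : forall s, Rabs (s - t0) < r -> is_derive psi s (dpsi s)).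
    { intros s Hs. unfold psi, dpsi. specialize (Hd s Hs).
      auto_derive.
      - now exists (dphi s).
      - replace (Derive (fun x => phi x) s) with (dphi s)
          by (symmetry; apply is_derive_unique, Hd). unfold Rminus; ring. }
    assert (Hin : forall s, Rmin t0 t <= s <= Rmax t0 t -> Rabs (s - t0) < r).
    { intros s Hs. apply Rabs_lt_between in Ht. apply Rabs_lt_between.
      unfold Rmin, Rmax in Hs. destruct (Rle_dec t0 t); lra. }
    destruct (MVT_gen psi t0 t dpsi) as (s & Hs & E).
    - intros s Hs. apply Hpsi, Hin. lra.
    - intros s Hs. apply ex_derive_continuity_pt. exists (dpsi s). now apply Hpsi, Hin.
    - assert (Hs' := Hb s (Hin s Hs)).
      apply Rabs_le_between in Hs'.
      assert (Hexp := exp_pos (k * (s - t0))).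
      assert (E0 : psi t0 = phi t0 + e)
        by (unfold psi; rewrite Rminus_diag, Rmult_0_r, exp_0; ring).
      change (psi t <= phi t0 + e). rewrite <- E0.
      assert (dpsi s * (t - t0) <= 0); [|lra].
      unfold dpsi. destruct Hk as [[-> Hk]|[-> Hk]].
      + assert (0 <= (dphi s + C * (phi s + e)) * exp (C * (s - t0)))
          by (apply Rmult_le_pos; lra). nra.
      + assert (0 <= (- dphi s - (- C) * (phi s + e)) * exp (- C * (s - t0)))
          by (apply Rmult_le_pos; lra). nra. }
  assert (H' : (phi t + e) * exp (- (C * Rabs (t - t0))) <= phi t0 + e).
  { destruct (Rle_dec t t0) as [L|L].
    - replace (- (C * Rabs (t - t0))) with (C * (t - t0))
        by (rewrite Rabs_left1 by lra; ring). apply H. now left.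
    - replace (- (C * Rabs (t - t0))) with (- C * (t - t0))
        by (rewrite Rabs_pos_eq by lra; ring). apply H. right. split; [trivial|lra]. }
  apply Rmult_le_compat_r with (r := exp (C * Rabs (t - t0))) in H';
    [|apply Rlt_le, exp_pos].
  rewrite Rmult_assoc, <- exp_plus in H'.
  replace (- (C * Rabs (t - t0)) + C * Rabs (t - t0)) with 0 in H' by ring.
  now rewrite exp_0, Rmult_1_r in H'.
Qed.

(** * The frame system *)

(** The index set of the three unknowns [x], [y], [l]: a frame system acts on the triple of
    the [i]-th components of [X], [Y] and [l], for each [i] separately. *)
Inductive component : Set := comp_x | comp_y | comp_l.

(** The infinitesimal Lorentz transformation with coefficients [m], [b], [d]; the [u]-equations
    have [(m, b, d) = (al, be, 0)] and the [v]-equations [(ga, 0, de)]. *)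
Definition frame_field (m b d : R) (w : component -> R) (i : component) : R :=
  match i with
  | comp_x => m * w comp_y - b * w comp_l
  | comp_y => - m * w comp_x - d * w comp_l
  | comp_l => - b * w comp_x - d * w comp_y
  end.

Lemma Rabs_mult_le x y a b : Rabs x <= a -> Rabs y <= b -> Rabs (x * y) <= a * b.
Proof.
  intros Hx Hy. rewrite Rabs_mult. apply Rmult_le_compat; trivial; apply Rabs_pos.
Qed.

Lemma Rabs_plus_le x y a b : Rabs x <= a -> Rabs y <= b -> Rabs (x + y) <= a + b.
Proof. intros Hx Hy. apply Rle_trans with (1 := Rabs_triang _ _). lra. Qed.

Lemma Rabs_minus_le x y a b : Rabs x <= a -> Rabs y <= b -> Rabs (x - y) <= a + b.
Proof. intros Hx Hy. apply Rabs_plus_le; trivial. now rewrite Rabs_Ropp. Qed.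

Lemma Rabs_opp_le x a : Rabs x <= a -> Rabs (- x) <= a.
Proof. now rewrite Rabs_Ropp. Qed.

Lemma frame_field_bound K d' m b d w i :
  Rabs m <= K -> Rabs b <= K -> Rabs d <= K -> (forall j, Rabs (w j) <= d') ->
  Rabs (frame_field m b d w i) <= 2 * K * d'.
Proof.
  intros Hm Hb Hd Hw. replace (2 * K * d') with (K * d' + K * d') by ring.
  destruct i; simpl; apply Rabs_minus_le; apply Rabs_mult_le; trivial; now apply Rabs_opp_le.
Qed.

Lemma frame_ode (m b d : R -> R) (t0 r K : R) (c : component -> R) :
  0 < r -> 2 * K * r < 1 ->
  (forall t, Rabs (t - t0) <= r ->
     continuous m t /\ continuous b t /\ continuous d t /\
     Rabs (m t) <= K /\ Rabs (b t) <= K /\ Rabs (d t) <= K) ->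
  exists w : R -> component -> R,
    (forall i, w t0 i = c i) /\
    (forall t i, Rabs (t - t0) < r ->
       is_derive (fun s => w s i) t (frame_field (m t) (b t) (d t) (w t) i)).
Proof.
  intros Hr HK H.
  assert (K0 : 0 <= K).
  { destruct (H t0) as (_ & _ & _ & Hm & _); [rewrite Rminus_diag, Rabs_R0; lra|].
    apply Rle_trans with (2 := Hm), Rabs_pos. }
  set (A := Rabs (c comp_x) + Rabs (c comp_y) + Rabs (c comp_l)).
  apply (picard_lindelof component (fun t => frame_field (m t) (b t) (d t)) c t0 r (2 * K)
           (2 * K * A)); trivial.
  - lra.
  - intros y t i Ht Hy. destruct (H t Ht) as (Cm & Cb & Cd & _).
    destruct i; simpl; apply @continuous_minus; apply @continuous_mult; trivial;
      now apply @continuous_opp.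
  - intros t x y e Ht He i. destruct (H t Ht) as (_ & _ & _ & Bm & Bb & Bd).
    replace (frame_field (m t) (b t) (d t) x i - frame_field (m t) (b t) (d t) y i)
      with (frame_field (m t) (b t) (d t) (fun j => x j - y j) i)
      by (destruct i; simpl; ring).
    now apply frame_field_bound.
  - intros t i Ht. destruct (H t Ht) as (_ & _ & _ & Bm & Bb & Bd).
    apply frame_field_bound; trivial. unfold A.
    assert (P := Rabs_pos). intros []; specialize (P (c comp_x)) as P1;
      specialize (P (c comp_y)) as P2; specialize (P (c comp_l)) as P3; lra.
Qed.

(** The energy estimate for the system with sources [s1], [s2], [s3].  The terms in [m] cancel
    in the derivative of the sum of squares, so no bound on [m] is needed. *)
Lemma frame_energy (m b d s1 s2 s3 x y l : R -> R) (t0 r K e t : R) :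
  (forall t, Rabs (t - t0) < r ->
     Rabs (b t) <= K /\ Rabs (d t) <= K /\
     Rabs (s1 t) <= e /\ Rabs (s2 t) <= e /\ Rabs (s3 t) <= e) ->
  (forall t, Rabs (t - t0) < r ->
     is_derive x t (m t * y t - b t * l t + s1 t) /\
     is_derive y t (- m t * x t - d t * l t + s2 t) /\
     is_derive l t (- b t * x t - d t * y t + s3 t)) ->
  Rabs (t - t0) < r ->
  x t ^ 2 + y t ^ 2 + l t ^ 2
  <= (x t0 ^ 2 + y t0 ^ 2 + l t0 ^ 2 + 3 * e ^ 2) * exp ((4 * K + 1) * r).
Proof.
  intros HB HD Ht.
  assert (Hr : 0 < r) by (apply Rle_lt_trans with (2 := Ht), Rabs_pos).
  assert (H0 : Rabs (t0 - t0) < r) by (now rewrite Rminus_diag, Rabs_R0).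
  assert (K0 : 0 <= K).
  { destruct (HB t0 H0) as (Hb & _). apply Rle_trans with (2 := Hb), Rabs_pos. }
  set (phi := fun t => x t ^ 2 + y t ^ 2 + l t ^ 2).
  set (dphi := fun t => - 4 * (b t * (x t * l t) + d t * (y t * l t))
                        + 2 * (x t * s1 t + y t * s2 t + l t * s3 t)).
  assert (G : phi t + 3 * e ^ 2
              <= (phi t0 + 3 * e ^ 2) * exp ((4 * K + 1) * Rabs (t - t0))).
  { apply (gronwall phi dphi t0 r); trivial.
    - intros s Hs. destruct (HD s Hs) as (Dx & Dy & Dl).
      unfold phi, dphi. auto_derive.
      + repeat split; eexists; eassumption.
      + replace (Derive (fun x0 => x x0) s) with (m s * y s - b s * l s + s1 s)
          by (symmetry; apply is_derive_unique, Dx).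
        replace (Derive (fun x0 => y x0) s) with (- m s * x s - d s * l s + s2 s)
          by (symmetry; apply is_derive_unique, Dy).
        replace (Derive (fun x0 => l x0) s) with (- b s * x s - d s * y s + s3 s)
          by (symmetry; apply is_derive_unique, Dl).
        ring.
    - intros s Hs. destruct (HB s Hs) as (Bb & Bd & B1 & B2 & B3).
      assert (Q : forall p q, Rabs (p * q) <= (p ^ 2 + q ^ 2) / 2).
      { intros p q. apply Rabs_le.
        assert (0 <= (p + q) ^ 2) by apply pow2_ge_0.
        assert (0 <= (p - q) ^ 2) by apply pow2_ge_0. split; lra. }
      assert (Q' : forall p q, Rabs q <= e -> Rabs (p * q) <= (p ^ 2 + e ^ 2) / 2).
      { intros p q Hq. apply Rle_trans with (1 := Q p q).
        assert (q ^ 2 <= e ^ 2); [|lra]. rewrite <- (pow2_abs q). apply pow_incr.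
        split; [apply Rabs_pos|trivial]. }
      assert (E1 := Rabs_mult_le _ _ _ _ Bb (Q (x s) (l s))).
      assert (E2 := Rabs_mult_le _ _ _ _ Bd (Q (y s) (l s))).
      assert (F1 := Q' (x s) _ B1). assert (F2 := Q' (y s) _ B2).
      assert (F3 := Q' (l s) _ B3).
      unfold dphi, phi. apply Rabs_le_between in E1, E2, F1, F2, F3. apply Rabs_le_between.
      assert (0 <= K * x s ^ 2) by (apply Rmult_le_pos; [lra|apply pow2_ge_0]).
      assert (0 <= K * y s ^ 2) by (apply Rmult_le_pos; [lra|apply pow2_ge_0]).
      assert (0 <= K * l s ^ 2) by (apply Rmult_le_pos; [lra|apply pow2_ge_0]).
      assert (0 <= K * e ^ 2) by (apply Rmult_le_pos; [lra|apply pow2_ge_0]).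
      lra. }
  change (phi t <= (phi t0 + 3 * e ^ 2) * exp ((4 * K + 1) * r)).
  assert (P : 0 <= phi t0 + 3 * e ^ 2) by (unfold phi;
        generalize (pow2_ge_0 (x t0)) (pow2_ge_0 (y t0)) (pow2_ge_0 (l t0)) (pow2_ge_0 e);
        lra).
  apply Rle_trans with ((phi t0 + 3 * e ^ 2) * exp ((4 * K + 1) * Rabs (t - t0))).
  - assert (0 <= e ^ 2) by apply pow2_ge_0. lra.
  - apply Rmult_le_compat_l; trivial. apply Rlt_le, exp_increasing. nra.
Qed.

Lemma is_derive_eps (f : R -> R) (x l : R) :
  is_derive f x l <->
  (forall e, 0 < e -> exists d, 0 < d /\
     forall h, Rabs h < d -> Rabs (f (x + h) - f x - h * l) <= e * Rabs h).
Proof.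
  split.
  - intros H e He. apply is_derive_Reals in H. destruct (H e He) as [d Hd].
    exists d. split; [apply cond_pos|]. intros h Hh.
    destruct (Req_dec h 0) as [->|Nh].
    + rewrite Rplus_0_r.
      replace (f x - f x - 0 * l) with 0 by ring. rewrite Rabs_R0. lra.
    + replace (f (x + h) - f x - h * l) with (((f (x + h) - f x) / h - l) * h)
        by (field; trivial).
      rewrite Rabs_mult. apply Rmult_le_compat_r; [apply Rabs_pos|].
      now apply Rlt_le, Hd.
  - intros H. apply is_derive_Reals. intros e He.
    destruct (H (e / 2)) as (d & Hd & Hh); [lra|].
    exists (mkposreal d Hd). intros h Nh Hhd. simpl in Hhd.
    specialize (Hh h Hhd).
    assert (Ph := Rabs_pos_lt h Nh).
    replace ((f (x + h) - f x) / h - l) with ((f (x + h) - f x - h * l) * / h)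
      by (field; trivial).
    rewrite Rabs_mult, Rabs_inv. apply Rle_lt_trans with (e / 2); [|lra].
    apply Rmult_le_reg_r with (Rabs h); trivial.
    rewrite Rmult_assoc, Rinv_l by lra. lra.
Qed.

(** The dependence of the solutions of the [v]-equations on [u].  [gau] and [deu] stand for the
    [u]-derivatives of [ga] and [de]; they are only used through first-order expansions
    with quadratic error. *)
Section Dependence.
Variables (u0 v0 r K M : R).
Variables (al be ga de alv bev gau deu x y l : R -> R -> R).
Let Q := square u0 v0 r.
Hypothesis K_pos : 1 <= K.
Hypothesis M_pos : 0 <= M.
Hypothesis al_v : forall u v, Q (u, v) -> is_derive (fun s => al u s) v (alv u v).
Hypothesis be_v : forall u v, Q (u, v) -> is_derive (fun s => be u s) v (bev u v).
Hypothesis compat_al : forall u v, Q (u, v) -> alv u v + be u v * de u v = gau u v.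
Hypothesis compat_be : forall u v, Q (u, v) -> bev u v = - al u v * de u v.
Hypothesis compat_de : forall u v, Q (u, v) -> deu u v = be u v * ga u v.
Hypothesis coef_bound : forall u v, Q (u, v) ->
  Rabs (al u v) <= K /\ Rabs (be u v) <= K /\ Rabs (ga u v) <= K /\ Rabs (de u v) <= K.
Hypothesis coef_taylor : forall u v h, Q (u, v) -> Q (u + h, v) ->
  Rabs (ga (u + h) v - ga u v) <= K * Rabs h /\
  Rabs (de (u + h) v - de u v) <= K * Rabs h /\
  Rabs (ga (u + h) v - ga u v - h * gau u v) <= K * h ^ 2 /\
  Rabs (de (u + h) v - de u v - h * deu u v) <= K * h ^ 2.
Hypothesis sol_bound : forall u v, Q (u, v) ->
  Rabs (x u v) <= M /\ Rabs (y u v) <= M /\ Rabs (l u v) <= M.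
Hypothesis sol_v : forall u v, Q (u, v) ->
  is_derive (fun s => x u s) v (ga u v * y u v) /\
  is_derive (fun s => y u s) v (- ga u v * x u v - de u v * l u v) /\
  is_derive (fun s => l u s) v (- de u v * y u v).

(** Remainders of the first-order expansions that the [u]-equations predict. *)
Let rx h u v := x (u + h) v - x u v - h * (al u v * y u v - be u v * l u v).
Let ry h u v := y (u + h) v - y u v - h * (- al u v * x u v).
Let rl h u v := l (u + h) v - l u v - h * (- be u v * x u v).

(** Increments of the coefficients, and remainders of their first-order expansions. *)
Let dga h u v := ga (u + h) v - ga u v.
Let dde h u v := de (u + h) v - de u v.
Let tga h u v := ga (u + h) v - ga u v - h * gau u v.
Let tde h u v := de (u + h) v - de u v - h * deu u v.

(** By compatibility, the remainders solve the [v]-system at [u + h] up to terms which are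
    quadratic in [h]. *)
Lemma remainder_v h u v : Q (u, v) -> Q (u + h, v) ->
  is_derive (fun s => rx h u s) v
    (ga (u + h) v * ry h u v - 0 * rl h u v
     + (tga h u v * y u v - h * (al u v * dga h u v * x u v))) /\
  is_derive (fun s => ry h u s) v
    (- ga (u + h) v * rx h u v - de (u + h) v * rl h u v
     + (- (tga h u v * x u v) - tde h u v * l u v
        + h * (be u v * dde h u v * x u v - al u v * dga h u v * y u v
               + be u v * dga h u v * l u v))) /\
  is_derive (fun s => rl h u s) v
    (- 0 * rx h u v - de (u + h) v * ry h u v
     + (- (tde h u v * y u v) + h * (al u v * dde h u v * x u v))).
Proof.
  intros Huv Hhv.
  destruct (sol_v u v Huv) as (Dx & Dy & Dl).
  destruct (sol_v (u + h) v Hhv) as (Dx' & Dy' & Dl').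
  assert (Da := al_v u v Huv). assert (Db := be_v u v Huv).
  assert (Ca : alv u v = gau u v - be u v * de u v)
    by (rewrite <- (compat_al u v Huv); ring).
  assert (Cb := compat_be u v Huv). assert (Cd := compat_de u v Huv).
  assert (Ux : Derive (fun s => x u s) v = _) by apply is_derive_unique, Dx.
  assert (Uy : Derive (fun s => y u s) v = _) by apply is_derive_unique, Dy.
  assert (Ul : Derive (fun s => l u s) v = _) by apply is_derive_unique, Dl.
  assert (Ux' : Derive (fun s => x (u + h) s) v = _) by apply is_derive_unique, Dx'.
  assert (Uy' : Derive (fun s => y (u + h) s) v = _) by apply is_derive_unique, Dy'.
  assert (Ul' : Derive (fun s => l (u + h) s) v = _) by apply is_derive_unique, Dl'.
  assert (Ua : Derive (fun s => al u s) v = _) by apply is_derive_unique, Da.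
  assert (Ub : Derive (fun s => be u s) v = _) by apply is_derive_unique, Db.
  unfold rx, ry, rl, tga, tde, dga, dde. rewrite Cd.
  split; [|split].
  - auto_derive; [repeat split; eexists; eassumption|].
    rewrite Ux, Ux', Uy, Ul, Ua, Ub, Ca, Cb. ring.
  - auto_derive; [repeat split; eexists; eassumption|].
    rewrite Ux, Uy', Uy, Ua, Ca. ring.
  - auto_derive; [repeat split; eexists; eassumption|].
    rewrite Ux, Ul', Ul, Ub, Cb. ring.
Qed.

Lemma source_bound h u v : Q (u, v) -> Q (u + h, v) ->
  Rabs (tga h u v * y u v - h * (al u v * dga h u v * x u v)) <= 5 * K ^ 2 * M * h ^ 2 /\
  Rabs (- (tga h u v * x u v) - tde h u v * l u v
        + h * (be u v * dde h u v * x u v - al u v * dga h u v * y u v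
               + be u v * dga h u v * l u v)) <= 5 * K ^ 2 * M * h ^ 2 /\
  Rabs (- (tde h u v * y u v) + h * (al u v * dde h u v * x u v)) <= 5 * K ^ 2 * M * h ^ 2.
Proof.
  intros Huv Hhv.
  destruct (coef_bound u v Huv) as (Ba & Bb & _ & _).
  destruct (coef_taylor u v h Huv Hhv) as (Tg & Td & Rg & Rd).
  destruct (sol_bound u v Huv) as (Bx & By & Bl).
  assert (A1 : forall p w, Rabs p <= K * h ^ 2 -> Rabs w <= M ->
                 Rabs (p * w) <= K ^ 2 * M * h ^ 2).
  { intros p w Hp Hw. apply Rle_trans with (1 := Rabs_mult_le _ _ _ _ Hp Hw).
    assert (0 <= K * (K - 1) * (M * h ^ 2)); [|lra].
    apply Rmult_le_pos; apply Rmult_le_pos; try lra. apply pow2_ge_0. }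
  assert (A2 : forall p q w, Rabs p <= K -> Rabs q <= K * Rabs h -> Rabs w <= M ->
                 Rabs (h * (p * q * w)) <= K ^ 2 * M * h ^ 2).
  { intros p q w Hp Hq Hw.
    assert (E := Rabs_mult_le _ _ _ _ (Rle_refl (Rabs h))
                  (Rabs_mult_le _ _ _ _ (Rabs_mult_le _ _ _ _ Hp Hq) Hw)).
    apply Rle_trans with (1 := E). right. rewrite <- (pow2_abs h). ring. }
  assert (P : 0 <= K ^ 2 * M * h ^ 2).
  { apply Rmult_le_pos; [apply Rmult_le_pos; [apply pow2_ge_0|lra]|apply pow2_ge_0]. }
  rewrite !Rmult_plus_distr_l, !Rmult_minus_distr_l.
  assert (E1 := A1 _ _ Rg By). assert (E2 := A1 _ _ Rg Bx). assert (E3 := A1 _ _ Rd Bl).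
  assert (E4 := A1 _ _ Rd By).
  assert (G1 := A2 _ _ _ Ba Tg Bx). assert (G2 := A2 _ _ _ Bb Td Bx).
  assert (G3 := A2 _ _ _ Ba Tg By). assert (G4 := A2 _ _ _ Bb Tg Bl).
  assert (G5 := A2 _ _ _ Ba Td Bx).
  change (ga (u + h) v - ga u v - h * gau u v) with (tga h u v) in *.
  change (de (u + h) v - de u v - h * deu u v) with (tde h u v) in *.
  change (ga (u + h) v - ga u v) with (dga h u v) in *.
  change (de (u + h) v - de u v) with (dde h u v) in *.
  apply Rabs_le_between in E1, E2, E3, E4, G1, G2, G3, G4, G5.
  repeat split; apply Rabs_le_between; split; lra.
Qed.

Hypothesis sol_u : forall u, Rabs (u - u0) < r ->
  is_derive (fun s => x s v0) u (al u v0 * y u v0 - be u v0 * l u v0) /\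
  is_derive (fun s => y s v0) u (- al u v0 * x u v0) /\
  is_derive (fun s => l s v0) u (- be u v0 * x u v0).

Lemma remainder_small u v e : Q (u, v) -> 0 < e ->
  exists d, 0 < d /\ forall h, Rabs h < d ->
    rx h u v ^ 2 + ry h u v ^ 2 + rl h u v ^ 2 <= (e * Rabs h) ^ 2.
Proof.
  intros [Hu Hv] He. simpl in Hu, Hv.
  set (E := exp ((4 * K + 1) * r)).
  assert (Hr : 0 < r) by (apply Rle_lt_trans with (2 := Hu), Rabs_pos).
  assert (E1 : 1 <= E).
  { apply Rle_trans with (exp 0); [rewrite exp_0; lra|].
    apply Rlt_le, exp_increasing, Rmult_lt_0_compat; lra. }
  set (W := 3 * (5 * K ^ 2 * M) ^ 2 * E + 1).
  assert (HW : 1 <= W).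
  { unfold W. assert (0 <= 3 * (5 * K ^ 2 * M) ^ 2 * E); [|lra].
    apply Rmult_le_pos; [|lra]. apply Rmult_le_pos; [lra|apply pow2_ge_0]. }
  destruct (sol_u u Hu) as (Dx & Dy & Dl).
  (* [n] makes [3 n^2 E <= e^2 / 2]; the bound [e / (2 W)] on [h] absorbs the source terms *)
  set (n := e / (3 * E)).
  assert (Hn : 0 < n) by (apply Rdiv_lt_0_compat; lra).
  destruct (proj1 (is_derive_eps _ _ _) Dx n Hn) as (d1 & Hd1 & X1).
  destruct (proj1 (is_derive_eps _ _ _) Dy n Hn) as (d2 & Hd2 & X2).
  destruct (proj1 (is_derive_eps _ _ _) Dl n Hn) as (d3 & Hd3 & X3).
  set (d := Rmin (Rmin d1 (Rmin d2 d3)) (Rmin (r - Rabs (u - u0)) (e / (2 * W)))).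
  exists d. split.
  { unfold d. repeat apply Rmin_case; trivial; [lra|]. apply Rdiv_lt_0_compat; lra. }
  intros h Hh.
  assert (L1 : Rabs h < d1) by (apply Rlt_le_trans with (1 := Hh); unfold d;
    eapply Rle_trans; [apply Rmin_l|]; apply Rmin_l).
  assert (L2 : Rabs h < d2) by (apply Rlt_le_trans with (1 := Hh); unfold d;
    eapply Rle_trans; [apply Rmin_l|]; eapply Rle_trans; [apply Rmin_r|]; apply Rmin_l).
  assert (L3 : Rabs h < d3) by (apply Rlt_le_trans with (1 := Hh); unfold d;
    eapply Rle_trans; [apply Rmin_l|]; eapply Rle_trans; [apply Rmin_r|]; apply Rmin_r).
  assert (L4 : Rabs h < r - Rabs (u - u0)) by (apply Rlt_le_trans with (1 := Hh); unfold d;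
    eapply Rle_trans; [apply Rmin_r|]; apply Rmin_l).
  assert (L5 : Rabs h < e / (2 * W)) by (apply Rlt_le_trans with (1 := Hh); unfold d;
    eapply Rle_trans; [apply Rmin_r|]; apply Rmin_r).
  specialize (X1 h L1). specialize (X2 h L2). specialize (X3 h L3).
  assert (Huh : Rabs (u + h - u0) < r).
  { replace (u + h - u0) with (h + (u - u0)) by ring.
    apply Rle_lt_trans with (1 := Rabs_triang _ _). lra. }
  assert (G := frame_energy (fun t => ga (u + h) t) (fun _ => 0) (fun t => de (u + h) t)
    _ _ _ (rx h u) (ry h u) (rl h u) v0 r K (5 * K ^ 2 * M * h ^ 2) v
    (fun t Ht => conj (eq_ind_r (fun z => z <= K) (Rle_trans _ _ _ Rle_0_1 K_pos) Rabs_R0)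
       (conj (proj2 (proj2 (proj2 (coef_bound (u + h) t (conj Huh Ht)))))
          (source_bound h u t (conj Hu Ht) (conj Huh Ht))))
    (fun t Ht => remainder_v h u t (conj Hu Ht) (conj Huh Ht)) Hv).
  apply Rle_trans with (1 := G). fold E. clear G.
  assert (S : forall p, Rabs p <= n * Rabs h -> p ^ 2 <= n ^ 2 * h ^ 2).
  { intros p Hp. rewrite <- (pow2_abs p), <- (pow2_abs h), <- Rpow_mult_distr.
    apply pow_incr. split; [apply Rabs_pos|trivial]. }
  apply S in X1, X2, X3.
  change (rx h u v0 ^ 2 <= n ^ 2 * h ^ 2) in X1.
  change (ry h u v0 ^ 2 <= n ^ 2 * h ^ 2) in X2.
  change (rl h u v0 ^ 2 <= n ^ 2 * h ^ 2) in X3.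
  assert (h2 : 0 <= h ^ 2) by apply pow2_ge_0.
  apply Rle_trans with ((3 * (n ^ 2 * h ^ 2) + 3 * (5 * K ^ 2 * M * h ^ 2) ^ 2) * E).
  { apply Rmult_le_compat_r; lra. }
  assert (N1 : 3 * n ^ 2 * E <= e ^ 2 / 2).
  { replace (3 * n ^ 2 * E) with (e ^ 2 / 3 * / E) by (unfold n; field; lra).
    assert (/ E <= 1) by (rewrite <- Rinv_1; apply Rinv_le_contravar; lra).
    assert (0 <= e ^ 2) by apply pow2_ge_0.
    assert (0 < / E) by (apply Rinv_0_lt_compat; lra). nra. }
  assert (N2 : W * h ^ 2 <= e ^ 2 / 2).
  { assert (Hh2 : h ^ 2 <= (e / (2 * W)) ^ 2).
    { rewrite <- (pow2_abs h). apply pow_incr. split; [apply Rabs_pos|lra]. }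
    apply Rle_trans with (W * (e / (2 * W)) ^ 2); [apply Rmult_le_compat_l; lra|].
    replace (W * (e / (2 * W)) ^ 2) with (e ^ 2 / 4 * / W) by (field; lra).
    assert (/ W <= 1) by (rewrite <- Rinv_1; apply Rinv_le_contravar; lra).
    assert (0 <= e ^ 2) by apply pow2_ge_0.
    assert (0 < / W) by (apply Rinv_0_lt_compat; lra). nra. }
  rewrite (Rpow_mult_distr e (Rabs h)), pow2_abs.
  replace ((3 * (n ^ 2 * h ^ 2) + 3 * (5 * K ^ 2 * M * h ^ 2) ^ 2) * E) with
    ((3 * n ^ 2 * E + (W - 1) * h ^ 2) * h ^ 2) by (unfold W; ring).
  apply Rmult_le_compat_r; trivial. lra.
Qed.

(** If a family of solutions in the second variable solves the system in the first
    variable along one line, then compatibility makes it solve it everywhere: the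
    first-order remainder solves the same system up to a source of second order. *)
Lemma parameter_derivative u v : Q (u, v) ->
  is_derive (fun s => x s v) u (al u v * y u v - be u v * l u v) /\
  is_derive (fun s => y s v) u (- al u v * x u v) /\
  is_derive (fun s => l s v) u (- be u v * x u v).
Proof.
  intros Huv.
  assert (S : forall p q, 0 <= q -> p ^ 2 <= q ^ 2 -> Rabs p <= q).
  { intros p q Hq Hp. rewrite <- (Rabs_pos_eq q Hq). apply Rsqr_le_abs_0.
    unfold Rsqr. lra. }
  split; [|split]; apply is_derive_eps; intros e He;
    destruct (remainder_small u v e Huv He) as (d & Hd & H);
    exists d; split; trivial; intros h Hh; specialize (H h Hh);
    assert (P1 := pow2_ge_0 (rx h u v)); assert (P2 := pow2_ge_0 (ry h u v));
    assert (P3 := pow2_ge_0 (rl h u v));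
    (apply S; [apply Rmult_le_pos; [lra|apply Rabs_pos]|]).
  - change (rx h u v ^ 2 <= (e * Rabs h) ^ 2). lra.
  - change (ry h u v ^ 2 <= (e * Rabs h) ^ 2). lra.
  - change (rl h u v ^ 2 <= (e * Rabs h) ^ 2). lra.
Qed.

End Dependence.

(** Finitely many smooth functions have a common bound near a point. *)
Lemma common_bound (D : R * R -> Prop) u0 v0 (hs : list (R -> R -> R)) :
  open D -> D (u0, v0) -> (forall h, In h hs -> smooth2 D h) ->
  exists r K, 0 < r /\ 1 <= K /\ (forall p, square u0 v0 r p -> D p) /\
    forall h, In h hs -> forall u v, square u0 v0 r (u, v) -> Rabs (h u v) <= K.
Proof.
  intros HD H0. induction hs as [|h hs IH]; intros H.
  - destruct (square_in_open D u0 v0 HD H0) as (r & Hr & Hs).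
    exists r, 1. repeat split; trivial; [lra|]. intros h [].
  - destruct IH as (r & K & Hr & HK & Hs & HB).
    { intros k Hk. apply H. now right. }
    destruct (continuity_2d_bounded h u0 v0) as (r' & Hr' & Hs').
    { apply smooth2_continuity with D; trivial. apply H. now left. }
    set (K' := Rmax K (Rabs (h u0 v0) + 1)).
    assert (A1 := Rmax_l K (Rabs (h u0 v0) + 1)).
    assert (A2 := Rmax_r K (Rabs (h u0 v0) + 1)).
    exists (Rmin r r'), K'. fold K' in A1, A2.
    split; [now apply Rmin_case|]. split; [lra|]. split.
    + intros p Hp. apply Hs, square_le with (2 := Hp), Rmin_l.
    + intros k [<-|Hk] u v Huv.
      * apply Rle_trans with (2 := A2), Hs', square_le with (2 := Huv), Rmin_r.
      * apply Rle_trans with (2 := A1), (HB k Hk), square_le with (2 := Huv), Rmin_l.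
Qed.

Lemma first_order_bounds (h h' h'' : R -> R) (u0 r K s d : R) :
  (forall t, Rabs (t - u0) < r -> is_derive h t (h' t)) ->
  (forall t, Rabs (t - u0) < r -> is_derive h' t (h'' t)) ->
  (forall t, Rabs (t - u0) < r -> Rabs (h' t) <= K /\ Rabs (h'' t) <= K) ->
  Rabs (s - u0) < r -> Rabs (s + d - u0) < r ->
  Rabs (h (s + d) - h s) <= K * Rabs d /\
  Rabs (h (s + d) - h s - d * h' s) <= K * d ^ 2.
Proof.
  intros H1 H2 HK Hs Hd.
  assert (K0 : 0 <= K) by (apply Rle_trans with (2 := proj1 (HK s Hs)), Rabs_pos).
  assert (Hsd : forall t, Rmin s (s + d) <= t <= Rmax s (s + d) ->
            Rabs (t - u0) < r /\ Rabs (t - s) <= Rabs d).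
  { intros t Ht. apply Rabs_lt_between in Hs, Hd.
    unfold Rmin, Rmax in Ht. split.
    - apply Rabs_lt_between. destruct (Rle_dec s (s + d)); lra.
    - unfold Rabs. destruct (Rle_dec s (s + d)), (Rcase_abs (t - s)), (Rcase_abs d); lra. }
  split.
  - replace (Rabs d) with (Rabs (s + d - s)) by (f_equal; ring).
    apply (segment_lipschitz h h' K s (s + d) r u0); trivial.
    intros t Ht. apply HK, Ht.
  - destruct (MVT_gen h s (s + d) h') as (t & Ht & E).
    + intros t Ht. apply H1, Hsd. lra.
    + intros t Ht. apply ex_derive_continuity_pt. exists (h' t). now apply H1, Hsd.
    + rewrite E. replace (h' t * (s + d - s) - d * h' s) with (d * (h' t - h' s)) by ring.
      destruct (Hsd t Ht) as [Ht1 Ht2].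
      rewrite Rabs_mult, <- (pow2_abs d).
      assert (L : Rabs (h' t - h' s) <= K * Rabs (t - s)).
      { apply (segment_lipschitz h' h'' K s t r u0); trivial. intros q Hq. apply HK, Hq. }
      assert (K * Rabs (t - s) <= K * Rabs d) by now apply Rmult_le_compat_l.
      assert (P := Rabs_pos d).
      apply Rle_trans with (Rabs d * (K * Rabs d)); [|right; ring].
      apply Rmult_le_compat_l; lra.
Qed.

(** Bootstrap: the partial derivatives of a solution are polynomials in the solution and the
    coefficients. *)
Lemma frame_system_smooth (Q : R * R -> Prop) al be ga de x y l :
  open Q -> smooth2 Q al -> smooth2 Q be -> smooth2 Q ga -> smooth2 Q de ->
  (forall u v, Q (u, v) ->
     continuity_2d_pt x u v /\ continuity_2d_pt y u v /\ continuity_2d_pt l u v) ->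
  has_partials Q x (fun u v => al u v * y u v - be u v * l u v) (fun u v => ga u v * y u v) ->
  has_partials Q y (fun u v => - al u v * x u v)
                   (fun u v => - ga u v * x u v - de u v * l u v) ->
  has_partials Q l (fun u v => - be u v * x u v) (fun u v => - de u v * y u v) ->
  smooth2 Q x /\ smooth2 Q y /\ smooth2 Q l.
Proof.
  intros HQ Sa Sb Sg Sd HC Px Py Pl.
  assert (H : forall n, class_C Q n x /\ class_C Q n y /\ class_C Q n l).
  { induction n as [|n (Cx & Cy & Cl)].
    - split; [|split]; intros u v Huv; split; trivial; now apply HC.
    - assert (Ca := Sa n : class_C Q n al). assert (Cb := Sb n : class_C Q n be).
      assert (Cg := Sg n : class_C Q n ga). assert (Cd := Sd n : class_C Q n de).
      split; [|split].
      + eapply class_C_S_intro; [trivial|apply HC|exact Px| |];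
          repeat first [apply class_C_minus | apply class_C_mult | apply class_C_opp]; trivial.
      + eapply class_C_S_intro; [trivial|apply HC|exact Py| |];
          repeat first [apply class_C_minus | apply class_C_mult | apply class_C_opp]; trivial.
      + eapply class_C_S_intro; [trivial|apply HC|exact Pl| |];
          repeat first [apply class_C_minus | apply class_C_mult | apply class_C_opp]; trivial. }
  split; [|split]; intros n; apply H.
Qed.

(** A compatible frame system has smooth solutions with arbitrary initial values, on a square
    which does not depend on these values. *)
Lemma frame_system_solution (D : R * R -> Prop) u0 v0 al be ga de :
  open D -> D (u0, v0) ->
  smooth2 D al -> smooth2 D be -> smooth2 D ga -> smooth2 D de ->
  (forall u v, D (u, v) ->
     dv al u v + be u v * de u v = du ga u v /\
     dv be u v = - al u v * de u v /\
     du de u v = be u v * ga u v) ->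
  exists r, 0 < r /\ (forall p, square u0 v0 r p -> D p) /\
    forall c : component -> R, exists x y l : R -> R -> R,
      let Q := square u0 v0 r in
      (x u0 v0 = c comp_x /\ y u0 v0 = c comp_y /\ l u0 v0 = c comp_l) /\
      has_partials Q x (fun u v => al u v * y u v - be u v * l u v)
                       (fun u v => ga u v * y u v) /\
      has_partials Q y (fun u v => - al u v * x u v)
                       (fun u v => - ga u v * x u v - de u v * l u v) /\
      has_partials Q l (fun u v => - be u v * x u v) (fun u v => - de u v * y u v) /\
      smooth2 Q x /\ smooth2 Q y /\ smooth2 Q l.
Proof.
  intros HD H0 Sa Sb Sg Sd Hc.
  destruct (common_bound D u0 v0
    (al :: be :: ga :: de :: du ga :: du de :: du (du ga) :: du (du de) :: nil) HD H0)
    as (r1 & K & Hr1 & HK & Hs & HB).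
  { simpl. intros h. intuition subst; auto using smooth2_du. }
  (* a radius for which the Picard iteration contracts, as [2 K r < 1] *)
  set (r := Rmin (r1 / 2) (/ (4 * K))).
  assert (Hr : 0 < r).
  { apply Rmin_case; [lra|]. apply Rinv_0_lt_compat; lra. }
  assert (Hrr : r <= r1 / 2) by apply Rmin_l.
  assert (HKr : 2 * K * r < 1).
  { assert (r <= / (4 * K)) by apply Rmin_r.
    apply Rle_lt_trans with (2 * K * / (4 * K)).
    - apply Rmult_le_compat_l; lra.
    - replace (2 * K * / (4 * K)) with (/ 2) by (field; lra). lra. }
  assert (Hsub : forall p, square u0 v0 r p -> D p).
  { intros p Hp. apply Hs. apply square_le with (2 := Hp). lra. }
  assert (Hclosed : forall u v, Rabs (u - u0) <= r -> Rabs (v - v0) <= r ->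
            square u0 v0 r1 (u, v)).
  { intros u v Hu Hv. split; simpl; lra. }
  assert (Cu : forall h, smooth2 D h -> forall u v, D (u, v) -> continuous (fun s => h s v) u).
  { intros h Hh u v Huv. apply @ex_derive_continuous.
    exists (du h u v). now apply smooth2_partials with D. }
  assert (Cv : forall h, smooth2 D h -> forall u v, D (u, v) -> continuous (fun s => h u s) v).
  { intros h Hh u v Huv. apply @ex_derive_continuous.
    exists (dv h u v). now apply smooth2_partials with D. }
  assert (Z0 : forall z, Rabs (z - z) <= r) by (intros z; rewrite Rminus_diag, Rabs_R0; lra).
  assert (Z1 : forall z, Rabs (z - z) < r) by (intros z; rewrite Rminus_diag, Rabs_R0; lra).
  exists r. split; [trivial|]. split; [trivial|]. intros c.
  destruct (frame_ode (fun u => al u v0) (fun u => be u v0) (fun _ => 0) u0 r K c Hr HKr)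
    as (w0 & W0 & D0).
  { intros t Ht. assert (Hq := Hclosed t v0 Ht (Z0 v0)). assert (Hd := Hs _ Hq).
    repeat split.
    - now apply (Cu al).
    - now apply (Cu be).
    - apply continuous_const.
    - apply HB; simpl; tauto.
    - apply HB; simpl; tauto.
    - rewrite Rabs_R0. lra. }
  (* a solution along every vertical line, starting from the values on the horizontal one *)
  destruct (functional_choice (fun (u : R) (w : R -> component -> R) =>
     Rabs (u - u0) < r ->
     (forall i, w v0 i = w0 u i) /\
     (forall t i, Rabs (t - v0) < r ->
       is_derive (fun s => w s i) t (frame_field (ga u t) 0 (de u t) (w t) i))))
    as (w & Hw).
  { intros u. destruct (Rlt_dec (Rabs (u - u0)) r) as [Hu|Hu].
    2:{ exists (fun _ _ => 0). contradiction. }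
    destruct (frame_ode (fun v => ga u v) (fun _ => 0) (fun v => de u v) v0 r K (w0 u) Hr HKr)
      as (w & W & Dw).
    - intros t Ht. assert (Hq := Hclosed u t (Rlt_le _ _ Hu) Ht). assert (Hd := Hs _ Hq).
      repeat split.
      + now apply (Cv ga).
      + apply continuous_const.
      + now apply (Cv de).
      + apply HB; simpl; tauto.
      + rewrite Rabs_R0. lra.
      + apply HB; simpl; tauto.
    - exists w. intros _. now split. }
  clear Cu Cv.
  set (x := fun u v => w u v comp_x). set (y := fun u v => w u v comp_y).
  set (l := fun u v => w u v comp_l).
  assert (Sv : forall u v, square u0 v0 r (u, v) ->
    is_derive (fun s => x u s) v (ga u v * y u v) /\
    is_derive (fun s => y u s) v (- ga u v * x u v - de u v * l u v) /\
    is_derive (fun s => l u s) v (- de u v * y u v)).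
  { intros u v [Hu Hv]; simpl in Hu, Hv. destruct (Hw u Hu) as [_ Dw].
    assert (Dx := Dw v comp_x Hv). assert (Dy := Dw v comp_y Hv).
    assert (Dl := Dw v comp_l Hv). simpl in Dx, Dy, Dl.
    unfold x, y, l. split; [|split].
    - replace (ga u v * w u v comp_y) with (ga u v * w u v comp_y - 0 * w u v comp_l) by ring.
      exact Dx.
    - exact Dy.
    - replace (- de u v * w u v comp_y) with (- 0 * w u v comp_x - de u v * w u v comp_y) by ring.
      exact Dl. }
  assert (Su0 : forall u, Rabs (u - u0) < r ->
    is_derive (fun s => x s v0) u (al u v0 * y u v0 - be u v0 * l u v0) /\
    is_derive (fun s => y s v0) u (- al u v0 * x u v0) /\
    is_derive (fun s => l s v0) u (- be u v0 * x u v0)).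
  { intros u Hu.
    assert (Hloc : forall i, locally u (fun s => w0 s i = w s v0 i)).
    { intros i. apply (locally_Rabs _ u (r - Rabs (u - u0))); [lra|].
      intros s Hsu. symmetry. apply (Hw s).
      replace (s - u0) with ((s - u) + (u - u0)) by ring.
      apply Rle_lt_trans with (1 := Rabs_triang _ _). lra. }
    assert (Dx := D0 u comp_x Hu). assert (Dy := D0 u comp_y Hu).
    assert (Dl := D0 u comp_l Hu). simpl in Dx, Dy, Dl.
    rewrite <- !(proj1 (Hw u Hu)) in Dx, Dy, Dl.
    unfold x, y, l. split; [|split].
    - apply is_derive_ext_loc with (1 := Hloc comp_x). exact Dx.
    - apply is_derive_ext_loc with (1 := Hloc comp_y).
      replace (- al u v0 * w u v0 comp_x) with (- al u v0 * w u v0 comp_x - 0 * w u v0 comp_l)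
        by ring. exact Dy.
    - apply is_derive_ext_loc with (1 := Hloc comp_l).
      replace (- be u v0 * w u v0 comp_x) with (- be u v0 * w u v0 comp_x - 0 * w u v0 comp_y)
        by ring. exact Dl. }
  (* two applications of the energy estimate bound the solution on the square *)
  set (E := exp ((4 * K + 1) * r)).
  set (M := (x u0 v0 ^ 2 + y u0 v0 ^ 2 + l u0 v0 ^ 2) * E * E + 1).
  assert (HE : 0 < E) by apply exp_pos.
  assert (HM : forall u v, square u0 v0 r (u, v) ->
            x u v ^ 2 + y u v ^ 2 + l u v ^ 2 <= M - 1).
  { intros u v [Hu Hv]; simpl in Hu, Hv.
    assert (E1 := frame_energy (fun t => al t v0) (fun t => be t v0) (fun _ => 0)
      (fun _ => 0) (fun _ => 0) (fun _ => 0) (fun t => x t v0) (fun t => y t v0)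
      (fun t => l t v0) u0 r K 0 u).
    assert (E2 := frame_energy (fun t => ga u t) (fun _ => 0) (fun t => de u t)
      (fun _ => 0) (fun _ => 0) (fun _ => 0) (fun t => x u t) (fun t => y u t)
      (fun t => l u t) v0 r K 0 v).
    cbv beta in E1, E2. fold E in E1, E2.
    assert (F1 : x u v0 ^ 2 + y u v0 ^ 2 + l u v0 ^ 2 <=
                 (x u0 v0 ^ 2 + y u0 v0 ^ 2 + l u0 v0 ^ 2 + 3 * 0 ^ 2) * E).
    { apply E1; trivial.
      - intros t Ht. rewrite Rabs_R0. repeat split; try lra.
        apply HB; [simpl; tauto|]. apply Hclosed; [lra|apply Z0].
      - intros t Ht. destruct (Su0 t Ht) as (A1 & A2 & A3). rewrite !Rplus_0_r.
        split; [exact A1|split].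
        + replace (- al t v0 * x t v0 - 0 * l t v0) with (- al t v0 * x t v0) by ring. exact A2.
        + replace (- be t v0 * x t v0 - 0 * y t v0) with (- be t v0 * x t v0) by ring. exact A3. }
    assert (F2 : x u v ^ 2 + y u v ^ 2 + l u v ^ 2 <=
                 (x u v0 ^ 2 + y u v0 ^ 2 + l u v0 ^ 2 + 3 * 0 ^ 2) * E).
    { apply E2; trivial.
      - intros t Ht. rewrite Rabs_R0. repeat split; try lra.
        apply HB; [simpl; tauto|]. apply Hclosed; lra.
      - intros t Ht. destruct (Sv u t (conj Hu Ht)) as (A1 & A2 & A3). rewrite !Rplus_0_r.
        split; [|split].
        + replace (ga u t * y u t - 0 * l u t) with (ga u t * y u t) by ring. exact A1.
        + exact A2.
        + replace (- 0 * x u t - de u t * y u t) with (- de u t * y u t) by ring. exact A3. }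
    apply Rle_trans with (1 := F2). unfold M.
    apply Rle_trans with
      ((x u0 v0 ^ 2 + y u0 v0 ^ 2 + l u0 v0 ^ 2 + 3 * 0 ^ 2) * E * E); [|right; ring].
    apply Rmult_le_compat_r; lra. }
  assert (HB' : forall u v, square u0 v0 r (u, v) ->
            Rabs (x u v) <= M /\ Rabs (y u v) <= M /\ Rabs (l u v) <= M).
  { intros u v Huv. specialize (HM u v Huv).
    assert (A : forall p, Rabs p <= p ^ 2 + 1).
    { intros p. rewrite <- (pow2_abs p). assert (0 <= (Rabs p - 1) ^ 2) by apply pow2_ge_0.
      assert (P := Rabs_pos p). nra. }
    assert (A1 := A (x u v)). assert (A2 := A (y u v)). assert (A3 := A (l u v)).
    assert (P1 := pow2_ge_0 (x u v)). assert (P2 := pow2_ge_0 (y u v)).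
    assert (P3 := pow2_ge_0 (l u v)). lra. }
  assert (M0 : 0 <= M).
  { destruct (HB' u0 v0) as (A & _); [now apply square_center|].
    apply Rle_trans with (2 := A), Rabs_pos. }
  assert (Hq1 : forall u v, square u0 v0 r (u, v) -> square u0 v0 r1 (u, v)).
  { intros u v Huv. apply square_le with (2 := Huv). lra. }
  assert (Taylor : forall h, smooth2 D h ->
            (forall u v, square u0 v0 r1 (u, v) ->
               Rabs (du h u v) <= K /\ Rabs (du (du h) u v) <= K) ->
            forall u v d, square u0 v0 r (u, v) -> square u0 v0 r (u + d, v) ->
            Rabs (h (u + d) v - h u v) <= K * Rabs d /\
            Rabs (h (u + d) v - h u v - d * du h u v) <= K * d ^ 2).
  { intros h Hh Hk u v d [Hu Hv] [Hud _]; simpl in Hu, Hv, Hud.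
    apply (first_order_bounds (fun s => h s v) (fun s => du h s v)
             (fun s => du (du h) s v) u0 r K u d); trivial.
    - intros t Ht. apply (smooth2_partials D h Hh t v). apply Hsub. now split.
    - intros t Ht. apply (smooth2_partials D _ (smooth2_du D h Hh) t v). apply Hsub. now split.
    - intros t Ht. apply Hk, Hq1. now split. }
  assert (Su : forall u v, square u0 v0 r (u, v) ->
    is_derive (fun s => x s v) u (al u v * y u v - be u v * l u v) /\
    is_derive (fun s => y s v) u (- al u v * x u v) /\
    is_derive (fun s => l s v) u (- be u v * x u v)).
  { intros u v Huv.
    apply (parameter_derivative u0 v0 r K M al be ga de (dv al) (dv be) (du ga) (du de) x y l);
      trivial; try (intros s t Hst; specialize (Hsub _ Hst); now apply Hc).
    - intros s t Hst. apply (smooth2_partials D al Sa s t), Hsub, Hst.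
    - intros s t Hst. apply (smooth2_partials D be Sb s t), Hsub, Hst.
    - intros s t Hst. apply Hq1 in Hst. repeat split; apply HB; simpl; tauto.
    - intros s t d Hst Hsd.
      destruct (Taylor ga Sg) with s t d as [T1 T2]; trivial.
      { intros; split; apply HB; simpl; tauto. }
      destruct (Taylor de Sd) with s t d as [T3 T4]; trivial.
      { intros; split; apply HB; simpl; tauto. }
      now repeat split. }
  assert (Px : has_partials (square u0 v0 r) x (fun u v => al u v * y u v - be u v * l u v)
                       (fun u v => ga u v * y u v))
    by (intros u v Huv; split; [now apply Su|now apply Sv]).
  assert (Py : has_partials (square u0 v0 r) y (fun u v => - al u v * x u v)
                       (fun u v => - ga u v * x u v - de u v * l u v))
    by (intros u v Huv; split; [now apply Su|now apply Sv]).
  assert (Pl : has_partials (square u0 v0 r) l (fun u v => - be u v * x u v)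
                       (fun u v => - de u v * y u v))
    by (intros u v Huv; split; [now apply Su|now apply Sv]).
  exists x, y, l. intros Q. subst Q.
  split; [|split; [trivial|split; [trivial|split; [trivial|]]]].
  { unfold x, y, l. rewrite !(proj1 (Hw u0 (Z1 u0))). auto. }
  assert (Lip : forall h hu hv, has_partials (square u0 v0 r) h hu hv ->
            (forall u v, square u0 v0 r (u, v) ->
               Rabs (hu u v) <= 2 * (K * M) /\ Rabs (hv u v) <= 2 * (K * M)) ->
            forall u v, square u0 v0 r (u, v) -> continuity_2d_pt h u v).
  { intros h hu hv Hp Hb u v Huv. apply bounded_partials_continuity
      with (square u0 v0 r) hu hv (2 * (K * M)); trivial. apply square_open. }
  assert (KM : 0 <= K * M) by (apply Rmult_le_pos; lra).
  assert (Hcf : forall u v, square u0 v0 r (u, v) ->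
            Rabs (al u v) <= K /\ Rabs (be u v) <= K /\ Rabs (ga u v) <= K /\ Rabs (de u v) <= K).
  { intros s t Hst. apply Hq1 in Hst. repeat split; apply HB; simpl; tauto. }
  assert (two : 2 * (K * M) = K * M + K * M) by ring.
  assert (one : forall p, p <= K * M -> p <= 2 * (K * M)) by (intros; lra).
  apply (frame_system_smooth (square u0 v0 r) al be ga de); trivial;
    try (apply smooth2_subset with D; trivial).
  { apply square_open. }
  intros u v Huv. split; [|split].
  - apply (Lip _ _ _ Px); trivial. intros s t Hst.
    destruct (HB' s t Hst) as (A1 & A2 & A3). destruct (Hcf s t Hst) as (B1 & B2 & B3 & B4).
    split.
    + rewrite two. apply Rabs_minus_le; now apply Rabs_mult_le.
    + apply one. now apply Rabs_mult_le.
  - apply (Lip _ _ _ Py); trivial. intros s t Hst.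
    destruct (HB' s t Hst) as (A1 & A2 & A3). destruct (Hcf s t Hst) as (B1 & B2 & B3 & B4).
    split.
    + apply one. apply Rabs_mult_le; trivial. now apply Rabs_opp_le.
    + rewrite two. apply Rabs_minus_le; apply Rabs_mult_le; trivial. now apply Rabs_opp_le.
  - apply (Lip _ _ _ Pl); trivial. intros s t Hst.
    destruct (HB' s t Hst) as (A1 & A2 & A3). destruct (Hcf s t Hst) as (B1 & B2 & B3 & B4).
    split; apply one; apply Rabs_mult_le; trivial; now apply Rabs_opp_le.
Qed.

(** Poincare's lemma on a square, with the potential obtained by integrating along a horizontal
    and then a vertical segment. *)
Lemma square_potential u0 v0 r (P Q : R -> R -> R) :
  0 < r -> smooth2 (square u0 v0 r) P -> smooth2 (square u0 v0 r) Q ->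
  (forall u v, square u0 v0 r (u, v) -> dv P u v = du Q u v) ->
  exists z, has_partials (square u0 v0 r) z P Q /\ smooth2 (square u0 v0 r) z.
Proof.
  intros Hr SP SQ Hc.
  set (z := fun u v => RInt (fun s => P s v0) u0 u + RInt (fun t => Q u t) v0 v).
  assert (Hbtw : forall c t s, Rabs (t - c) < r -> Rmin c t <= s <= Rmax c t ->
                 Rabs (s - c) < r).
  { intros c t s Ht Hs. apply Rabs_lt_between in Ht. apply Rabs_lt_between.
    unfold Rmin, Rmax in Hs. destruct (Rle_dec c t); lra. }
  assert (Hloc : forall c t, Rabs (t - c) < r -> locally t (fun s => Rabs (s - c) < r)).
  { intros c t Ht. apply (locally_Rabs _ t (r - Rabs (t - c))); [lra|].
    intros s Hs. replace (s - c) with ((s - t) + (t - c)) by ring.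
    apply Rle_lt_trans with (1 := Rabs_triang _ _). lra. }
  assert (Z1 : Rabs (v0 - v0) < r) by (rewrite Rminus_diag, Rabs_R0; lra).
  assert (CP : forall u, Rabs (u - u0) < r -> continuous (fun s => P s v0) u).
  { intros u Hu. apply @ex_derive_continuous. exists (du P u v0).
    apply (smooth2_partials _ _ SP u v0). now split. }
  assert (CQ : forall u v, Rabs (u - u0) < r -> Rabs (v - v0) < r ->
            continuous (fun s => Q u s) v).
  { intros u v Hu Hv. apply @ex_derive_continuous. exists (dv Q u v).
    apply (smooth2_partials _ _ SQ u v). now split. }
  assert (IP : forall u, Rabs (u - u0) < r -> ex_RInt (fun s => P s v0) u0 u).
  { intros u Hu. apply @ex_RInt_continuous. intros s Hs. apply CP. now apply Hbtw with u. }
  assert (IQ : forall u v, Rabs (u - u0) < r -> Rabs (v - v0) < r ->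
            ex_RInt (fun t => Q u t) v0 v).
  { intros u v Hu Hv. apply @ex_RInt_continuous. intros s Hs. apply CQ; trivial.
    now apply Hbtw with v. }
  assert (Hz : has_partials (square u0 v0 r) z P Q).
  { intros u v [Hu Hv]; simpl in Hu, Hv. split.
    - replace (P u v) with (P u v0 + RInt (fun t => Derive (fun s => Q s t) u) v0 v).
      2:{ assert (E : RInt (fun t => Derive (fun s => Q s t) u) v0 v = P u v - P u v0);
            [|rewrite E; ring].
          apply is_RInt_unique.
          apply is_RInt_ext with (fun t => dv P u t).
          { intros t Ht. apply (Hc u t). split; [trivial|]. simpl. apply Hbtw with v; [trivial|]. lra. }
          apply (is_RInt_derive (fun t => P u t) (fun t => dv P u t)).
          - intros t Ht. apply (smooth2_partials _ _ SP u t).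
            split; [trivial|]. now apply Hbtw with v.
          - intros t Ht. apply @ex_derive_continuous. exists (dv (dv P) u t).
            apply (smooth2_partials _ _ (smooth2_dv _ _ SP) u t).
            split; [trivial|]. now apply Hbtw with v. }
      apply (@is_derive_plus R_AbsRing R_NormedModule
               (fun u => RInt (fun s => P s v0) u0 u) (fun u => RInt (fun t => Q u t) v0 v)).
      + apply (is_derive_RInt (fun s => P s v0) (fun u => RInt (fun s => P s v0) u0 u) u0 u).
        * generalize (Hloc u0 u Hu). apply filter_imp. intros s Hs.
          apply @RInt_correct. now apply IP.
        * now apply CP.
      + apply (is_derive_RInt_param Q v0 v u).
        * generalize (Hloc u0 u Hu). apply filter_imp. intros s Hs t Ht.
          exists (du Q s t). apply (smooth2_partials _ _ SQ s t).
          split; [trivial|]. now apply Hbtw with v.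
        * intros t Ht. apply (smooth2_continuity (square u0 v0 r) (du Q)).
          -- now apply smooth2_du.
          -- split; [trivial|]. now apply Hbtw with v.
        * generalize (Hloc u0 u Hu). apply filter_imp. intros s Hs. now apply IQ.
    - replace (Q u v) with (0 + Q u v) by ring.
      apply (@is_derive_plus R_AbsRing R_NormedModule
               (fun _ => RInt (fun s => P s v0) u0 u) (fun v => RInt (fun t => Q u t) v0 v)).
      + apply (@is_derive_const R_AbsRing R_NormedModule).
      + apply (is_derive_RInt (fun t => Q u t) (fun v => RInt (fun t => Q u t) v0 v) v0 v).
        * generalize (Hloc v0 v Hv). apply filter_imp. intros t Ht.
          apply @RInt_correct. now apply IQ.
        * now apply CQ. }
  exists z. split; trivial.
  apply (smooth2_intro _ z P Q); trivial; [apply square_open|].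
  intros u v Huv.
  apply (has_partials_continuity (square u0 v0 r) z P Q); trivial;
    [apply square_open| |]; now apply smooth2_continuity with (square u0 v0 r).
Qed.

(** * Vectors of Minkowski space *)

(* lets [simpl] compute the coordinates of explicit triples *)
Arguments x1 !a /.
Arguments x2 !a /.
Arguments x3 !a /.

(** The multiple of a vector by a scalar, by coordinates. *)
Definition vscale (c : R) (a : vec) : vec := (c * x1 a, c * x2 a, c * x3 a).

(** A linear combination of three vectors, by coordinates. *)
Definition vcomb (a : R) (X : vec) (b : R) (Y : vec) (c : R) (Z : vec) : vec :=
  (a * x1 X + b * x1 Y + c * x1 Z,
   a * x2 X + b * x2 Y + c * x2 Z,
   a * x3 X + b * x3 Y + c * x3 Z).

Arguments vscale c a /.
Arguments vcomb a X b Y c Z /.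

Lemma vec_ext (a b : vec) : x1 a = x1 b -> x2 a = x2 b -> x3 a = x3 b -> a = b.
Proof. destruct a as [[a1 a2] a3], b as [[b1 b2] b3]. simpl. congruence. Qed.

Ltac vring := unfold mink, det3, vscale, vcomb, x1, x2, x3; simpl; ring.

Lemma scal_vscale (c : R) (a : vec) : @scal R_AbsRing _ c a = vscale c a.
Proof. now destruct a as [[a1 a2] a3]. Qed.

Lemma mink_sym a b : mink a b = mink b a.
Proof. vring. Qed.

Lemma mink_vscale_l c a b : mink (vscale c a) b = c * mink a b.
Proof. vring. Qed.

Lemma mink_vscale_r c a b : mink a (vscale c b) = c * mink a b.
Proof. vring. Qed.

Lemma mink_vcomb_l a X b Y c Z w :
  mink (vcomb a X b Y c Z) w = a * mink X w + b * mink Y w + c * mink Z w.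
Proof. vring. Qed.

Lemma mink_vcomb_r a X b Y c Z w :
  mink w (vcomb a X b Y c Z) = a * mink w X + b * mink w Y + c * mink w Z.
Proof. vring. Qed.

(** Orthonormality for the Minkowski product, the third vector being time-like. *)
Definition orthonormal (X Y l : vec) : Prop :=
  mink X X = 1 /\ mink Y Y = 1 /\ mink l l = -1 /\
  mink X Y = 0 /\ mink l X = 0 /\ mink l Y = 0.

(** The square of the determinant is minus the Gram determinant. *)
Lemma orthonormal_det X Y l : orthonormal X Y l -> det3 X Y l ^ 2 = 1.
Proof.
  intros (XX & YY & ll & XY & lX & lY).
  assert (E : det3 X Y l ^ 2 =
    - (mink X X * (mink Y Y * mink l l - mink l Y * mink l Y)
       - mink X Y * (mink X Y * mink l l - mink l Y * mink l X)
       + mink l X * (mink X Y * mink l Y - mink Y Y * mink l X))) by vring.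
  rewrite E, XX, YY, ll, XY, lX, lY. ring.
Qed.

(** Expansion in an orthonormal frame; the difference of the two sides is orthogonal to the
    frame, and vanishes by Cramer's rule. *)
Lemma orthonormal_expansion X Y l w :
  orthonormal X Y l -> w = vcomb (mink w X) X (mink w Y) Y (- mink w l) l.
Proof.
  intros H. assert (D := orthonormal_det X Y l H).
  destruct H as (XX & YY & ll & XY & lX & lY).
  set (e := vcomb 1 w (-1) (vcomb (mink w X) X (mink w Y) Y (- mink w l) l) 0 X).
  assert (eX : mink e X = 0).
  { unfold e. rewrite !mink_vcomb_l, (mink_sym Y X), XX, XY, lX. ring. }
  assert (eY : mink e Y = 0).
  { unfold e. rewrite !mink_vcomb_l, YY, XY, lY. ring. }
  assert (el : mink e l = 0).
  { unfold e. rewrite !mink_vcomb_l, (mink_sym X l), (mink_sym Y l), ll, lX, lY. ring. }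
  assert (Z : forall p, det3 X Y l * p = 0 -> p = 0).
  { intros p Hp. apply Rmult_integral in Hp. destruct Hp as [Hp|]; trivial.
    rewrite Hp in D. exfalso. lra. }
  assert (e1 : x1 e = 0).
  { apply Z. transitivity (mink e X * (x2 Y * x3 l - x3 Y * x2 l)
      + mink e Y * (x2 l * x3 X - x3 l * x2 X) + mink e l * (x2 X * x3 Y - x3 X * x2 Y)).
    - vring.
    - rewrite eX, eY, el. ring. }
  assert (e2 : x2 e = 0).
  { apply Z. transitivity (mink e X * (x3 Y * x1 l - x1 Y * x3 l)
      + mink e Y * (x3 l * x1 X - x1 l * x3 X) + mink e l * (x3 X * x1 Y - x1 X * x3 Y)).
    - vring.
    - rewrite eX, eY, el. ring. }
  assert (e3 : x3 e = 0).
  { apply Z. transitivity (- (mink e X * (x1 Y * x2 l - x2 Y * x1 l)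
      + mink e Y * (x1 l * x2 X - x2 l * x1 X) + mink e l * (x1 X * x2 Y - x2 X * x1 Y))).
    - vring.
    - rewrite eX, eY, el. ring. }
  apply vec_ext; [revert e1|revert e2|revert e3]; unfold e; simpl; lra.
Qed.

(** A matrix whose rows are orthonormal has orthonormal columns. *)
Lemma orthonormal_transpose (X Y l : vec) :
  orthonormal (x1 X, x1 Y, x1 l) (x2 X, x2 Y, x2 l) (x3 X, x3 Y, x3 l) ->
  orthonormal X Y l.
Proof.
  intros H.
  assert (E1 := orthonormal_expansion _ _ _ (1, 0, 0) H).
  assert (E2 := orthonormal_expansion _ _ _ (0, 1, 0) H).
  assert (E3 := orthonormal_expansion _ _ _ (0, 0, 1) H).
  unfold vcomb, mink in E1, E2, E3. simpl in E1, E2, E3.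
  injection E1 as A1 A2 A3. injection E2 as B1 B2 B3. injection E3 as C1 C2 C3.
  unfold orthonormal, mink. repeat split; lra.
Qed.

(** The unit vector completing two orthonormal space-like vectors to a positively
    oriented orthonormal frame. *)
Definition normal_of (X Y : vec) : vec :=
  (x3 X * x2 Y - x2 X * x3 Y, x1 X * x3 Y - x3 X * x1 Y, x1 X * x2 Y - x2 X * x1 Y).

Lemma orthonormal_normal X Y l :
  orthonormal X Y l -> 0 < det3 X Y l -> det3 X Y l = 1 /\ l = normal_of X Y.
Proof.
  intros H P. assert (D := orthonormal_det X Y l H).
  assert (D1 : det3 X Y l = 1) by nra. split; trivial.
  assert (E := orthonormal_expansion X Y l (normal_of X Y) H).
  replace (mink (normal_of X Y) X) with 0 in E by (unfold normal_of; vring).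
  replace (mink (normal_of X Y) Y) with 0 in E by (unfold normal_of; vring).
  replace (mink (normal_of X Y) l) with (- det3 X Y l) in E by (unfold normal_of; vring).
  rewrite D1 in E. rewrite E. apply vec_ext; vring.
Qed.

(** The linear map carrying the orthonormal frame [X], [Y], [l] to [X'], [Y'], [l']. *)
Definition frame_map (X Y l X' Y' l' w : vec) : vec :=
  vcomb (mink w X) X' (mink w Y) Y' (- mink w l) l'.

Lemma linear_functional (c1 c2 c3 : R) :
  is_linear (fun w : R * R * R => c1 * x1 w + c2 * x2 w + c3 * x3 w).
Proof.
  assert (L1 : is_linear (fun w : R * R * R => x1 w)).
  { apply (is_linear_comp (fun w : R * R * R => fst w) (fun w => fst w)); apply is_linear_fst. }
  assert (L2 : is_linear (fun w : R * R * R => x2 w)).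
  { apply (is_linear_comp (fun w : R * R * R => fst w) (fun w => snd w));
      [apply is_linear_fst|apply is_linear_snd]. }
  assert (L3 : is_linear (fun w : R * R * R => x3 w)) by apply is_linear_snd.
  assert (S : forall (c : R) (h : R * R * R -> R), is_linear h -> is_linear (fun w => c * h w)).
  { intros c h Hh. apply (is_linear_comp h (fun t : R => c * t)); trivial.
    apply (@is_linear_scal_r R_AbsRing R_NormedModule c). intros; apply Rmult_comm. }
  assert (A : forall h k : R * R * R -> R, is_linear h -> is_linear k ->
            is_linear (fun w => h w + k w)).
  { intros h k Hh Hk.
    apply (is_linear_comp (fun w => (h w, k w)) (fun t : R * R => fst t + snd t)).
    - now apply is_linear_prod.
    - apply (@is_linear_plus R_AbsRing R_NormedModule). }
  now apply A; [apply A|]; apply S.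
Qed.

Lemma frame_map_linear X Y l X' Y' l' : is_linear (frame_map X Y l X' Y' l').
Proof.
  assert (H : forall a b c, is_linear (fun w : R * R * R =>
             mink w X * a + mink w Y * b + - mink w l * c)).
  { intros a b c. eapply is_linear_ext; [|apply (linear_functional
      (x1 X * a + x1 Y * b - x1 l * c) (x2 X * a + x2 Y * b - x2 l * c)
      (- x3 X * a - x3 Y * b + x3 l * c))].
    intros w. unfold mink. simpl. ring. }
  unfold frame_map, vcomb.
  apply (is_linear_prod (fun w : R * R * R => (_, _))); [apply is_linear_prod|]; apply H.
Qed.

Lemma frame_map_mink X Y l X' Y' l' v w :
  orthonormal X Y l -> orthonormal X' Y' l' ->
  mink (frame_map X Y l X' Y' l' v) (frame_map X Y l X' Y' l' w) = mink v w.
Proof.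
  intros H (XX & YY & ll & XY & lX & lY).
  rewrite (orthonormal_expansion X Y l v H) at 2.
  unfold frame_map. rewrite !mink_vcomb_l, !mink_vcomb_r.
  rewrite (mink_sym Y' X'), (mink_sym X' l'), (mink_sym Y' l'), XX, YY, ll, XY, lX, lY.
  rewrite (mink_sym X w), (mink_sym Y w), (mink_sym l w). ring.
Qed.

Lemma frame_map_det X Y l X' Y' l' :
  det3 (frame_map X Y l X' Y' l' (1, 0, 0)) (frame_map X Y l X' Y' l' (0, 1, 0))
       (frame_map X Y l X' Y' l' (0, 0, 1)) = det3 X Y l * det3 X' Y' l'.
Proof. unfold frame_map. vring. Qed.

Lemma frame_map_frame X Y l X' Y' l' :
  orthonormal X Y l ->
  frame_map X Y l X' Y' l' X = X' /\ frame_map X Y l X' Y' l' Y = Y'.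
Proof.
  intros (XX & YY & ll & XY & lX & lY). unfold frame_map.
  rewrite (mink_sym Y X), (mink_sym X l), (mink_sym Y l), XX, YY, XY, lX, lY.
  split; apply vec_ext; unfold vcomb; simpl; ring.
Qed.

(** * Moving frames *)

(** On [D], the vector fields [Zu] and [Zv] are the partial derivatives of [Z]. *)
Definition vec_partials (D : R * R -> Prop) (Z Zu Zv : R -> R -> vec) : Prop :=
  has_partials D (fun u v => x1 (Z u v)) (fun u v => x1 (Zu u v)) (fun u v => x1 (Zv u v)) /\
  has_partials D (fun u v => x2 (Z u v)) (fun u v => x2 (Zu u v)) (fun u v => x2 (Zv u v)) /\
  has_partials D (fun u v => x3 (Z u v)) (fun u v => x3 (Zu u v)) (fun u v => x3 (Zv u v)).

(** The scalar frame system, satisfied by the [i]-th components of a moving frame. *)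
Definition frame_system (D : R * R -> Prop) (al be ga de x y l : R -> R -> R) : Prop :=
  has_partials D x (fun u v => al u v * y u v - be u v * l u v) (fun u v => ga u v * y u v) /\
  has_partials D y (fun u v => - al u v * x u v)
                   (fun u v => - ga u v * x u v - de u v * l u v) /\
  has_partials D l (fun u v => - be u v * x u v) (fun u v => - de u v * y u v).

(** The frame system for vector fields: the Gauss-Weingarten equations in principal
    parameters. *)
Definition moving_frame (D : R * R -> Prop) (al be ga de : R -> R -> R)
    (X Y l : R -> R -> vec) : Prop :=
  vec_partials D X (fun u v => vcomb 0 (X u v) (al u v) (Y u v) (- be u v) (l u v))
                   (fun u v => vcomb 0 (X u v) (ga u v) (Y u v) 0 (l u v)) /\
  vec_partials D Y (fun u v => vcomb (- al u v) (X u v) 0 (Y u v) 0 (l u v))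
                   (fun u v => vcomb (- ga u v) (X u v) 0 (Y u v) (- de u v) (l u v)) /\
  vec_partials D l (fun u v => vcomb (- be u v) (X u v) 0 (Y u v) 0 (l u v))
                   (fun u v => vcomb 0 (X u v) (- de u v) (Y u v) 0 (l u v)).

Ltac ext_by H := eapply has_partials_ext; [eassumption| | | |exact H]; intros; simpl; ring.

Lemma moving_frame_components D al be ga de X Y l :
  open D ->
  moving_frame D al be ga de X Y l <->
  frame_system D al be ga de (fun u v => x1 (X u v)) (fun u v => x1 (Y u v))
                             (fun u v => x1 (l u v)) /\
  frame_system D al be ga de (fun u v => x2 (X u v)) (fun u v => x2 (Y u v))
                             (fun u v => x2 (l u v)) /\
  frame_system D al be ga de (fun u v => x3 (X u v)) (fun u v => x3 (Y u v))
                             (fun u v => x3 (l u v)).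
Proof.
  intros HD. unfold moving_frame, frame_system, vec_partials, vcomb. simpl.
  split.
  - intros ((A1 & A2 & A3) & (B1 & B2 & B3) & (C1 & C2 & C3)).
    repeat apply conj;
      [ext_by A1 | ext_by B1 | ext_by C1 | ext_by A2 | ext_by B2 | ext_by C2
      | ext_by A3 | ext_by B3 | ext_by C3].
  - intros ((A1 & A2 & A3) & (B1 & B2 & B3) & (C1 & C2 & C3)).
    repeat apply conj;
      [ext_by A1 | ext_by B1 | ext_by C1 | ext_by A2 | ext_by B2 | ext_by C2
      | ext_by A3 | ext_by B3 | ext_by C3].
Qed.

(** Two solutions of the frame system pair to a constant, since the coefficient matrices
    lie in the Lie algebra of the Lorentz group. *)
Lemma frame_system_pairing D al be ga de x y l x' y' l' :
  open D -> frame_system D al be ga de x y l -> frame_system D al be ga de x' y' l' ->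
  has_partials D (fun u v => x u v * x' u v + y u v * y' u v - l u v * l' u v)
    (fun _ _ => 0) (fun _ _ => 0).
Proof.
  intros HD (Px & Py & Pl) (Px' & Py' & Pl').
  eapply has_partials_ext; trivial.
  4:{ exact (has_partials_minus _ _ _ _ _ _ _
        (has_partials_plus _ _ _ _ _ _ _
          (has_partials_mult _ _ _ _ _ _ _ Px Px') (has_partials_mult _ _ _ _ _ _ _ Py Py'))
        (has_partials_mult _ _ _ _ _ _ _ Pl Pl')). }
  - reflexivity.
  - intros u v _. cbv beta. ring.
  - intros u v _. cbv beta. ring.
Qed.

(** The map carrying one solution of the frame system to another does not depend on the
    point. *)
Lemma frame_map_constant D al be ga de X Y l X' Y' l' w u v s t :
  open D -> connected D ->
  moving_frame D al be ga de X Y l -> moving_frame D al be ga de X' Y' l' ->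
  D (u, v) -> D (s, t) ->
  frame_map (X u v) (Y u v) (l u v) (X' u v) (Y' u v) (l' u v) w =
  frame_map (X s t) (Y s t) (l s t) (X' s t) (Y' s t) (l' s t) w.
Proof.
  intros HD HC M M' Hp Hq.
  apply moving_frame_components in M, M'; trivial.
  destruct M as (M1 & M2 & M3). destruct M' as (M1' & M2' & M3').
  assert (K : forall x y l x' y' l', frame_system D al be ga de x y l ->
            frame_system D al be ga de x' y' l' ->
            x u v * x' u v + y u v * y' u v - l u v * l' u v =
            x s t * x' s t + y s t * y' s t - l s t * l' s t).
  { intros x y l0 x' y' l0' F F'.
    apply (connected_constant D (fun u v => x u v * x' u v + y u v * y' u v
             - l0 u v * l0' u v) (u, v) (s, t)); trivial.
    now apply (frame_system_pairing D al be ga de). }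
  assert (E11 := K _ _ _ _ _ _ M1 M1'). assert (E21 := K _ _ _ _ _ _ M2 M1').
  assert (E31 := K _ _ _ _ _ _ M3 M1'). assert (E12 := K _ _ _ _ _ _ M1 M2').
  assert (E22 := K _ _ _ _ _ _ M2 M2'). assert (E32 := K _ _ _ _ _ _ M3 M2').
  assert (E13 := K _ _ _ _ _ _ M1 M3'). assert (E23 := K _ _ _ _ _ _ M2 M3').
  assert (E33 := K _ _ _ _ _ _ M3 M3'). cbv beta in *.
  assert (S : forall X Y l X' Y' l', frame_map X Y l X' Y' l' w =
    let C := fun (a b : vec -> R) => a X * b X' + a Y * b Y' - a l * b l' in
    (x1 w * C x1 x1 + x2 w * C x2 x1 - x3 w * C x3 x1,
     x1 w * C x1 x2 + x2 w * C x2 x2 - x3 w * C x3 x2,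
     x1 w * C x1 x3 + x2 w * C x2 x3 - x3 w * C x3 x3)).
  { intros. unfold frame_map, vcomb, mink. apply vec_ext; simpl; ring. }
  rewrite !S. cbv zeta beta.
  rewrite E11, E21, E31, E12, E22, E32, E13, E23, E33. reflexivity.
Qed.

(** Surfaces with the same metric coefficients, whose moving frames satisfy the same system,
    differ by a motion. *)
Lemma frame_congruence D al be ga de p q X Y l X' Y' l' (z z' : surface) u0 v0 :
  open D -> connected D -> D (u0, v0) ->
  moving_frame D al be ga de X Y l -> moving_frame D al be ga de X' Y' l' ->
  (forall u v, D (u, v) -> orthonormal (X u v) (Y u v) (l u v)) ->
  (forall u v, D (u, v) -> orthonormal (X' u v) (Y' u v) (l' u v)) ->
  det3 (X u0 v0) (Y u0 v0) (l u0 v0) = 1 ->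
  det3 (X' u0 v0) (Y' u0 v0) (l' u0 v0) = 1 ->
  vec_partials D z (fun u v => vscale (p u v) (X u v)) (fun u v => vscale (q u v) (Y u v)) ->
  vec_partials D z' (fun u v => vscale (p u v) (X' u v)) (fun u v => vscale (q u v) (Y' u v)) ->
  exists T, motion T /\ forall u v, D (u, v) -> z' u v = T (z u v).
Proof.
  intros HD HC H0 M M' O O' d d' Pz Pz'.
  set (A := frame_map (X u0 v0) (Y u0 v0) (l u0 v0) (X' u0 v0) (Y' u0 v0) (l' u0 v0)).
  assert (AX : forall u v, D (u, v) -> A (X u v) = X' u v /\ A (Y u v) = Y' u v).
  { intros u v Huv. destruct (frame_map_frame _ _ _ (X' u v) (Y' u v) (l' u v) (O u v Huv))
      as [FX FY].
    split; [refine (eq_trans _ FX)|refine (eq_trans _ FY)];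
      apply (frame_map_constant D al be ga de X Y l X' Y' l' _ u0 v0 u v);
      trivial. }
  set (b := vcomb 1 (z' u0 v0) (-1) (A (z u0 v0)) 0 (z u0 v0)).
  exists (fun w => plus (A w) b). split.
  - exists A, b. split; [apply frame_map_linear|]. split; [|split].
    + intros x y. apply frame_map_mink; auto.
    + unfold A. rewrite frame_map_det, d, d'. ring.
    + reflexivity.
  - intros u v Huv.
    assert (Lin : forall c1 c2 c3 : R, has_partials D
      (fun u v => c1 * x1 (z u v) + c2 * x2 (z u v) + c3 * x3 (z u v))
      (fun u v => p u v * (c1 * x1 (X u v) + c2 * x2 (X u v) + c3 * x3 (X u v)))
      (fun u v => q u v * (c1 * x1 (Y u v) + c2 * x2 (Y u v) + c3 * x3 (Y u v)))).
    { intros c1 c2 c3. destruct Pz as (P1 & P2 & P3).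
      eapply (has_partials_ext D (fun u v => c1 * x1 (z u v) + c2 * x2 (z u v) + c3 * x3 (z u v))
        _ _ _ (fun u v => p u v * (c1 * x1 (X u v) + c2 * x2 (X u v) + c3 * x3 (X u v)))
              (fun u v => q u v * (c1 * x1 (Y u v) + c2 * x2 (Y u v) + c3 * x3 (Y u v))) HD
        (fun _ _ _ => eq_refl)).
      3:{ exact (has_partials_plus _ _ _ _ _ _ _
            (has_partials_plus _ _ _ _ _ _ _
              (has_partials_mult _ _ _ _ _ _ _ (has_partials_const D c1) P1)
              (has_partials_mult _ _ _ _ _ _ _ (has_partials_const D c2) P2))
            (has_partials_mult _ _ _ _ _ _ _ (has_partials_const D c3) P3)). }
      - intros; unfold vscale; simpl; ring.
      - intros; unfold vscale; simpl; ring. }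
    assert (K : forall (pi : vec -> R) (c1 c2 c3 : R),
      (forall w, pi (A w) = c1 * x1 w + c2 * x2 w + c3 * x3 w) ->
      has_partials D (fun u v => pi (z' u v)) (fun u v => p u v * pi (X' u v))
                     (fun u v => q u v * pi (Y' u v)) ->
      pi (z' u v) - pi (A (z u v)) = pi (z' u0 v0) - pi (A (z u0 v0))).
    { intros pi c1 c2 c3 Hpi Hz'.
      apply (connected_constant D (fun u v => pi (z' u v) - pi (A (z u v))) (u, v) (u0, v0));
        trivial.
      refine (has_partials_ext D _ _ _ _ _ _ HD _ _ _
        (has_partials_minus _ _ _ _ _ _ _ Hz' (Lin c1 c2 c3))).
      - intros s t _. cbv beta. now rewrite Hpi.
      - intros s t Hst. cbv beta. rewrite <- Hpi. destruct (AX s t Hst) as [-> _]. ring.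
      - intros s t Hst. cbv beta. rewrite <- Hpi. destruct (AX s t Hst) as [_ ->]. ring. }
    destruct Pz' as (P1 & P2 & P3).
    assert (K1 := fun c1 c2 c3 H => K x1 c1 c2 c3 H P1).
    assert (K2 := fun c1 c2 c3 H => K x2 c1 c2 c3 H P2).
    assert (K3 := fun c1 c2 c3 H => K x3 c1 c2 c3 H P3).
    assert (Hc : forall a b c, exists c1 c2 c3, forall w,
       mink w (X u0 v0) * a + mink w (Y u0 v0) * b + - mink w (l u0 v0) * c
       = c1 * x1 w + c2 * x2 w + c3 * x3 w).
    { intros e f g.
      exists (x1 (X u0 v0) * e + x1 (Y u0 v0) * f - x1 (l u0 v0) * g),
        (x2 (X u0 v0) * e + x2 (Y u0 v0) * f - x2 (l u0 v0) * g),
        (- x3 (X u0 v0) * e - x3 (Y u0 v0) * f + x3 (l u0 v0) * g).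
      intros w. unfold mink. ring. }
    apply vec_ext.
    + destruct (Hc (x1 (X' u0 v0)) (x1 (Y' u0 v0)) (x1 (l' u0 v0))) as (c1 & c2 & c3 & H).
      specialize (K1 c1 c2 c3 H).
      change (x1 (z' u v) = x1 (A (z u v)) +
        (1 * x1 (z' u0 v0) + -1 * x1 (A (z u0 v0)) + 0 * x1 (z u0 v0))). lra.
    + destruct (Hc (x2 (X' u0 v0)) (x2 (Y' u0 v0)) (x2 (l' u0 v0))) as (c1 & c2 & c3 & H).
      specialize (K2 c1 c2 c3 H).
      change (x2 (z' u v) = x2 (A (z u v)) +
        (1 * x2 (z' u0 v0) + -1 * x2 (A (z u0 v0)) + 0 * x2 (z u0 v0))). lra.
    + destruct (Hc (x3 (X' u0 v0)) (x3 (Y' u0 v0)) (x3 (l' u0 v0))) as (c1 & c2 & c3 & H).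
      specialize (K3 c1 c2 c3 H).
      change (x3 (z' u v) = x3 (A (z u v)) +
        (1 * x3 (z' u0 v0) + -1 * x3 (A (z u0 v0)) + 0 * x3 (z u0 v0))). lra.
Qed.

(** * Structure equations of a surface *)

Lemma vec_partials_ext D Z W Zu Zv Wu Wv :
  open D ->
  (forall u v, D (u, v) -> Z u v = W u v) ->
  (forall u v, D (u, v) -> Zu u v = Wu u v) ->
  (forall u v, D (u, v) -> Zv u v = Wv u v) ->
  vec_partials D Z Zu Zv -> vec_partials D W Wu Wv.
Proof.
  intros HD E Eu Ev (H1 & H2 & H3).
  split; [|split].
  - refine (has_partials_ext D _ _ _ _ _ _ HD _ _ _ H1); intros; f_equal; auto.
  - refine (has_partials_ext D _ _ _ _ _ _ HD _ _ _ H2); intros; f_equal; auto.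
  - refine (has_partials_ext D _ _ _ _ _ _ HD _ _ _ H3); intros; f_equal; auto.
Qed.

Lemma vec_partials_unique D Z Zu Zv Zu' Zv' u v :
  vec_partials D Z Zu Zv -> vec_partials D Z Zu' Zv' -> D (u, v) ->
  Zu u v = Zu' u v /\ Zv u v = Zv' u v.
Proof.
  intros (H1 & H2 & H3) (H1' & H2' & H3') Huv.
  destruct (has_partials_unique _ _ _ _ _ _ _ _ H1 H1' Huv).
  destruct (has_partials_unique _ _ _ _ _ _ _ _ H2 H2' Huv).
  destruct (has_partials_unique _ _ _ _ _ _ _ _ H3 H3' Huv).
  split; now apply vec_ext.
Qed.

Lemma has_partials_mink D X Xu Xv Y Yu Yv :
  vec_partials D X Xu Xv -> vec_partials D Y Yu Yv ->
  has_partials D (fun u v => mink (X u v) (Y u v))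
    (fun u v => mink (Xu u v) (Y u v) + mink (X u v) (Yu u v))
    (fun u v => mink (Xv u v) (Y u v) + mink (X u v) (Yv u v)).
Proof.
  intros (A1 & A2 & A3) (B1 & B2 & B3) u v Huv.
  assert (H := has_partials_minus _ _ _ _ _ _ _ (has_partials_plus _ _ _ _ _ _ _
    (has_partials_mult _ _ _ _ _ _ _ A1 B1) (has_partials_mult _ _ _ _ _ _ _ A2 B2))
    (has_partials_mult _ _ _ _ _ _ _ A3 B3) u v Huv).
  cbv beta in H. unfold mink.
  match type of H with is_derive _ _ ?a /\ is_derive _ _ ?b =>
    match goal with |- is_derive _ _ ?c /\ is_derive _ _ ?d =>
      replace c with a by ring; replace d with b by ring end end.
  exact H.
Qed.

Lemma vec_partials_vscale D c cu cv X Xu Xv :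
  has_partials D c cu cv -> vec_partials D X Xu Xv ->
  vec_partials D (fun u v => vscale (c u v) (X u v))
    (fun u v => vcomb (cu u v) (X u v) (c u v) (Xu u v) 0 (X u v))
    (fun u v => vcomb (cv u v) (X u v) (c u v) (Xv u v) 0 (X u v)).
Proof.
  intros Hc (A1 & A2 & A3). split; [|split]; intros u v Huv; simpl;
    rewrite !Rmult_0_l, !Rplus_0_r.
  - exact (has_partials_mult _ _ _ _ _ _ _ Hc A1 u v Huv).
  - exact (has_partials_mult _ _ _ _ _ _ _ Hc A2 u v Huv).
  - exact (has_partials_mult _ _ _ _ _ _ _ Hc A3 u v Huv).
Qed.

Lemma smooth_surface_partials D z : smooth_surface D z -> vec_partials D z (zu z) (zv z).
Proof.
  intros (H1 & H2 & H3). split; [|split].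
  - exact (smooth2_partials _ _ H1).
  - exact (smooth2_partials _ _ H2).
  - exact (smooth2_partials _ _ H3).
Qed.

Lemma smooth_surface_zu D z : smooth_surface D z -> smooth_surface D (zu z).
Proof.
  intros (H1 & H2 & H3). split; [|split].
  - exact (smooth2_du _ _ H1).
  - exact (smooth2_du _ _ H2).
  - exact (smooth2_du _ _ H3).
Qed.

Lemma smooth_surface_zv D z : smooth_surface D z -> smooth_surface D (zv z).
Proof.
  intros (H1 & H2 & H3). split; [|split].
  - exact (smooth2_dv _ _ H1).
  - exact (smooth2_dv _ _ H2).
  - exact (smooth2_dv _ _ H3).
Qed.

Lemma smooth_surface_schwarz D z u v :
  open D -> smooth_surface D z -> D (u, v) -> zv (zu z) u v = zu (zv z) u v.
Proof.
  intros HD (H1 & H2 & H3) Huv. apply vec_ext.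
  - exact (smooth2_schwarz D _ u v HD H1 Huv).
  - exact (smooth2_schwarz D _ u v HD H2 Huv).
  - exact (smooth2_schwarz D _ u v HD H3 Huv).
Qed.

Lemma smooth_surface_ext D Z W :
  open D -> (forall u v, D (u, v) -> Z u v = W u v) -> smooth_surface D Z ->
  smooth_surface D W.
Proof.
  intros HD E (H1 & H2 & H3). split; [|split].
  - refine (smooth2_ext D _ _ HD _ H1). intros; f_equal; auto.
  - refine (smooth2_ext D _ _ HD _ H2). intros; f_equal; auto.
  - refine (smooth2_ext D _ _ HD _ H3). intros; f_equal; auto.
Qed.

Lemma smooth2_mink D X Y :
  open D -> smooth_surface D X -> smooth_surface D Y ->
  smooth2 D (fun u v => mink (X u v) (Y u v)).
Proof.
  intros HD (A1 & A2 & A3) (B1 & B2 & B3). unfold mink.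
  apply smooth2_minus; [trivial|apply smooth2_plus; trivial|]; now apply smooth2_mult.
Qed.

Lemma smooth_surface_vscale D c X :
  open D -> smooth2 D c -> smooth_surface D X ->
  smooth_surface D (fun u v => vscale (c u v) (X u v)).
Proof.
  intros HD Hc (A1 & A2 & A3). split; [|split]; now apply smooth2_mult.
Qed.

Lemma smooth_surface_normal D X Y :
  open D -> smooth_surface D X -> smooth_surface D Y ->
  smooth_surface D (fun u v => normal_of (X u v) (Y u v)).
Proof.
  intros HD (A1 & A2 & A3) (B1 & B2 & B3).
  split; [|split]; apply smooth2_minus; trivial; now apply smooth2_mult.
Qed.

Lemma mink_constant_partials D X Y c u v :
  open D -> smooth_surface D X -> smooth_surface D Y ->
  (forall u v, D (u, v) -> mink (X u v) (Y u v) = c) -> D (u, v) ->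
  mink (zu X u v) (Y u v) = - mink (X u v) (zu Y u v) /\
  mink (zv X u v) (Y u v) = - mink (X u v) (zv Y u v).
Proof.
  intros HD SX SY H Huv.
  assert (P := has_partials_mink _ _ _ _ _ _ _ (smooth_surface_partials _ _ SX)
                 (smooth_surface_partials _ _ SY)).
  assert (Q : has_partials D (fun u v => mink (X u v) (Y u v)) (fun _ _ => 0) (fun _ _ => 0)).
  { refine (has_partials_ext D _ _ _ _ _ _ HD _ _ _ (has_partials_const D c)); auto.
    intros; symmetry; auto. }
  destruct (has_partials_unique _ _ _ _ _ _ _ _ P Q Huv). cbv beta in *. lra.
Qed.

Lemma space_like_positive D z u v :
  space_like D z -> D (u, v) -> 0 < fE z u v /\ 0 < fG z u v.
Proof.
  intros H Huv. split.
  - assert (A := H u v Huv 1 0 ltac:(intros E; injection E; lra)). lra.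
  - assert (A := H u v Huv 0 1 ltac:(intros E; injection E; lra)). lra.
Qed.

(** The moving frame of a surface in principal parameters, with its Gauss-Weingarten
    equations, and the Codazzi equations written with the invariants. *)
Lemma structure_equations D z l n1 n2 g1 g2 :
  open D -> regular_principal_surface D z l -> has_invariants D z l n1 n2 g1 g2 ->
  smooth2 D n1 -> smooth2 D n2 ->
  exists p q X Y,
    (forall u v, D (u, v) ->
       0 < p u v /\ 0 < q u v /\ orthonormal (X u v) (Y u v) (l u v) /\
       det3 (X u v) (Y u v) (l u v) = 1) /\
    vec_partials D z (fun u v => vscale (p u v) (X u v)) (fun u v => vscale (q u v) (Y u v)) /\
    moving_frame D (fun u v => g1 u v * p u v) (fun u v => n1 u v * p u v)
                   (fun u v => g2 u v * q u v) (fun u v => n2 u v * q u v) X Y l /\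
    (forall u v, D (u, v) ->
       dv n1 u v = g1 u v * q u v * (n1 u v - n2 u v) /\
       du n2 u v = g2 u v * p u v * (n1 u v - n2 u v)).
Proof.
  intros HD (Sz & SL & UN & PP & SR) Inv Sn1 Sn2.
  set (p := fun u v => sqrt (fE z u v)). set (q := fun u v => sqrt (fG z u v)).
  assert (EG : forall u v, D (u, v) -> 0 < fE z u v /\ 0 < fG z u v)
    by (intros; now apply space_like_positive with D).
  assert (pq : forall u v, D (u, v) -> 0 < p u v /\ 0 < q u v).
  { intros u v Huv. destruct (EG u v Huv). split; now apply sqrt_lt_R0. }
  assert (pE : forall u v, D (u, v) -> p u v * p u v = fE z u v).
  { intros u v Huv. destruct (EG u v Huv). apply sqrt_sqrt. lra. }
  assert (qG : forall u v, D (u, v) -> q u v * q u v = fG z u v).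
  { intros u v Huv. destruct (EG u v Huv). apply sqrt_sqrt. lra. }
  assert (Szu := smooth_surface_zu D z Sz). assert (Szv := smooth_surface_zv D z Sz).
  assert (Sp : smooth2 D p).
  { apply smooth2_sqrt; trivial; [apply EG|]. now apply smooth2_mink. }
  assert (Sq : smooth2 D q).
  { apply smooth2_sqrt; trivial; [apply EG|]. now apply smooth2_mink. }
  set (X := fun u v => vscale (/ p u v) (zu z u v)).
  set (Y := fun u v => vscale (/ q u v) (zv z u v)).
  assert (SX : smooth_surface D X).
  { apply smooth_surface_vscale; trivial. apply smooth2_inv; trivial.
    intros u v Huv. destruct (pq u v Huv). lra. }
  assert (SY : smooth_surface D Y).
  { apply smooth_surface_vscale; trivial. apply smooth2_inv; trivial.
    intros u v Huv. destruct (pq u v Huv). lra. }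
  assert (zuX : forall u v, D (u, v) -> zu z u v = vscale (p u v) (X u v)).
  { intros u v Huv. destruct (pq u v Huv).
    apply vec_ext; unfold X; cbn [vscale x1 x2 x3 fst snd]; field; lra. }
  assert (zvY : forall u v, D (u, v) -> zv z u v = vscale (q u v) (Y u v)).
  { intros u v Huv. destruct (pq u v Huv).
    apply vec_ext; unfold Y; cbn [vscale x1 x2 x3 fst snd]; field; lra. }
  assert (ON : forall u v, D (u, v) -> orthonormal (X u v) (Y u v) (l u v)).
  { intros u v Huv. destruct (pq u v Huv) as [Pp Pq]. destruct (UN u v Huv) as (ll & lu & lv & _).
    destruct (PP u v Huv) as [F0 _].
    unfold orthonormal, X, Y. rewrite !mink_vscale_l, !mink_vscale_r, ll, lu, lv.
    change (mink (zu z u v) (zu z u v)) with (fE z u v).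
    change (mink (zv z u v) (zv z u v)) with (fG z u v).
    change (mink (zu z u v) (zv z u v)) with (fF z u v).
    rewrite <- (pE u v Huv), <- (qG u v Huv), F0.
    repeat split; try ring; field; lra. }
  assert (NO : forall u v, D (u, v) ->
            det3 (X u v) (Y u v) (l u v) = 1 /\ l u v = normal_of (X u v) (Y u v)).
  { intros u v Huv. apply orthonormal_normal; [now apply ON|].
    destruct (UN u v Huv) as (_ & _ & _ & P). now rewrite !scal_vscale in P. }
  assert (Sl : smooth_surface D l).
  { apply smooth_surface_ext with (fun u v => normal_of (X u v) (Y u v)); trivial.
    - intros u v Huv. symmetry. now apply NO.
    - now apply smooth_surface_normal. }
  assert (Pzu : vec_partials D (zu z)
    (fun u v => vcomb (du p u v) (X u v) (p u v) (zu X u v) 0 (X u v))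
    (fun u v => vcomb (dv p u v) (X u v) (p u v) (zv X u v) 0 (X u v))).
  { refine (vec_partials_ext D _ _ _ _ _ _ HD _ _ _ (vec_partials_vscale _ _ _ _ _ _ _
      (smooth2_partials _ _ Sp) (smooth_surface_partials _ _ SX))); trivial.
    intros u v Huv. symmetry. now apply zuX. }
  assert (Pzv : vec_partials D (zv z)
    (fun u v => vcomb (du q u v) (Y u v) (q u v) (zu Y u v) 0 (Y u v))
    (fun u v => vcomb (dv q u v) (Y u v) (q u v) (zv Y u v) 0 (Y u v))).
  { refine (vec_partials_ext D _ _ _ _ _ _ HD _ _ _ (vec_partials_vscale _ _ _ _ _ _ _
      (smooth2_partials _ _ Sq) (smooth_surface_partials _ _ SY))); trivial.
    intros u v Huv. symmetry. now apply zvY. }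
  assert (Hpq : forall u v, D (u, v) ->
            dv p u v = - (g1 u v * p u v) * q u v /\ du q u v = g2 u v * q u v * p u v).
  { intros u v Huv. destruct (pq u v Huv) as [Pp Pq]. destruct (Inv u v Huv) as (_ & _ & G1 & G2).
    assert (Ev : dv (fE z) u v = dv p u v * p u v + p u v * dv p u v).
    { apply (has_partials_dv D _ (fun u v => du p u v * p u v + p u v * du p u v)
        (fun u v => dv p u v * p u v + p u v * dv p u v)); trivial.
      refine (has_partials_ext D _ _ _ _ _ _ HD pE _ _
        (has_partials_mult _ _ _ _ _ _ _ (smooth2_partials _ _ Sp) (smooth2_partials _ _ Sp)));
        trivial. }
    assert (Gu : du (fG z) u v = du q u v * q u v + q u v * du q u v).
    { apply (has_partials_du D _ (fun u v => du q u v * q u v + q u v * du q u v)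
        (fun u v => dv q u v * q u v + q u v * dv q u v)); trivial.
      refine (has_partials_ext D _ _ _ _ _ _ HD qG _ _
        (has_partials_mult _ _ _ _ _ _ _ (smooth2_partials _ _ Sq) (smooth2_partials _ _ Sq)));
        trivial. }
    rewrite <- G1, <- G2. unfold gamma1, gamma2.
    change (sqrt (fE z u v)) with (p u v). change (sqrt (fG z u v)) with (q u v).
    rewrite Ev, Gu, <- (pE u v Huv), <- (qG u v Huv).
    split; field; lra. }
  assert (K : forall u v, D (u, v) ->
      (zu X u v = vcomb 0 (X u v) (g1 u v * p u v) (Y u v) (- (n1 u v * p u v)) (l u v) /\
       zv X u v = vcomb 0 (X u v) (g2 u v * q u v) (Y u v) 0 (l u v)) /\
      (zu Y u v = vcomb (- (g1 u v * p u v)) (X u v) 0 (Y u v) 0 (l u v) /\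
       zv Y u v = vcomb (- (g2 u v * q u v)) (X u v) 0 (Y u v) (- (n2 u v * q u v)) (l u v)) /\
      (zu l u v = vcomb (- (n1 u v * p u v)) (X u v) 0 (Y u v) 0 (l u v) /\
       zv l u v = vcomb 0 (X u v) (- (n2 u v * q u v)) (Y u v) 0 (l u v))).
    { intros u v Huv. destruct (pq u v Huv) as [Pp Pq].
      assert (O := ON u v Huv). destruct O as (XX & YY & ll & XY & lX & lY).
      destruct (mink_constant_partials D X X 1 u v HD SX SX
        (fun s t H => proj1 (ON s t H)) Huv) as [XXu XXv].
      destruct (mink_constant_partials D Y Y 1 u v HD SY SY
        (fun s t H => proj1 (proj2 (ON s t H))) Huv) as [YYu YYv].
      destruct (mink_constant_partials D l l (-1) u v HD Sl Sl
        (fun s t H => proj1 (proj2 (proj2 (ON s t H)))) Huv) as [llu llv].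
      destruct (mink_constant_partials D X Y 0 u v HD SX SY
        (fun s t H => proj1 (proj2 (proj2 (proj2 (ON s t H))))) Huv) as [XYu XYv].
      destruct (mink_constant_partials D l X 0 u v HD Sl SX
        (fun s t H => proj1 (proj2 (proj2 (proj2 (proj2 (ON s t H)))))) Huv) as [lXu lXv].
      destruct (mink_constant_partials D l Y 0 u v HD Sl SY
        (fun s t H => proj2 (proj2 (proj2 (proj2 (proj2 (ON s t H)))))) Huv) as [lYu lYv].
      rewrite (mink_sym (X u v) (zu X u v)) in XXu.
      rewrite (mink_sym (X u v) (zv X u v)) in XXv.
      rewrite (mink_sym (Y u v) (zu Y u v)) in YYu.
      rewrite (mink_sym (Y u v) (zv Y u v)) in YYv.
      rewrite (mink_sym (l u v) (zu l u v)) in llu.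
      rewrite (mink_sym (l u v) (zv l u v)) in llv.
      destruct (Inv u v Huv) as (N1 & N2 & _ & _). destruct (PP u v Huv) as [_ M0].
      destruct (Hpq u v Huv) as [pv qu].
      destruct (vec_partials_unique _ _ _ _ _ _ u v
        (smooth_surface_partials _ _ Szu) Pzu Huv) as [Zuu Zuv].
      destruct (vec_partials_unique _ _ _ _ _ _ u v
        (smooth_surface_partials _ _ Szv) Pzv Huv) as [Zvu Zvv].
      (* the products of the two expressions of [z_uv] with the frame give the remaining
         coefficients *)
      assert (Sch := smooth_surface_schwarz D z u v HD Sz Huv).
      rewrite Zuv, Zvu in Sch.
      unfold nu1, fL in N1. rewrite Zuu, mink_vcomb_r, lX, <- (pE u v Huv) in N1.
      unfold nu2, fN in N2. rewrite Zvv, mink_vcomb_r, lY, <- (qG u v Huv) in N2.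
      unfold fM in M0. rewrite Zuv, mink_vcomb_r, lX in M0.
      assert (SX' := f_equal (fun w => mink w (X u v)) Sch).
      assert (SY' := f_equal (fun w => mink w (Y u v)) Sch).
      assert (Sl' := f_equal (fun w => mink (l u v) w) Sch).
      cbv beta in SX', SY', Sl'. rewrite !mink_vcomb_l in SX', SY'.
      rewrite !mink_vcomb_r in Sl'.
      rewrite (mink_sym (Y u v) (X u v)), XX, XY in SX'. rewrite YY, XY in SY'.
      rewrite lX, lY in Sl'.
      assert (cancel : forall c a b, 0 < c -> c * a = c * b -> a = b).
      { intros c a b Hc E. apply Rmult_eq_reg_l with c; [trivial|lra]. }
      assert (lXu' : mink (l u v) (zu X u v) = n1 u v * p u v).
      { rewrite <- N1. field. lra. }
      assert (lXv' : mink (l u v) (zv X u v) = 0).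
      { apply (cancel (p u v)); trivial. lra. }
      assert (lYu' : mink (l u v) (zu Y u v) = 0).
      { apply (cancel (q u v)); trivial. lra. }
      assert (lYv' : mink (l u v) (zv Y u v) = n2 u v * q u v).
      { rewrite <- N2. field. lra. }
      assert (XuX : mink (zu X u v) (X u v) = 0) by lra.
      assert (XvX : mink (zv X u v) (X u v) = 0) by lra.
      assert (YuY : mink (zu Y u v) (Y u v) = 0) by lra.
      assert (YvY : mink (zv Y u v) (Y u v) = 0) by lra.
      assert (lul : mink (zu l u v) (l u v) = 0) by lra.
      assert (lvl : mink (zv l u v) (l u v) = 0) by lra.
      assert (YuX : mink (zu Y u v) (X u v) = - (g1 u v * p u v)).
      { apply (cancel (q u v)); trivial. rewrite XvX, pv in SX'. lra. }
      assert (XvY : mink (zv X u v) (Y u v) = g2 u v * q u v).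
      { apply (cancel (p u v)); trivial. rewrite YuY, qu in SY'. lra. }
      rewrite (mink_sym (X u v)) in XYu, XYv.
      assert (expand : forall w a b c, mink w (X u v) = a -> mink w (Y u v) = b ->
                - mink (l u v) w = c -> w = vcomb a (X u v) b (Y u v) c (l u v)).
      { intros w a b c <- <- <-. rewrite (mink_sym (l u v) w). now apply orthonormal_expansion, ON. }
      rewrite (mink_sym _ (l u v)) in lul. rewrite (mink_sym _ (l u v)) in lvl.
      repeat split; apply expand; lra. }
  exists p, q, X, Y. split; [|split; [|split]].
  - intros u v Huv. destruct (pq u v Huv). destruct (NO u v Huv).
    split; [trivial|split; [trivial|split; [now apply ON|trivial]]].
  - exact (vec_partials_ext D _ _ _ _ _ _ HD (fun _ _ _ => eq_refl) zuX zvY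
             (smooth_surface_partials D z Sz)).
  - split; [|split].
    + exact (vec_partials_ext D _ _ _ _ _ _ HD (fun _ _ _ => eq_refl)
               (fun s t H => proj1 (proj1 (K s t H))) (fun s t H => proj2 (proj1 (K s t H)))
               (smooth_surface_partials D X SX)).
    + exact (vec_partials_ext D _ _ _ _ _ _ HD (fun _ _ _ => eq_refl)
               (fun s t H => proj1 (proj1 (proj2 (K s t H)))) (fun s t H => proj2 (proj1 (proj2 (K s t H))))
               (smooth_surface_partials D Y SY)).
    + exact (vec_partials_ext D _ _ _ _ _ _ HD (fun _ _ _ => eq_refl)
               (fun s t H => proj1 (proj2 (proj2 (K s t H)))) (fun s t H => proj2 (proj2 (proj2 (K s t H))))
               (smooth_surface_partials D l Sl)).
  - (* the Codazzi equations are the symmetry of the second derivatives of the normal *)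
    intros u v Huv.
    assert (Pc1 := has_partials_opp _ _ _ _ (has_partials_mult _ _ _ _ _ _ _
      (smooth2_partials _ _ Sn1) (smooth2_partials _ _ Sp))).
    assert (Pc2 := has_partials_opp _ _ _ _ (has_partials_mult _ _ _ _ _ _ _
      (smooth2_partials _ _ Sn2) (smooth2_partials _ _ Sq))).
    assert (P1 := vec_partials_vscale _ _ _ _ _ _ _ Pc1 (smooth_surface_partials _ _ SX)).
    assert (P2 := vec_partials_vscale _ _ _ _ _ _ _ Pc2 (smooth_surface_partials _ _ SY)).
    assert (E1 : forall s t, D (s, t) -> vscale (- (n1 s t * p s t)) (X s t) = zu l s t).
    { intros s t Hst. destruct (K s t Hst) as (_ & _ & -> & _). apply vec_ext; vring. }
    assert (E2 : forall s t, D (s, t) -> vscale (- (n2 s t * q s t)) (Y s t) = zv l s t).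
    { intros s t Hst. destruct (K s t Hst) as (_ & _ & _ & ->). apply vec_ext; vring. }
    apply (vec_partials_ext D _ _ _ _ _ _ HD E1 (fun _ _ _ => eq_refl) (fun _ _ _ => eq_refl))
      in P1.
    apply (vec_partials_ext D _ _ _ _ _ _ HD E2 (fun _ _ _ => eq_refl) (fun _ _ _ => eq_refl))
      in P2.
    assert (Slu := smooth_surface_partials _ _ (smooth_surface_zu _ _ Sl)).
    assert (Slv := smooth_surface_partials _ _ (smooth_surface_zv _ _ Sl)).
    destruct (vec_partials_unique _ _ _ _ _ _ u v Slu P1 Huv) as [_ Luv].
    destruct (vec_partials_unique _ _ _ _ _ _ u v Slv P2 Huv) as [Lvu _].
    assert (Sch := smooth_surface_schwarz D l u v HD Sl Huv).
    rewrite Luv, Lvu in Sch. clear Luv Lvu Slu Slv P1 P2 E1 E2 Pc1 Pc2.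
    destruct (K u v Huv) as ((_ & Xv) & (Yu & _) & _). rewrite Xv, Yu in Sch.
    destruct (pq u v Huv) as [Pp Pq]. destruct (Hpq u v Huv) as [pv qu].
    destruct (ON u v Huv) as (XX & YY & ll & XY & lX & lY).
    assert (SX' := f_equal (fun w => mink w (X u v)) Sch).
    assert (SY' := f_equal (fun w => mink w (Y u v)) Sch).
    cbv beta in SX', SY'. rewrite !mink_vcomb_l in SX', SY'.
    rewrite (mink_sym (Y u v) (X u v)), XX, XY, lX, pv in SX'.
    rewrite YY, XY, lY, qu in SY'.
    split.
    + apply Rmult_eq_reg_l with (p u v); lra.
    + apply Rmult_eq_reg_l with (q u v); lra.
Qed.

(** Both metric coefficients are determined by the Codazzi equations, so that strongly
    regular surfaces with the same invariants satisfy the same frame system. *)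
Theorem congruence_of_invariants D z l z' l' n1 n2 g1 g2 u0 v0 :
  planar_domain D -> D (u0, v0) -> smooth2 D n1 -> smooth2 D n2 ->
  regular_principal_surface D z l -> has_invariants D z l n1 n2 g1 g2 ->
  regular_principal_surface D z' l' -> has_invariants D z' l' n1 n2 g1 g2 ->
  exists T, motion T /\ forall u v, D (u, v) -> z' u v = T (z u v).
Proof.
  intros (_ & HD & HC) H0 Sn1 Sn2 Rz Iz Rz' Iz'.
  destruct (structure_equations D z l n1 n2 g1 g2 HD Rz Iz Sn1 Sn2)
    as (p & q & X & Y & A & P & M & C).
  destruct (structure_equations D z' l' n1 n2 g1 g2 HD Rz' Iz' Sn1 Sn2)
    as (p' & q' & X' & Y' & A' & P' & M' & C').
  assert (E : forall u v, D (u, v) -> p' u v = p u v /\ q' u v = q u v).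
  { intros u v Huv. destruct (C u v Huv) as [C1 C2]. destruct (C' u v Huv) as [C1' C2'].
    destruct Rz as (_ & _ & _ & _ & SR). specialize (SR u v Huv).
    destruct (Iz u v Huv) as (E1 & E2 & E3 & E4). rewrite E1, E2, E3, E4 in SR.
    assert (N : g1 u v <> 0 /\ g2 u v <> 0 /\ n1 u v - n2 u v <> 0).
    { split; [|split]; intros Z; apply SR; rewrite Z; ring. }
    destruct N as (N1 & N2 & N3). split.
    - apply Rmult_eq_reg_l with (g2 u v * (n1 u v - n2 u v)).
      + lra.
      + now apply Rmult_integral_contrapositive_currified.
    - apply Rmult_eq_reg_l with (g1 u v * (n1 u v - n2 u v)).
      + lra.
      + now apply Rmult_integral_contrapositive_currified. }
  apply (frame_congruence D (fun u v => g1 u v * p u v) (fun u v => n1 u v * p u v)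
    (fun u v => g2 u v * q u v) (fun u v => n2 u v * q u v) p q X Y l X' Y' l' z z' u0 v0);
    [exact HD|exact HC|exact H0|exact M| | | | | |exact P| ].
  - destruct M' as (M1 & M2 & M3). split; [|split].
    + refine (vec_partials_ext D _ _ _ _ _ _ HD _ _ _ M1); trivial;
        intros u v Huv; destruct (E u v Huv) as [Ep Eq]; now rewrite ?Ep, ?Eq.
    + refine (vec_partials_ext D _ _ _ _ _ _ HD _ _ _ M2); trivial;
        intros u v Huv; destruct (E u v Huv) as [Ep Eq]; now rewrite ?Ep, ?Eq.
    + refine (vec_partials_ext D _ _ _ _ _ _ HD _ _ _ M3); trivial;
        intros u v Huv; destruct (E u v Huv) as [Ep Eq]; now rewrite ?Ep, ?Eq.
  - intros u v Huv. apply (A u v Huv).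
  - intros u v Huv. apply (A' u v Huv).
  - apply (A u0 v0 H0).
  - apply (A' u0 v0 H0).
  - refine (vec_partials_ext D _ _ _ _ _ _ HD _ _ _ P'); trivial;
      intros u v Huv; destruct (E u v Huv) as [Ep Eq]; now rewrite ?Ep, ?Eq.
Qed.

(** * Existence of a surface with given invariants *)

(** The coefficient matrices are trace-free, so that determinants of solutions are constant. *)
Lemma frame_system_det D al be ga de x y l x' y' l' x'' y'' l'' :
  open D -> frame_system D al be ga de x y l -> frame_system D al be ga de x' y' l' ->
  frame_system D al be ga de x'' y'' l'' ->
  has_partials D (fun u v => det3 (x u v, x' u v, x'' u v) (y u v, y' u v, y'' u v)
                                  (l u v, l' u v, l'' u v))
    (fun _ _ => 0) (fun _ _ => 0).
Proof.
  intros HD (Px & Py & Pl) (Px' & Py' & Pl') (Px'' & Py'' & Pl'').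
  assert (M2 : forall h hu hv k ku kv h' hu' hv' k' ku' kv',
    has_partials D h hu hv -> has_partials D k ku kv ->
    has_partials D h' hu' hv' -> has_partials D k' ku' kv' ->
    has_partials D (fun u v => h u v * k u v - h' u v * k' u v)
     (fun u v => hu u v * k u v + h u v * ku u v - (hu' u v * k' u v + h' u v * ku' u v))
     (fun u v => hv u v * k u v + h u v * kv u v - (hv' u v * k' u v + h' u v * kv' u v))).
  { intros. apply has_partials_minus; now apply has_partials_mult. }
  refine (has_partials_ext D _ _ _ _ _ _ HD _ _ _
    (has_partials_plus _ _ _ _ _ _ _
      (has_partials_minus _ _ _ _ _ _ _
        (has_partials_mult _ _ _ _ _ _ _ Px
           (M2 _ _ _ _ _ _ _ _ _ _ _ _ Py' Pl'' Py'' Pl'))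
        (has_partials_mult _ _ _ _ _ _ _ Px'
           (M2 _ _ _ _ _ _ _ _ _ _ _ _ Py Pl'' Py'' Pl)))
      (has_partials_mult _ _ _ _ _ _ _ Px''
           (M2 _ _ _ _ _ _ _ _ _ _ _ _ Py Pl' Py' Pl)))).
  - reflexivity.
  - intros u v _. cbv beta. ring.
  - intros u v _. cbv beta. ring.
Qed.

(** Integration of the frame equations from a standard initial frame. *)
Lemma moving_frame_exists D u0 v0 al be ga de :
  open D -> D (u0, v0) ->
  smooth2 D al -> smooth2 D be -> smooth2 D ga -> smooth2 D de ->
  (forall u v, D (u, v) ->
     dv al u v + be u v * de u v = du ga u v /\
     dv be u v = - al u v * de u v /\
     du de u v = be u v * ga u v) ->
  exists r, 0 < r /\ (forall w, square u0 v0 r w -> D w) /\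
    exists X Y l,
      moving_frame (square u0 v0 r) al be ga de X Y l /\
      smooth_surface (square u0 v0 r) X /\ smooth_surface (square u0 v0 r) Y /\
      smooth_surface (square u0 v0 r) l /\
      forall u v, square u0 v0 r (u, v) ->
        orthonormal (X u v) (Y u v) (l u v) /\ det3 (X u v) (Y u v) (l u v) = 1.
Proof.
  intros HD H0 Sa Sb Sg Sd Hc.
  destruct (frame_system_solution D u0 v0 al be ga de HD H0 Sa Sb Sg Sd Hc)
    as (r & Hr & Hs & Sol).
  exists r. split; [trivial|]. split; [trivial|].
  destruct (Sol (fun i => match i with comp_x => 1 | _ => 0 end))
    as (a1 & b1 & c1 & (A1 & B1 & C1) & Pa1 & Pb1 & Pc1 & Sa1 & Sb1 & Sc1).
  destruct (Sol (fun i => match i with comp_y => 1 | _ => 0 end))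
    as (a2 & b2 & c2 & (A2 & B2 & C2) & Pa2 & Pb2 & Pc2 & Sa2 & Sb2 & Sc2).
  destruct (Sol (fun i => match i with comp_l => 1 | _ => 0 end))
    as (a3 & b3 & c3 & (A3 & B3 & C3) & Pa3 & Pb3 & Pc3 & Sa3 & Sb3 & Sc3).
  set (Q := square u0 v0 r) in *.
  assert (HQ : open Q) by apply square_open.
  assert (CQ : connected Q) by apply square_connected.
  assert (Q0 : Q (u0, v0)) by now apply square_center.
  assert (F1 : frame_system Q al be ga de a1 b1 c1) by (split; [|split]; assumption).
  assert (F2 : frame_system Q al be ga de a2 b2 c2) by (split; [|split]; assumption).
  assert (F3 : frame_system Q al be ga de a3 b3 c3) by (split; [|split]; assumption).
  exists (fun u v => (a1 u v, a2 u v, a3 u v)), (fun u v => (b1 u v, b2 u v, b3 u v)),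
    (fun u v => (c1 u v, c2 u v, c3 u v)).
  split; [|split; [|split; [|split]]].
  - apply moving_frame_components; [trivial|]. split; [exact F1|split; [exact F2|exact F3]].
  - split; [exact Sa1|split; [exact Sa2|exact Sa3]].
  - split; [exact Sb1|split; [exact Sb2|exact Sb3]].
  - split; [exact Sc1|split; [exact Sc2|exact Sc3]].
  - intros u v Huv.
    assert (K : forall x y l x' y' l', frame_system Q al be ga de x y l ->
       frame_system Q al be ga de x' y' l' ->
       x u v * x' u v + y u v * y' u v - l u v * l' u v =
       x u0 v0 * x' u0 v0 + y u0 v0 * y' u0 v0 - l u0 v0 * l' u0 v0).
    { intros x y l x' y' l' F F'.
      apply (connected_constant Q (fun u v => x u v * x' u v + y u v * y' u v
               - l u v * l' u v) (u, v) (u0, v0)); trivial.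
      now apply (frame_system_pairing Q al be ga de). }
    split.
    + apply orthonormal_transpose. unfold orthonormal, mink. simpl.
      rewrite (K _ _ _ _ _ _ F1 F1), (K _ _ _ _ _ _ F2 F2), (K _ _ _ _ _ _ F3 F3),
        (K _ _ _ _ _ _ F1 F2), (K _ _ _ _ _ _ F3 F1), (K _ _ _ _ _ _ F3 F2).
      rewrite A1, B1, C1, A2, B2, C2, A3, B3, C3. repeat split; ring.
    + transitivity (det3 (a1 u0 v0, a2 u0 v0, a3 u0 v0) (b1 u0 v0, b2 u0 v0, b3 u0 v0)
                         (c1 u0 v0, c2 u0 v0, c3 u0 v0)).
      * apply (connected_constant Q (fun u v => det3 (a1 u v, a2 u v, a3 u v)
          (b1 u v, b2 u v, b3 u v) (c1 u v, c2 u v, c3 u v)) (u, v) (u0, v0)); trivial.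
        now apply (frame_system_det Q al be ga de).
      * rewrite A1, B1, C1, A2, B2, C2, A3, B3, C3. vring.
Qed.

(** The fundamental theorem of surface theory in principal parameters: if [g1] and [g2] are the
    principal geodesic curvatures of the metric with coefficients [p^2] and [q^2], then the
    Gauss and Codazzi equations suffice for the local existence of a surface. *)
Theorem surface_of_invariants D u0 v0 p q n1 n2 g1 g2 :
  open D -> D (u0, v0) ->
  smooth2 D p -> smooth2 D q -> smooth2 D n1 -> smooth2 D n2 -> smooth2 D g1 -> smooth2 D g2 ->
  (forall u v, D (u, v) ->
     0 < p u v /\ 0 < q u v /\ (n1 u v - n2 u v) * g1 u v * g2 u v <> 0) ->
  (forall u v, D (u, v) ->
     dv p u v = - g1 u v * p u v * q u v /\ du q u v = g2 u v * p u v * q u v) ->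
  (forall u v, D (u, v) ->
     dv n1 u v = g1 u v * q u v * (n1 u v - n2 u v) /\
     du n2 u v = g2 u v * p u v * (n1 u v - n2 u v)) ->
  (forall u v, D (u, v) ->
     dv (fun u v => g1 u v * p u v) u v + n1 u v * n2 u v * p u v * q u v
     = du (fun u v => g2 u v * q u v) u v) ->
  exists r, 0 < r /\ (forall w, square u0 v0 r w -> D w) /\
    exists z l,
      regular_principal_surface (square u0 v0 r) z l /\
      has_invariants (square u0 v0 r) z l n1 n2 g1 g2 /\
      forall u v, square u0 v0 r (u, v) ->
        fE z u v = p u v ^ 2 /\ fG z u v = q u v ^ 2.
Proof.
  intros HD H0 Sp Sq Sn1 Sn2 Sg1 Sg2 Hpos Hpq Hcod Hgauss.
  destruct (moving_frame_exists D u0 v0 (fun u v => g1 u v * p u v) (fun u v => n1 u v * p u v)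
              (fun u v => g2 u v * q u v) (fun u v => n2 u v * q u v))
    as (r & Hr & Hs & X & Y & l & M & SX & SY & Sl & ON); trivial;
    try now apply smooth2_mult.
  { intros u v Huv. destruct (Hpq u v Huv) as [pv qu]. destruct (Hcod u v Huv) as [C1 C2].
    split; [|split].
    - rewrite <- (Hgauss u v Huv). ring.
    - rewrite (has_partials_dv _ _ _ _ _ _ (has_partials_mult _ _ _ _ _ _ _
        (smooth2_partials _ _ Sn1) (smooth2_partials _ _ Sp)) Huv), pv, C1. ring.
    - rewrite (has_partials_du _ _ _ _ _ _ (has_partials_mult _ _ _ _ _ _ _
        (smooth2_partials _ _ Sn2) (smooth2_partials _ _ Sq)) Huv), qu, C2. ring. }
  exists r. split; [trivial|]. split; [trivial|].
  set (Q := square u0 v0 r) in *.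
  assert (HQ : open Q) by apply square_open.
  assert (SpQ : smooth2 Q p) by now apply smooth2_subset with D.
  assert (SqQ : smooth2 Q q) by now apply smooth2_subset with D.
  destruct M as (MX & MY & Ml).
  assert (PX := vec_partials_vscale _ _ _ _ _ _ _ (smooth2_partials _ _ SpQ) MX).
  assert (PY := vec_partials_vscale _ _ _ _ _ _ _ (smooth2_partials _ _ SqQ) MY).
  assert (SPX := smooth_surface_vscale _ _ _ HQ SpQ SX).
  assert (SPY := smooth_surface_vscale _ _ _ HQ SqQ SY).
  assert (Closed : forall u v, Q (u, v) ->
    zv (fun u v => vscale (p u v) (X u v)) u v = zu (fun u v => vscale (q u v) (Y u v)) u v).
  { intros u v Huv.
    destruct (vec_partials_unique _ _ _ _ _ _ u v (smooth_surface_partials _ _ SPX) PX Huv)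
      as [_ ->].
    destruct (vec_partials_unique _ _ _ _ _ _ u v (smooth_surface_partials _ _ SPY) PY Huv)
      as [-> _].
    destruct (Hpq u v (Hs _ Huv)) as [-> ->].
    apply vec_ext; vring. }
  destruct SPX as (SX1 & SX2 & SX3). destruct SPY as (SY1 & SY2 & SY3).
  destruct (square_potential u0 v0 r _ _ Hr SX1 SY1) as (z1 & Pz1 & Sz1).
  { intros u v Huv. exact (f_equal x1 (Closed u v Huv)). }
  destruct (square_potential u0 v0 r _ _ Hr SX2 SY2) as (z2 & Pz2 & Sz2).
  { intros u v Huv. exact (f_equal x2 (Closed u v Huv)). }
  destruct (square_potential u0 v0 r _ _ Hr SX3 SY3) as (z3 & Pz3 & Sz3).
  { intros u v Huv. exact (f_equal x3 (Closed u v Huv)). }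
  set (z := (fun u v => (z1 u v, z2 u v, z3 u v)) : surface).
  assert (Sz : smooth_surface Q z) by (split; [exact Sz1|split; [exact Sz2|exact Sz3]]).
  assert (Pz : vec_partials Q z (fun u v => vscale (p u v) (X u v))
                 (fun u v => vscale (q u v) (Y u v)))
    by (split; [exact Pz1|split; [exact Pz2|exact Pz3]]).
  assert (Z1 : forall u v, Q (u, v) ->
    zu z u v = vscale (p u v) (X u v) /\ zv z u v = vscale (q u v) (Y u v)).
  { intros u v Huv.
    exact (vec_partials_unique _ _ _ _ _ _ u v (smooth_surface_partials _ _ Sz) Pz Huv). }
  apply (vec_partials_ext Q _ (zu z) _ _ _ _ HQ (fun u v H => eq_sym (proj1 (Z1 u v H)))
    (fun _ _ _ => eq_refl) (fun _ _ _ => eq_refl)) in PX.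
  apply (vec_partials_ext Q _ (zv z) _ _ _ _ HQ (fun u v H => eq_sym (proj2 (Z1 u v H)))
    (fun _ _ _ => eq_refl) (fun _ _ _ => eq_refl)) in PY.
  assert (EG : forall u v, Q (u, v) -> fE z u v = p u v * p u v /\ fG z u v = q u v * q u v /\
            fF z u v = 0).
  { intros u v Huv. destruct (Z1 u v Huv) as [E1 E2].
    destruct (ON u v Huv) as ((XX & YY & ll & XY & lX & lY) & _).
    unfold fE, fG, fF. rewrite E1, E2, !mink_vscale_l, !mink_vscale_r, XX, YY, XY.
    split; [|split]; ring. }
  assert (LMN : forall u v, Q (u, v) -> fL z l u v = n1 u v * (p u v * p u v) /\
            fM z l u v = 0 /\ fN z l u v = n2 u v * (q u v * q u v)).
  { intros u v Huv.
    destruct (ON u v Huv) as ((XX & YY & ll & XY & lX & lY) & _).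
    destruct (vec_partials_unique _ _ _ _ _ _ u v
      (smooth_surface_partials _ _ (smooth_surface_zu _ _ Sz)) PX Huv) as [E1 E2].
    destruct (vec_partials_unique _ _ _ _ _ _ u v
      (smooth_surface_partials _ _ (smooth_surface_zv _ _ Sz)) PY Huv) as [_ E3].
    unfold fL, fM, fN. rewrite E1, E2, E3, !mink_vcomb_r, lX, lY, ll.
    split; [|split]; ring. }
  assert (Inv : has_invariants Q z l n1 n2 g1 g2).
  { intros u v Huv. destruct (Hpos u v (Hs _ Huv)) as (Pp & Pq & _).
    destruct (EG u v Huv) as (E & G & F). destruct (LMN u v Huv) as (L & M & N).
    destruct (Hpq u v (Hs _ Huv)) as [pv qu].
    assert (Ev : dv (fE z) u v = dv p u v * p u v + p u v * dv p u v).
    { apply (has_partials_dv Q _ (fun u v => du p u v * p u v + p u v * du p u v)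
        (fun u v => dv p u v * p u v + p u v * dv p u v)); trivial.
      refine (has_partials_ext Q _ _ _ _ _ _ HQ
        (fun s t H => eq_sym (proj1 (EG s t H))) _ _
        (has_partials_mult _ _ _ _ _ _ _ (smooth2_partials _ _ SpQ) (smooth2_partials _ _ SpQ)));
        trivial. }
    assert (Gu : du (fG z) u v = du q u v * q u v + q u v * du q u v).
    { apply (has_partials_du Q _ (fun u v => du q u v * q u v + q u v * du q u v)
        (fun u v => dv q u v * q u v + q u v * dv q u v)); trivial.
      refine (has_partials_ext Q _ _ _ _ _ _ HQ
        (fun s t H => eq_sym (proj1 (proj2 (EG s t H)))) _ _
        (has_partials_mult _ _ _ _ _ _ _ (smooth2_partials _ _ SqQ) (smooth2_partials _ _ SqQ)));
        trivial. }
    unfold nu1, nu2, gamma1, gamma2.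
    rewrite Ev, Gu, L, N, E, G, !sqrt_square, pv, qu by lra.
    split; [|split; [|split]]; field; lra. }
  exists z, l. split; [|split; [exact Inv|]].
  2:{ intros u v Huv. destruct (EG u v Huv) as (-> & -> & _). split; ring. }
  split; [exact Sz|split; [|split; [|split]]].
  - intros u v Huv c d Hcd. destruct (EG u v Huv) as (-> & -> & ->).
    destruct (Hpos u v (Hs _ Huv)) as (Pp & Pq & _).
    assert (A1 : 0 < p u v * p u v) by now apply Rmult_lt_0_compat.
    assert (A2 : 0 < q u v * q u v) by now apply Rmult_lt_0_compat.
    assert (B1 := pow2_ge_0 c). assert (B2 := pow2_ge_0 d).
    assert (C1 : 0 <= p u v * p u v * c ^ 2) by (apply Rmult_le_pos; lra).
    assert (C2 : 0 <= q u v * q u v * d ^ 2) by (apply Rmult_le_pos; lra).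
    destruct (Req_dec c 0) as [Zc|Nc].
    + destruct (Req_dec d 0) as [Zd|Nd]; [subst; now contradiction Hcd|].
      assert (0 < q u v * q u v * d ^ 2); [|lra].
      apply Rmult_lt_0_compat; trivial. now apply pow2_gt_0.
    + assert (0 < p u v * p u v * c ^ 2); [|lra].
      apply Rmult_lt_0_compat; trivial. now apply pow2_gt_0.
  - intros u v Huv. destruct (EG u v Huv) as (E & G & _).
    destruct (Hpos u v (Hs _ Huv)) as (Pp & Pq & _).
    destruct (ON u v Huv) as ((XX & YY & ll & XY & lX & lY) & d).
    destruct (Z1 u v Huv) as [E1 E2].
    rewrite E, G, !sqrt_square, E1, E2, !mink_vscale_r, lX, lY, !scal_vscale by lra.
    split; [trivial|]. split; [ring|]. split; [ring|].
    assert (V : forall c w, 0 < c -> vscale (/ c) (vscale c w) = w).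
    { intros c w Hc. apply vec_ext; cbn [vscale x1 x2 x3 fst snd]; field; lra. }
    rewrite !V, d by trivial. lra.
  - intros u v Huv. split; [apply EG|apply LMN]; trivial.
  - intros u v Huv. destruct (Inv u v Huv) as (-> & -> & -> & ->).
    now apply (Hpos u v (Hs _ Huv)).
Qed.

(** * The Weingarten functions *)

(** A value taken with non-vanishing derivative is interior to the interval of values; the
    interval itself need not be open. *)
Lemma interior_value (Int : R -> Prop) D nu u v :
  interval Int -> open D -> smooth2 D nu -> (forall u v, D (u, v) -> Int (nu u v)) ->
  D (u, v) -> du nu u v <> 0 ->
  locally (nu u v) Int.
Proof.
  intros HI HD Sn Hn Huv N.
  assert (P := Rabs_pos_lt _ N). set (m := du nu u v) in *.
  destruct (smooth2_partials D nu Sn u v Huv) as [Du _]. fold m in Du.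
  destruct (proj1 (is_derive_eps _ _ _) Du (Rabs m / 2)) as (d & Hd & H); [lra|].
  destruct (open_slice_u D u v HD Huv) as [r Hr].
  set (k := Rmin d r / 2).
  assert (Hk : 0 < k).
  { unfold k. apply Rdiv_lt_0_compat; [|lra]. apply Rmin_case; trivial. apply cond_pos. }
  assert (Hkd : k < d) by (unfold k; assert (Rmin d r <= d) by apply Rmin_l; lra).
  assert (Hkr : k < r) by (unfold k in *; assert (Rmin d r <= r) by apply Rmin_r; lra).
  assert (Hk' : Rabs k = k) by (apply Rabs_pos_eq; lra).
  assert (H1 := H k ltac:(lra)).
  assert (H2 := H (- k) ltac:(rewrite Rabs_Ropp; lra)).
  rewrite Rabs_Ropp in H2. rewrite Hk' in H1, H2.
  assert (I1 : Int (nu (u + k) v)).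
  { apply Hn, Hr. change (Rabs (u + k - u) < r). replace (u + k - u) with k by ring. lra. }
  assert (I2 : Int (nu (u + - k) v)).
  { apply Hn, Hr. change (Rabs (u + - k - u) < r). replace (u + - k - u) with (- k) by ring.
    rewrite Rabs_Ropp. lra. }
  assert (E : 0 < Rabs m / 2 * k) by (apply Rmult_lt_0_compat; lra).
  apply (locally_Rabs _ _ (Rabs m / 2 * k)); trivial.
  intros t Ht. apply Rabs_le_between in H1, H2. apply Rabs_lt_between in Ht.
  destruct (Rcase_abs m) as [L|L].
  - rewrite (Rabs_left m L) in *. apply (HI (nu (u + k) v) (nu (u + - k) v)); trivial. lra.
  - rewrite (Rabs_right m L) in *. apply (HI (nu (u + - k) v) (nu (u + k) v)); trivial. lra.
Qed.

(** The integrals [I] (and [J], exchanging [f] and [g]) as functions of two variables, for a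
    function [nu] with values in [Int]. *)
Section Weingarten.
Variables (Int : R -> Prop) (f g : R -> R) (D : R * R -> Prop) (nu : R -> R -> R) (t0 : R).
Hypothesis Int_interval : interval Int.
Hypothesis f_smooth : smooth1 Int f.
Hypothesis g_smooth : smooth1 Int g.
Hypothesis fg : forall t, Int t -> f t - g t <> 0.
Hypothesis D_open : open D.
Hypothesis nu_smooth : smooth2 D nu.
Hypothesis nu_Int : forall u v, D (u, v) -> Int (nu u v).
Hypothesis nu_regular : forall u v, D (u, v) -> du nu u v <> 0.
Hypothesis t0_Int : Int t0.

Let phi (t : R) : R := Derive f t / (f t - g t).

Lemma weingarten_integrand_continuous t : Int t -> continuous phi t.
Proof.
  intros Ht. apply @ex_derive_continuous. unfold phi.
  apply @ex_derive_div.
  - exact (f_smooth 2%nat t Ht).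
  - apply @ex_derive_minus; [exact (f_smooth 1%nat t Ht)|exact (g_smooth 1%nat t Ht)].
  - now apply fg.
Qed.

Lemma Wint_partials :
  has_partials D (Wint f g t0 nu) (fun u v => phi (nu u v) * du nu u v)
                                  (fun u v => phi (nu u v) * dv nu u v).
Proof.
  apply (has_partials_comp D (fun t => RInt phi t0 t) phi nu (du nu) (dv nu)).
  - intros u v Huv.
    apply (is_derive_RInt phi (fun t => RInt phi t0 t) t0 (nu u v)).
    + assert (H := interior_value Int D nu u v Int_interval D_open nu_smooth nu_Int Huv
                     (nu_regular u v Huv)).
      revert H. apply filter_imp. intros t Ht.
      apply @RInt_correct, @ex_RInt_continuous. intros s Hs.
      apply weingarten_integrand_continuous. unfold Rmin, Rmax in Hs.
      destruct (Rle_dec t0 t); [now apply (Int_interval t0 t)|now apply (Int_interval t t0)].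
    + now apply weingarten_integrand_continuous, nu_Int.
  - now apply smooth2_partials.
Qed.

Lemma Wint_smooth : smooth2 D (Wint f g t0 nu).
Proof.
  assert (Sphi : smooth2 D (fun u v => phi (nu u v))).
  { apply smooth2_mult; trivial.
    - apply smooth2_comp; trivial. intros m u v Huv.
      now apply ex_derive_n_Derive, f_smooth, nu_Int.
    - apply smooth2_inv; trivial.
      + intros u v Huv. now apply fg, nu_Int.
      + apply smooth2_minus; trivial; apply smooth2_comp; trivial; intros m u v Huv;
          [now apply f_smooth, nu_Int|now apply g_smooth, nu_Int]. }
  assert (Su : smooth2 D (fun u v => phi (nu u v) * du nu u v))
    by (apply smooth2_mult; trivial; now apply smooth2_du).
  assert (Sv : smooth2 D (fun u v => phi (nu u v) * dv nu u v))
    by (apply smooth2_mult; trivial; now apply smooth2_dv).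
  apply (smooth2_intro D _ _ _ D_open) with (2 := Wint_partials); trivial.
  intros u v Huv. apply (has_partials_continuity D _ _ _ u v D_open Wint_partials Huv);
    now apply smooth2_continuity with D.
Qed.

(** The relation [df = (f - g) dI]. *)
Lemma Wint_relation u v : D (u, v) ->
  du (fun u v => f (nu u v)) u v = du (Wint f g t0 nu) u v * (f (nu u v) - g (nu u v)) /\
  dv (fun u v => f (nu u v)) u v = dv (Wint f g t0 nu) u v * (f (nu u v) - g (nu u v)).
Proof.
  intros Huv.
  assert (P : has_partials D (fun u v => f (nu u v)) (fun u v => Derive f (nu u v) * du nu u v)
                (fun u v => Derive f (nu u v) * dv nu u v)).
  { apply has_partials_comp with (dphi := Derive f); [|now apply smooth2_partials].
    intros s t Hst. apply Derive_correct, (f_smooth 1%nat), nu_Int, Hst. }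
  assert (N := fg _ (nu_Int u v Huv)).
  rewrite (has_partials_du _ _ _ _ _ _ P Huv), (has_partials_dv _ _ _ _ _ _ P Huv),
    (has_partials_du _ _ _ _ _ _ Wint_partials Huv),
    (has_partials_dv _ _ _ _ _ _ Wint_partials Huv).
  unfold phi. split; field; trivial.
Qed.

Lemma Wint_nonzero u v : D (u, v) -> Derive f (nu u v) <> 0 ->
  du nu u v <> 0 -> dv nu u v <> 0 ->
  du (Wint f g t0 nu) u v <> 0 /\ dv (Wint f g t0 nu) u v <> 0.
Proof.
  intros Huv Hf Hu Hv.
  rewrite (has_partials_du _ _ _ _ _ _ Wint_partials Huv),
    (has_partials_dv _ _ _ _ _ _ Wint_partials Huv).
  assert (N : phi (nu u v) <> 0).
  { unfold phi, Rdiv. apply Rmult_integral_contrapositive_currified; trivial.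
    now apply Rinv_neq_0_compat, fg, nu_Int. }
  split; now apply Rmult_integral_contrapositive_currified.
Qed.

End Weingarten.

Lemma regular_principal_surface_subset (D D' : R * R -> Prop) z l :
  (forall w, D' w -> D w) -> regular_principal_surface D z l -> regular_principal_surface D' z l.
Proof.
  intros Hs ((S1 & S2 & S3) & SL & UN & PP & SR).
  split; [|split; [|split; [|split]]].
  - split; [|split]; now apply smooth2_subset with D.
  - intros u v Huv. apply SL, Hs, Huv.
  - intros u v Huv. apply UN, Hs, Huv.
  - intros u v Huv. apply PP, Hs, Huv.
  - intros u v Huv. apply SR, Hs, Huv.
Qed.

Theorem theorem3p7 :
  forall (Int : R -> Prop) (f g : R -> R)
         (D : R * R -> Prop) (nu : R -> R -> R) (u0 v0 a b : R),
    interval Int ->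
    smooth1 Int f -> smooth1 Int g ->
    (forall t, Int t -> f t - g t <> 0) ->
    (forall t, Int t -> Derive f t * Derive g t <> 0) ->
    planar_domain D ->
    smooth2 D nu ->
    (forall u v, D (u, v) -> du nu u v * dv nu u v <> 0) ->
    (forall u v, D (u, v) -> Int (nu u v)) ->
    D (u0, v0) ->
    0 < a -> 0 < b ->
    let I := Wint f g (nu u0 v0) nu in
    let J := Wint g f (nu u0 v0) nu in
    (forall u v, D (u, v) ->
       a ^ 2 * exp (2 * I u v)
         * (du (du J) u v + du I u v * du J u v - (du J u v) ^ 2)
       + b ^ 2 * exp (2 * J u v)
         * (dv (dv I) u v + dv I u v * dv J u v - (dv I u v) ^ 2)
       = - f (nu u v) * g (nu u v)) ->
    let S (D' : R * R -> Prop) (z l : surface) :=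
      regular_principal_surface D' z l /\
      W_surface Int f g D' z l /\
      has_invariants D' z l
        (fun u v => f (nu u v)) (fun u v => g (nu u v))
        (fun u v => b * exp (J u v) * dv I u v)
        (fun u v => - a * exp (I u v) * du J u v) in
    exists D0 : R * R -> Prop,
      planar_domain D0 /\ D0 (u0, v0) /\ (forall p, D0 p -> D p) /\
      exists z l : surface,
        S D0 z l /\
        natural_principal Int f g (nu u0 v0) nu D0 z l /\
        (* uniqueness, also over any smaller neighborhood of (u0, v0) *)
        (forall (D1 : R * R -> Prop) (z' l' : surface),
           planar_domain D1 -> D1 (u0, v0) -> (forall p, D1 p -> D0 p) ->
           S D1 z' l' ->
           exists T, motion T /\ forall u v, D1 (u, v) -> z' u v = T (z u v)).
Proof.
  intros Int f g D nu u0 v0 a b HInt Sf Sg Hfg Hdfg HD Sn Hdn Hn H0 Ha Hb I J HG S.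
  assert (OD : open D) by apply HD.
  assert (Hgf : forall t, Int t -> g t - f t <> 0)
    by (intros t Ht; specialize (Hfg t Ht); lra).
  assert (Hdn' : forall u v, D (u, v) -> du nu u v <> 0 /\ dv nu u v <> 0).
  { intros u v Huv. specialize (Hdn u v Huv). split; intros E; rewrite E in Hdn; lra. }
  assert (Hdnu : forall u v, D (u, v) -> du nu u v <> 0) by (intros; now apply Hdn').
  assert (Hd' : forall t, Int t -> Derive f t <> 0 /\ Derive g t <> 0).
  { intros t Ht. specialize (Hdfg t Ht). split; intros E; rewrite E in Hdfg; lra. }
  assert (Ht0 : Int (nu u0 v0)) by now apply Hn.
  assert (SI : smooth2 D I) by now apply Wint_smooth with Int.
  assert (SJ : smooth2 D J) by now apply Wint_smooth with Int.
  assert (RI := Wint_relation Int f g D nu (nu u0 v0) HInt Sf Sg Hfg OD Sn Hn Hdnu Ht0).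
  assert (RJ := Wint_relation Int g f D nu (nu u0 v0) HInt Sg Sf Hgf OD Sn Hn Hdnu Ht0).
  assert (NI := Wint_nonzero Int f g D nu (nu u0 v0) HInt Sf Sg Hfg OD Sn Hn Hdnu Ht0).
  assert (NJ := Wint_nonzero Int g f D nu (nu u0 v0) HInt Sg Sf Hgf OD Sn Hn Hdnu Ht0).
  fold I in RI, NI. fold J in RJ, NJ.
  set (p := fun u v => / a * exp (- I u v)). set (q := fun u v => / b * exp (- J u v)).
  set (n1 := fun u v => f (nu u v)) in *. set (n2 := fun u v => g (nu u v)) in *.
  set (g1 := fun u v => b * exp (J u v) * dv I u v) in *.
  set (g2 := fun u v => - a * exp (I u v) * du J u v) in *.
  assert (SdI := smooth2_dv _ _ SI). assert (SdJ := smooth2_du _ _ SJ).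
  assert (Sp : smooth2 D p).
  { apply smooth2_mult; [trivial|now apply smooth2_const|].
    now apply smooth2_exp, smooth2_opp. }
  assert (Sq : smooth2 D q).
  { apply smooth2_mult; [trivial|now apply smooth2_const|].
    now apply smooth2_exp, smooth2_opp. }
  assert (Sn1 : smooth2 D n1)
    by (apply smooth2_comp; trivial; intros m u v Huv; now apply Sf, Hn).
  assert (Sn2 : smooth2 D n2)
    by (apply smooth2_comp; trivial; intros m u v Huv; now apply Sg, Hn).
  assert (Sg1 : smooth2 D g1).
  { apply smooth2_mult; trivial. apply smooth2_mult; [trivial|now apply smooth2_const|].
    now apply smooth2_exp. }
  assert (Sg2 : smooth2 D g2).
  { apply smooth2_mult; trivial. apply smooth2_mult; [trivial|now apply smooth2_const|].
    now apply smooth2_exp. }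
  assert (Pp := has_partials_mult _ _ _ _ _ _ _ (has_partials_const D (/ a))
    (has_partials_exp _ _ _ _ (has_partials_opp _ _ _ _ (smooth2_partials _ _ SI)))).
  assert (Pq := has_partials_mult _ _ _ _ _ _ _ (has_partials_const D (/ b))
    (has_partials_exp _ _ _ _ (has_partials_opp _ _ _ _ (smooth2_partials _ _ SJ)))).
  assert (Pg1 := has_partials_mult _ _ _ _ _ _ _
    (has_partials_mult _ _ _ _ _ _ _ (has_partials_const D b)
      (has_partials_exp _ _ _ _ (smooth2_partials _ _ SJ)))
    (smooth2_partials _ _ SdI)).
  assert (Pg2 := has_partials_mult _ _ _ _ _ _ _
    (has_partials_mult _ _ _ _ _ _ _ (has_partials_const D (- a))
      (has_partials_exp _ _ _ _ (smooth2_partials _ _ SI)))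
    (smooth2_partials _ _ SdJ)).
  cbv beta in Pp, Pq, Pg1, Pg2.
  match type of Pp with has_partials _ _ ?hu ?hv => change (has_partials D p hu hv) in Pp end.
  match type of Pq with has_partials _ _ ?hu ?hv => change (has_partials D q hu hv) in Pq end.
  match type of Pg1 with has_partials _ _ ?hu ?hv => change (has_partials D g1 hu hv) in Pg1 end.
  match type of Pg2 with has_partials _ _ ?hu ?hv => change (has_partials D g2 hu hv) in Pg2 end.
  assert (Hexp : forall t, 0 < exp t) by apply exp_pos.
  destruct (surface_of_invariants D u0 v0 p q n1 n2 g1 g2 OD H0 Sp Sq Sn1 Sn2 Sg1 Sg2)
    as (r & Hr & Hs & z & l & Rz & Iz & EG).
  - intros u v Huv. assert (Hi := Hn u v Huv). destruct (Hdn' u v Huv) as [N1 N2].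
    destruct (Hd' _ Hi) as [F1 G1].
    destruct (NI u v Huv F1 N1 N2) as [_ Iv]. destruct (NJ u v Huv G1 N1 N2) as [Ju _].
    assert (Pa : 0 < / a) by now apply Rinv_0_lt_compat.
    assert (Pb : 0 < / b) by now apply Rinv_0_lt_compat.
    split; [now apply Rmult_lt_0_compat|split; [now apply Rmult_lt_0_compat|]].
    assert (E1 := Hexp (J u v)). assert (E2 := Hexp (I u v)).
    unfold g1, g2. repeat apply Rmult_integral_contrapositive_currified; trivial;
      [now apply Hfg| | | |]; lra.
  - intros u v Huv. assert (E1 := Hexp (J u v)). assert (E2 := Hexp (I u v)).
    rewrite (has_partials_dv _ _ _ _ _ _ Pp Huv), (has_partials_du _ _ _ _ _ _ Pq Huv).
    unfold g1, g2, p, q. rewrite !exp_Ropp. split; field; lra.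
  - intros u v Huv. assert (E1 := Hexp (J u v)). assert (E2 := Hexp (I u v)).
    destruct (RI u v Huv) as [_ ->]. destruct (RJ u v Huv) as [-> _].
    unfold g1, g2, p, q, n1, n2. rewrite !exp_Ropp. split; field; lra.
  - intros u v Huv. assert (E1 := Hexp (J u v)). assert (E2 := Hexp (I u v)).
    rewrite (has_partials_dv _ _ _ _ _ _ (has_partials_mult _ _ _ _ _ _ _ Pg1 Pp) Huv),
      (has_partials_du _ _ _ _ _ _ (has_partials_mult _ _ _ _ _ _ _ Pg2 Pq) Huv).
    assert (G := HG u v Huv).
    replace (2 * I u v) with (I u v + I u v) in G by ring.
    replace (2 * J u v) with (J u v + J u v) in G by ring.
    rewrite !exp_plus in G.
    (* the equation assumed for [nu] is the Gauss equation, solved for [nu1 nu2] *)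
    assert (G' : n1 u v * n2 u v =
      - (a ^ 2 * (exp (I u v) * exp (I u v))
         * (du (du J) u v + du I u v * du J u v - (du J u v) ^ 2)
       + b ^ 2 * (exp (J u v) * exp (J u v))
         * (dv (dv I) u v + dv I u v * dv J u v - (dv I u v) ^ 2)))
      by (unfold n1, n2; rewrite G; ring).
    rewrite G'. unfold g1, g2, p, q. rewrite !exp_Ropp. field. lra.
  - assert (W : W_surface_via Int f g nu (square u0 v0 r) z l).
    { split; [|split].
      - now split; [|split; [|split]].
      - now apply smooth2_subset with D.
      - intros u v Huv. split; [now apply Hn, Hs|].
        destruct (Iz u v Huv) as (E1 & E2 & _). now split. }
    exists (square u0 v0 r).
    split; [now apply square_domain|].
    split; [now apply square_center|].
    split; [trivial|].
    exists z, l. split; [|split].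
    + split; [trivial|split; [now exists nu|trivial]].
    + split; [trivial|]. split; [apply Rz|].
      split; [exists (/ a)|exists (/ b)]; intros u v Huv; destruct (EG u v Huv) as [E G].
      * fold I. rewrite E. unfold p.
        rewrite sqrt_pow2 by (apply Rlt_le, Rmult_lt_0_compat;
          [now apply Rinv_0_lt_compat|apply exp_pos]).
        rewrite exp_Ropp. assert (E2 := Hexp (I u v)). field. lra.
      * fold J. rewrite G. unfold q.
        rewrite sqrt_pow2 by (apply Rlt_le, Rmult_lt_0_compat;
          [now apply Rinv_0_lt_compat|apply exp_pos]).
        rewrite exp_Ropp. assert (E2 := Hexp (J u v)). field. lra.
    + intros D1 z' l' HD1 H1 Hsub (Rz' & _ & Iz').
      assert (Hsub' : forall w, D1 w -> D w) by auto.
      apply (congruence_of_invariants D1 z l z' l' n1 n2 g1 g2 u0 v0); trivial.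
      * now apply smooth2_subset with D.
      * now apply smooth2_subset with D.
      * now apply regular_principal_surface_subset with (square u0 v0 r).
      * intros u v Huv. apply Iz, Hsub, Huv.
Qed.
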